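(* Let $n\ge3$, $p>p_S:=\frac{n+2}{n-2}$ and $q_c:=\frac{n(p-1)}{2}$. There exist constants $C>0$ and $0<\varepsilon_1<1$ depending only on $n$ and $p$ such that the following holds. Let $u$ be a classical solution of $u_t=\Delta u+|u|^{p-1}u$ in $\mathbf{R}^n\times(-1,0]$ satisfying $$\sup_{-1<t<0}\|u(\cdot,t)\|_{L^{q_c,\infty}(\mathbf{R}^n)}\le M$$ with a constant $M>1$. Let $0<\varepsilon<\varepsilon_0:=M^{-2(p+1)^2}\varepsilon_1^{2(p+1)}$. If $$\delta^{\frac4{p-1}-n}\int_{t_0-\delta^2}^{t_0-\delta^2/2}\int_{B(x_0,A\delta)}|u(x,t)|^{p+1}\,dx\,dt\le\varepsilon$$ for some $x_0\in\mathbf{R}^n$, $-1/16<t_0\le0$, $0<\delta<1/4$ and $A>\left(24\log(M^{p+1}/\varepsilon)\right)^{1/2}$, then $$\|u\|_{L^\infty(Q((x_0,t_0),\delta/4))}\le CM\varepsilon^{\frac1{2(p+1)^2}}\delta^{-\frac2{p-1}},\qquad \|\nabla u\|_{L^\infty(Q((x_0,t_0),\delta/4))}\le CM\varepsilon^{\frac1{2(p+1)^2}}\delta^{-\frac{p+1}{p-1}} .$$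
   Context: A classical solution on $\mathbf{R}^n\times(-1,0]$ is a real-valued function $u\in C^{2,1}(\mathbf{R}^n\times(-1,0])$ (twice continuously differentiable in space, once in time, up to and including $t=0$) satisfying the equation. $B(x,r)=\{y\in\mathbf{R}^n:|x-y|<r\}$ and $Q((x,t),r)=B(x,r)\times(t-r^2,t)$. $L^{q,\infty}$ is the weak Lebesgue (Lorentz) space, $\|f\|_{L^{q,\infty}}=\sup_{\lambda>0}\lambda\,|\{|f|>\lambda\}|^{1/q}$. *)

(* Defs.v *)
From HB Require Import structures.
From mathcomp Require Import all_boot all_order all_algebra.
From mathcomp Require Import all_classical all_reals all_analysis.

Set Implicit Arguments.
Unset Strict Implicit.
Unset Printing Implicit Defensive.

Import Order.TTheory GRing.Theory Num.Theory.
Import numFieldNormedType.Exports.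

Local Open Scope classical_set_scope.
Local Open Scope ring_scope.

(* Row vectors carry the product sigma-algebra, as tuples do in the library;
   on 'rV[R]_n with R : realType it is the Borel sigma-algebra of R^n. *)
Section measurable_row.
Context {d : measure_display} {T : sigmaRingType d}.
Variable n : nat.

Let coors : 'I_n -> 'rV[T]_n -> T := fun i x => x ord0 i.

Let row_set0 : g_sigma_preimage coors set0.
Proof. exact: sigma_algebra0. Qed.

Let row_setC A : g_sigma_preimage coors A -> g_sigma_preimage coors (~` A).
Proof. exact: sigma_algebraC. Qed.

Let row_bigcup (F : _^nat) : (forall i, g_sigma_preimage coors (F i)) ->
  g_sigma_preimage coors (\bigcup_i (F i)).
Proof. exact: sigma_algebra_bigcup. Qed.

HB.instance Definition _ := @isMeasurable.Build (measure_tuple_display d)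
  'rV[T]_n (g_sigma_preimage coors) row_set0 row_setC row_bigcup.

End measurable_row.

Lemma measurable_coord d (T : sigmaRingType d) n (i : 'I_n) :
  measurable_fun [set: 'rV[T]_n] (fun x : 'rV[T]_n => x ord0 i).
Proof.
move=> _ Y mY; rewrite setTI; apply: sub_sigma_algebra => /=.
rewrite -bigcup_seq/=; exists i => /=; first by rewrite mem_index_enum.
by exists Y => //; rewrite setTI.
Qed.

Lemma measurable_fun_rowP d1 d2 (T1 : measurableType d1)
    (T2 : measurableType d2) n (f : T1 -> 'rV[T2]_n) :
  measurable_fun [set: T1] f <->
  forall i, measurable_fun [set: T1] (fun x => f x ord0 i).
Proof.
split=> [mf i|mf].
  exact: measurableT_comp (measurable_coord i) mf.
have H : g_sigma_preimage (fun i x => f x ord0 i) `<=` @measurable _ T1.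
  apply: smallest_sub; first exact: sigma_algebra_measurable.
  rewrite -bigcup_seq/=; apply: bigcup_sub => i _ A [B mB <-]; exact: mf.
move=> _ A mA; rewrite setTI; apply: H.
rewrite (g_sigma_preimage_comp (fun i (x : 'rV[T2]_n) => x ord0 i) f).
by exists A => //; rewrite setTI.
Qed.

Lemma sigma_finite_measure_of d (T : measurableType d) (R : realType)
    (m : set T -> \bar R) :
  m set0 = 0%E -> (forall A, (0 <= m A)%E) -> semi_sigma_additive m ->
  sigma_finite setT m ->
  {mu : {sigma_finite_measure set T -> \bar R} |
    (mu : set T -> \bar R) = m}.
Proof.
move=> m0 m_ge0 msa msf.
pose H1 := isMeasure.Build _ _ _ m m0 m_ge0 msa.
pose m1 : {measure set T -> \bar R} := HB.pack m H1.
pose H2 := @Measure_isSigmaFinite.Build _ T R m1 msf.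
pose m2 : {sigma_finite_measure set T -> \bar R} :=
  HB.pack (Measure.sort m1) H1 H2.
by exists m2.
Qed.

Section lebesgue_rV.
Context {R : realType}.

Definition row_cons n (z : measurableTypeR R * 'rV[R]_n) : 'rV[R]_n.+1 :=
  \row_j oapp (z.2 ord0) z.1 (unlift ord0 j).

Let row_uncons n (x : 'rV[R]_n.+1) : measurableTypeR R * 'rV[R]_n :=
  (x ord0 ord0, \row_j x ord0 (lift ord0 j)).

Lemma row_cons0 n z : @row_cons n z ord0 ord0 = z.1.
Proof. by rewrite mxE unlift_none. Qed.

Lemma row_consS n z j : @row_cons n z ord0 (lift ord0 j) = z.2 ord0 j.
Proof. by rewrite mxE liftK. Qed.

Let row_consK n : cancel (@row_cons n) (@row_uncons n).
Proof.
move=> [a x]; rewrite /row_uncons row_cons0/=; congr pair.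
by apply/rowP => j; rewrite mxE row_consS.
Qed.

Let row_unconsK n : cancel (@row_uncons n) (@row_cons n).
Proof.
move=> x; apply/rowP => j; case: (unliftP ord0 j) => [k|] ->.
  by rewrite row_consS/= mxE.
by rewrite row_cons0.
Qed.

Lemma measurable_row_cons n : measurable_fun setT (@row_cons n).
Proof.
apply/measurable_fun_rowP => j; case: (unliftP ord0 j) => [k|] ->.
  under eq_fun do rewrite row_consS.
  exact: measurableT_comp (measurable_coord k) measurable_snd.
under eq_fun do rewrite row_cons0.
exact: measurable_fst.
Qed.

Let measurable_row_uncons n : measurable_fun setT (@row_uncons n).
Proof.
apply: measurable_fun_pair; first exact: measurable_coord.
apply/measurable_fun_rowP => j; under eq_fun do rewrite mxE.
exact: measurable_coord.
Qed.

(* n-dimensional Lebesgue measure: one-dimensional Lebesgue measure times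
   (n-1)-dimensional Lebesgue measure, transported along
   (a, (x_1, .., x_{n-1})) |-> (a, x_1, .., x_{n-1}). *)
Fixpoint lebesgue_rV n : set 'rV[R]_n -> \bar R :=
  match n with
  | 0 => \d_(0 : 'rV[R]_0)
  | m.+1 => pushforward (lebesgue_measure \x @lebesgue_rV m)%E (@row_cons m)
  end.

Let lebesgue_rV_sfm n :
  {mu : {sigma_finite_measure set 'rV[R]_n -> \bar R} |
    (mu : set 'rV[R]_n -> \bar R) = @lebesgue_rV n}.
Proof.
elim: n => [|n [mu IH]].
  by exists (@dirac _ 'rV[R]_0 0 R : {finite_measure set _ -> \bar R}).
rewrite /= -IH.
pose nu : {measure set (measurableTypeR R * 'rV[R]_n)%type -> \bar R} :=
  (lebesgue_measure \x mu)%E.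
pose pf : set 'rV[R]_n.+1 -> \bar R :=
  pushforward (nu : set _ -> \bar R) (@row_cons n).
have pf_sf : sigma_finite setT pf.
  have /sigma_finiteP[F [TF ndF Foo]] := sigma_finiteT (@lebesgue_measure R).
  have /sigma_finiteP[G [TG ndG Goo]] := sigma_finiteT mu.
  exists (fun k => @row_uncons n @^-1` (F k `*` G k)).
    apply/esym; rewrite -subTset -preimage_bigcup => x _ /=.
    have [k _ Fk] : (\bigcup_k F k) (@row_uncons n x).1 by rewrite -TF.
    have [l _ Gl] : (\bigcup_k G k) (@row_uncons n x).2 by rewrite -TG.
    exists (maxn k l) => //; split.
      by move: Fk; exact/subsetPset/ndF/leq_maxl.
    by move: Gl; exact/subsetPset/ndG/leq_maxr.
  move=> k; have [mF Fk] := Foo k; have [mG Gk] := Goo k; split.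
    rewrite -[X in measurable X]setTI.
    by apply: measurable_row_uncons => //; exact: measurableX.
  rewrite /pf /pushforward -comp_preimage.
  rewrite (_ : _ \o _ = id); last by apply/funext => z; exact: row_consK.
  by rewrite /= product_measure1E// lte_mul_pinfty// ge0_fin_numE.
have pf0 : pf set0 = 0%E by rewrite /pf /pushforward preimage_set0 measure0.
have mpre A : measurable A -> measurable (@row_cons n @^-1` A).
  by move=> mA; rewrite -[X in measurable X]setTI; exact: measurable_row_cons.
have pf_ge0 A : (0 <= pf A)%E by move=> /=; apply: (measure_ge0 nu).
have pf_sa : semi_sigma_additive pf.
  move=> F mF tF mUF; rewrite /pf /pushforward preimage_bigcup.
  apply: measure_semi_sigma_additive.
  - by move=> k; exact: mpre.
  - apply/trivIsetP => /= i j _ _ ij; rewrite -preimage_setI.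
    by move/trivIsetP : tF => /(_ _ _ _ _ ij) ->//; rewrite preimage_set0.
  - by rewrite -preimage_bigcup; exact: mpre.
exact: sigma_finite_measure_of pf0 pf_ge0 pf_sa pf_sf.
Qed.

Let lebesgue_rV0 n : @lebesgue_rV n set0 = 0%E.
Proof. by case: (lebesgue_rV_sfm n) => mu <-; exact: measure0. Qed.

Let lebesgue_rV_ge0 n A : (0 <= @lebesgue_rV n A)%E.
Proof. by case: (lebesgue_rV_sfm n) => mu <-; exact: measure_ge0. Qed.

Let lebesgue_rV_semi_sigma_additive n : semi_sigma_additive (@lebesgue_rV n).
Proof.
by case: (lebesgue_rV_sfm n) => mu <-; exact: measure_semi_sigma_additive.
Qed.

HB.instance Definition _ n := isMeasure.Build _ _ _ (@lebesgue_rV n)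
  (@lebesgue_rV0 n) (@lebesgue_rV_ge0 n) (@lebesgue_rV_semi_sigma_additive n).

Let lebesgue_rV_sigma_finite n : sigma_finite setT (@lebesgue_rV n).
Proof. by case: (lebesgue_rV_sfm n) => mu <-; exact: sigma_finiteT. Qed.

HB.instance Definition _ n := @Measure_isSigmaFinite.Build _ _ _
  (@lebesgue_rV n) (@lebesgue_rV_sigma_finite n).

Lemma lebesgue_rV_box n (A : 'I_n -> set R) : (forall i, measurable (A i)) ->
  lebesgue_rV [set x : 'rV[R]_n | forall i, A i (x ord0 i)] =
  (\big[mule/1]_(i < n) lebesgue_measure (A i))%E.
Proof.
elim: n => [|n IH] in A * => mA.
  rewrite big_ord0 /= diracE mem_set//= => -[]//.
have mB (B : 'I_n -> set R) : (forall i, measurable (B i)) ->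
    measurable [set x : 'rV[R]_n | forall i, B i (x ord0 i)].
  move=> mB; rewrite (_ : [set _ | _] =
      \big[setI/setT]_(i < n) ((fun x : 'rV[R]_n => x ord0 i) @^-1` B i)).
    apply: bigsetI_measurable => i _.
    by rewrite -[X in measurable X]setTI; exact: measurable_coord.
  rewrite -bigcap_seq; apply/seteqP; split => x /= h i.
    by move=> _; exact: h.
  by apply: (h i); rewrite /= mem_index_enum.
rewrite big_ord_recl -(IH (fun i => A (lift ord0 i)))//=.
pose B := [set x : 'rV[R]_n | forall i, A (lift ord0 i) (x ord0 i)].
have mBA : measurable B by exact: (mB (fun i => A (lift ord0 i)) (fun i => mA _)).
transitivity ((lebesgue_measure \x @lebesgue_rV n)%E (A ord0 `*` B)); last first.
  exact: (@product_measure1E _ _ (measurableTypeR R) _ R lebesgue_measure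
    (@lebesgue_rV n) (A ord0) B (mA ord0) mBA).
rewrite /pushforward; congr (_ _); apply/seteqP; split => -[a x]/=.
  move=> h; split; first by have := h ord0; rewrite row_cons0.
  by move=> i; have := h (lift ord0 i); rewrite row_consS.
move=> [h0 h] j; case: (unliftP ord0 j) => [k|] ->.
  by rewrite row_consS; exact: h.
by rewrite row_cons0.
Qed.

End lebesgue_rV.

Section euclidean.
Context {R : realType} {n : nat}.
Implicit Types (x : 'rV[R]_n) (f : 'rV[R]_n -> R).

(* The library's norm on 'rV[R]_n is the sup norm. *)
Definition enorm x : R := Num.sqrt (\sum_(i < n) x ord0 i ^+ 2).

Definition eball x (r : R) : set 'rV[R]_n := [set y | enorm (x - y) < r].

(* Q((x, t), r) = B(x, r) x (t - r^2, t) *)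
Definition pcylinder (z : 'rV[R]_n * R) (r : R) : set ('rV[R]_n * R) :=
  eball z.1 r `*` `]z.2 - r ^+ 2, z.2[.

Definition partial (i : 'I_n) f x : R := 'D_(delta_mx ord0 i) f x.

Definition gradient f x : 'rV[R]_n := \row_i partial i f x.

Definition laplacian f x : R := \sum_(i < n) partial i (partial i f) x.

Definition weak_Lnorm (q : R) f : \bar R :=
  ereal_sup [set (l%:E * lebesgue_rV [set x | (l < `|f x|)%R] `^ (q^-1)%R)%E
            | l in `]0, +oo[].

(* L^oo(Q) norm with respect to the Lebesgue measure on R^n x R *)
Definition Linfty_norm_on (Q : set ('rV[R]_n * R)) (g : 'rV[R]_n * R -> R) :
    \bar R :=
  Lnorm (@lebesgue_rV R n \x lebesgue_measure)%E +oo%E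
    (fun z => (g z * \1_Q z)%:E).

End euclidean.

Section classical_solution.
Context {R : realType} {n : nat}.
Implicit Types u : 'rV[R]_n -> R -> R.

(* Increments are restricted to those staying in ]-1, 0], so the derivative at
   t = 0 is the left derivative. *)
Definition time_increments (t : R) : set_system R :=
  within [set h | t + h \in `]-1, 0]] 0^'.

Definition time_quotient u (x : 'rV[R]_n) (t h : R) : R :=
  h^-1 * (u x (t + h) - u x t).

Definition time_derivable u x t : Prop :=
  cvg (time_quotient u x t @ time_increments t).

Definition time_derivative u x t : R :=
  lim (time_quotient u x t @ time_increments t).

Definition strip : set ('rV[R]_n * R) := [set: 'rV[R]_n] `*` `]-1, 0].

Definition is_C21 u : Prop :=
  [/\ {within strip, continuous (fun z => u z.1 z.2)},
      forall i : 'I_n,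
        (forall x t, t \in `]-1, 0] -> derivable (u^~ t) x (delta_mx ord0 i)) /\
        {within strip, continuous (fun z => partial i (u^~ z.2) z.1)},
      forall i j : 'I_n,
        (forall x t, t \in `]-1, 0] ->
          derivable (partial i (u^~ t)) x (delta_mx ord0 j)) /\
        {within strip,
          continuous (fun z => partial j (partial i (u^~ z.2)) z.1)}
    & (forall x t, t \in `]-1, 0] -> time_derivable u x t) /\
      {within strip, continuous (fun z => time_derivative u z.1 z.2)}].

(* classical solution of u_t = Laplacian u + |u|^(p-1) u on R^n x (-1, 0];
   only the values of u at times in (-1, 0] are constrained *)
Definition classical_solution (p : R) u : Prop :=
  is_C21 u /\
  forall x t, t \in `]-1, 0] ->
    time_derivative u x t =
      laplacian (u^~ t) x + `|u x t| `^ (p - 1) * u x t.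

End classical_solution.

(* Main.v *)
(** Rescale so that [x0 = 0], [t0 = 0] and [delta = 1].  For a centre [c] and a final time
[t1], consider the energy of Giga and Kohn, whose weight is the backward heat kernel
centred at [(c, t1)], localized by a cutoff to the ball of radius [A].  Up to errors
supported near the boundary of that ball it is nonincreasing in time.  There the kernel is
[O(A^(-n) e / M^(p+1))], because [A^2 > 24 ln (M^(p+1) / e)], while the weak norm bounds
the integral of [|u|^(p+1)] by [O(A^n M^(p+1))]; so the errors are [O(e)], and smallness of
the integral of [|u|^(p+1)] over times in [(-1, -1/2)] propagates: at some time [xi]
slightly before [t1], the weighted integral of [|u|^(p+1)] is [O(e^(1/(p+1)))].

On the other hand, let [(x1, t1)] maximize [dist^(2/(p-1)) |u|] over a unit cylinder,
[dist] being the parabolic distance to its boundary.  Around [(x1, t1)], [|u|] is at most a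
constant times its value there, so by the maximum principle and the interior gradient bound
it remains comparable to that value on some ball at time [xi].  Comparing with the energy
bound shows that the maximum is [O(e^(1/(p+1)^2))]; the bound on the gradient of [u] follows
from the interior gradient bound. *)

Require Import Defs.
From HB Require Import structures.
From mathcomp Require Import all_boot all_order all_algebra.
From mathcomp Require Import all_classical all_reals all_analysis.
From mathcomp Require Import measurable_realfun ess_sup_inf.
From mathcomp Require Import ring lra.
Import Order.TTheory GRing.Theory Num.Theory.
Import numFieldNormedType.Exports.
Local Open Scope classical_set_scope.
Local Open Scope ring_scope.

(** * Lebesgue measure under affine maps *)

Section rV_measurable.
Context {R : realType}.

(** The obstacle is regularity. The gradient of a C^{2,1} solution need not be differentiable in
    time, nor its second derivatives in space, whereas the usual derivation of the energy identity
    differentiates |grad u|^2. Here difference quotients, in time or along translations, are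
    integrated by parts before the limit is taken.

    The errors near the boundary of the ball contain the integral of |grad u|^2, which the weak norm
    does not control. A small multiple of a local integral of u^2 is added to the energy; its time
    derivative produces this integral with the good sign.

    The negative part of the energy carries a factor t1 - t and [u] is bounded up to t1, so the
    energy is almost nonnegative. Its total drop is then at most its small initial value, and the
    dissipation is small at some time of (t1 - h, t1 - h/4), for every h.

    One factor 1/(p+1) of the final exponent comes from the level e^(1/(p+1)) at which u^2 is
    interpolated between a constant and |u|^(p+1); the other from taking the root of a lower bound
    in |u|^(p+1). *)

Lemma measurable_rV_box n (B : 'I_n -> set R) :
  (forall i, measurable (B i)) ->
  measurable [set x : 'rV[R]_n | forall i, B i (x ord0 i)].
Proof.
move=> mB; rewrite (_ : [set _ | _] =
    \big[setI/setT]_(i < n) ((fun x : 'rV[R]_n => x ord0 i) @^-1` B i)).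
  apply: bigsetI_measurable => i _.
  by rewrite -[X in measurable X]setTI; exact: measurable_coord.
rewrite -bigcap_seq; apply/seteqP; split => x /= h i.
  by move=> _; exact: h.
by apply: (h i); rewrite /= mem_index_enum.
Qed.

Lemma ball_rVP n (x y : 'rV[R]_n) (e : R) :
  ball x e y <-> 0 < e /\ forall i, `|x ord0 i - y ord0 i| < e.
Proof.
split => [[e0 h]|[e0 h]]; split => //.
  by move=> i; exact: h.
by move=> i j; rewrite (ord1 i); exact: h.
Qed.

(** The sigma-algebra is generated by the coordinates and the topology by the sup norm: an open set
    is the union of the boxes with rational centre and half-side 1/(k+1) that it contains, and these
    are countably many. *)
Lemma open_measurable_rV n (A : set 'rV[R]_n) : open A -> measurable A.
Proof.
move=> oA.
pose box (q : 'rV[rat]_n * nat) : set 'rV[R]_n :=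
  [set x | forall i, `](ratr (q.1 ord0 i) - q.2.+1%:R^-1)%R,
                      (ratr (q.1 ord0 i) + q.2.+1%:R^-1)%R[%classic (x ord0 i)].
have -> : A = \bigcup_q (if `[< box q `<=` A >] then box q else set0).
  apply/seteqP; split => x; last by move=> [q _]; case: asboolP => // h /h.
  move=> Ax; have /nbhs_ballP[e /= e0 eA] := open_nbhs_nbhs (conj oA Ax).
  have [k _ hk] := near_infty_natSinv_lt (PosNum (divr_gt0 e0 (ltr0n R 2))).
  have {}hk : k.+1%:R^-1 < e / 2 by exact: (hk _ (leqnn k)).
  have k0 : 0 < k.+1%:R^-1 :> R by rewrite invr_gt0.
  have /choice[q hq] : forall i : 'I_n, exists q : rat,
      ratr q \in `](x ord0 i - k.+1%:R^-1), (x ord0 i + k.+1%:R^-1)[.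
    by move=> i; apply: rat_in_itvoo; move: k0; move: _^-1 => s k0; lra.
  have xb : box (\row_i q i, k) x.
    move=> i /=; rewrite !mxE; have := hq i; rewrite !in_itv/=.
    move: (k.+1%:R^-1) (ratr _) => s z.
    by move=> /andP[? ?]; apply/andP; split; lra.
  exists (\row_i q i, k) => //; case: asboolP => // -[].
  move=> y hy; apply: eA; apply/ball_rVP; split => // i.
  have := hy i; have := xb i; rewrite /= !mxE !in_itv/= ltr_norml.
  move: hk; move: (k.+1%:R^-1) (ratr _) => s z hk.
  by move=> /andP[? ?] /andP[? ?]; apply/andP; split; lra.
apply: countable_bigcupT_measurable; first exact: countableP.
move=> q; case: ifP => // _.
apply: (@measurable_rV_box _ (fun i => `](ratr (q.1 ord0 i) - q.2.+1%:R^-1)%R,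
  (ratr (q.1 ord0 i) + q.2.+1%:R^-1)%R[%classic)) => i.
exact: measurable_itv.
Qed.

Lemma continuous_measurable_rV n (f : 'rV[R]_n -> R) :
  continuous f -> measurable_fun setT f.
Proof.
move=> cf; apply: (measurability _ (measurable_realfun.RGenOpens.measurableE R)).
move=> _ [_ [a [b ->] <-]]; rewrite setTI.
by apply: open_measurable_rV; apply: open_comp => //.
Qed.

Lemma closed_measurable_rV n (A : set 'rV[R]_n) : closed A -> measurable A.
Proof.
move=> cA; rewrite -(setCK A); apply: measurableC.
by apply: open_measurable_rV; exact: closed_openC.
Qed.
End rV_measurable.

(** The measure structure of a pushforward depends on the proof that the map is measurable. Naming
    the instance lets it be scaled and passed to the uniqueness theorems. *)
Definition pushforward_mea d d' (T1 : measurableType d) (T2 : measurableType d')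
    (R : realType) (m : {measure set T1 -> \bar R}) (f : T1 -> T2)
    (mf : measurable_fun setT f) : {measure set T2 -> \bar R} :=
  measure_function_pushforward__canonical__measure_function_Measure m mf.

Section rV_affine.
Context {R : realType}.
Implicit Types c : R.

Definition affine_rV n (c : R) (b x : 'rV[R]_n) : 'rV[R]_n := c *: x + b.

Lemma measurable_affine_rV n c (b : 'rV[R]_n) :
  measurable_fun setT (affine_rV n c b).
Proof.
apply/measurable_fun_rowP => i; rewrite /affine_rV.
under eq_fun do rewrite !mxE.
apply: measurable_funD => //; apply: measurable_funM => //.
exact: measurable_coord.
Qed.

(** The scaled pushforward agrees with Lebesgue measure on half-open intervals, which determine
    it. *)
Lemma lebesgue_measure_affine c (b : R) (A : set R) : 0 < c -> measurable A ->
  (c%:E * lebesgue_measure ((fun x : R => (c * x + b)%R) @^-1` A) =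
   lebesgue_measure A)%E.
Proof.
move=> c0 mA.
pose T0 (x : measurableTypeR R) : measurableTypeR R := (c * x + b)%R.
have mT : measurable_fun setT T0.
  by apply: measurable_funD => //; apply: measurable_funM.
pose mu : {measure set (measurableTypeR R) -> \bar R} :=
  mscale (NngNum (ltW c0)) (pushforward_mea _ _ _ _ _ (@lebesgue_measure R) T0 mT).
apply/esym; apply: (@lebesgue_measure_unique _ mu) => //.
move=> _ [[x y] _ <-].
rewrite /mu /= /mscale /= /pushforward /T0.
have -> : (fun x : R => c * x + b) @^-1` `]x, y]%classic =
    `](x - b) / c, (y - b) / c]%classic.
  apply/seteqP; split => z /=; rewrite !in_itv /= ltr_pdivrMr// ler_pdivlMr//.
    by move=> /andP[? ?]; apply/andP; split; lra.
  by move=> /andP[? ?]; apply/andP; split; lra.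
rewrite !lebesgue_measure_itv /= !lte_fin ltr_pM2r ?invr_gt0// ltrD2r.
case: ifPn => xy; last by rewrite mule0.
rewrite -EFinD -EFinM; congr EFin; field; exact: lt0r_neq0.
Qed.

(** Conjugated with [row_cons], the map is the product of an affine map of the line and one of the
    remaining coordinates. By uniqueness of the product measure it is enough to look at rectangles,
    where the induction hypothesis applies. *)
Lemma lebesgue_rV_affine n c (b : 'rV[R]_n) (A : set 'rV[R]_n) :
  0 < c -> measurable A ->
  ((c ^+ n)%:E * lebesgue_rV (affine_rV n c b @^-1` A) = lebesgue_rV A)%E.
Proof.
move=> c0; elim: n => [|n IH] in b A * => mA.
  rewrite expr0 mul1e /lebesgue_rV !diracE; congr (_%:E); congr (_%:R).
  congr nat_of_bool; apply/idP/idP => /set_mem h; apply/mem_set; move: h.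
    by rewrite /= (_ : affine_rV _ _ _ _ = 0)//; apply/rowP => -[].
  by rewrite /= (_ : affine_rV _ _ _ _ = 0)//; apply/rowP => -[].
rewrite /= /pushforward.
pose b0 := b ord0 ord0; pose b' : 'rV[R]_n := \row_j b ord0 (lift ord0 j).
pose S (z : measurableTypeR R * 'rV[R]_n) : measurableTypeR R * 'rV[R]_n :=
  (c * z.1 + b0, affine_rV n c b' z.2).
have mS : measurable_fun setT S.
  apply: measurable_fun_pair.
    by apply: measurable_funD => //; apply: measurable_funM.
  by apply: measurableT_comp measurable_snd; exact: measurable_affine_rV.
have cn0 : 0 <= c ^+ n.+1 by rewrite exprn_ge0// ltW.
pose nu : {measure set (measurableTypeR R * 'rV[R]_n)%type -> \bar R} :=
  (@lebesgue_measure R \x @lebesgue_rV R n)%E.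
pose mu : {measure set (measurableTypeR R * 'rV[R]_n)%type -> \bar R} :=
  mscale (NngNum cn0) (pushforward_mea _ _ _ _ _ nu S mS).
have mB : measurable (@row_cons R n @^-1` A).
  by rewrite -[X in measurable X]setTI; exact: measurable_row_cons.
transitivity (mu (@row_cons R n @^-1` A)).
  rewrite /mu /= /mscale /= /pushforward /nu /=; congr (_ * _)%E.
  congr (product_measure1 _ _ _); apply/seteqP; split => z /=.
    rewrite (_ : affine_rV _ _ _ _ = row_cons (S z))//.
    apply/rowP => j; rewrite !mxE.
    by case: unliftP => [k|] -> //=; rewrite /affine_rV !mxE.
  rewrite (_ : affine_rV _ _ _ _ = row_cons (S z))//.
  apply/rowP => j; rewrite !mxE.
  by case: unliftP => [k|] -> //=; rewrite /affine_rV !mxE.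
apply/esym.
apply: (@product_measure_unique _ _ _ _ _ (@lebesgue_measure R) (@lebesgue_rV R n) mu _ _ mB) => B C' mB' mC.
rewrite /mu /= /mscale /= /pushforward /nu /=.
have -> : S @^-1` (B `*` C') =
  ((fun x : R => c * x + b0) @^-1` B) `*` (affine_rV n c b' @^-1` C') by [].
rewrite product_measure1E; first last.
- by rewrite -[X in measurable X]setTI; exact: measurable_affine_rV.
- rewrite -[X in measurable X]setTI.
  by apply: measurable_funD => //; apply: measurable_funM.
rewrite exprS EFinM muleACA lebesgue_measure_affine// IH//.
Qed.

Lemma ge0_integral_affine n c (b : 'rV[R]_n) (f : 'rV[R]_n -> \bar R) :
  0 < c -> measurable_fun setT f -> (forall x, 0 <= f x)%E ->
  ((c ^+ n)%:E * \int[@lebesgue_rV R n]_x f (affine_rV n c b x) =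
   \int[@lebesgue_rV R n]_x f x)%E.
Proof.
move=> c0 mf f0.
have cn0 : 0 <= c ^+ n by rewrite exprn_ge0// ltW.
pose mu : {measure set 'rV[R]_n -> \bar R} :=
  mscale (NngNum cn0) (pushforward_mea _ _ _ _ _ (@lebesgue_rV R n) _ (measurable_affine_rV n c b)).
transitivity (\int[mu]_x f x)%E.
  rewrite ge0_integral_mscale//=.
  rewrite (ge0_integral_pushforward (measurable_affine_rV n c b))//.
apply: eq_measure_integral => A mA _.
by rewrite /mu /= /mscale /= /pushforward lebesgue_rV_affine.
Qed.
End rV_affine.

(** * Calculus for compactly supported functions *)

Section calculus.
Context {R : realType}.

Section alg.
Context {V : normedModType R}.
Implicit Types (f g : V -> R) (x v : V).

Lemma dD f g x v df dg : is_derive x v f df -> is_derive x v g dg ->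
  is_derive x v (fun y => f y + g y) (df + dg).
Proof. exact: is_deriveD. Qed.

Lemma dB f g x v df dg : is_derive x v f df -> is_derive x v g dg ->
  is_derive x v (fun y => f y - g y) (df - dg).
Proof. exact: is_deriveB. Qed.

Lemma dN f x v df : is_derive x v f df ->
  is_derive x v (fun y => - f y) (- df).
Proof. exact: is_deriveN. Qed.

Lemma dM f g x v df dg : is_derive x v f df -> is_derive x v g dg ->
  is_derive x v (fun y => f y * g y) (f x * dg + g x * df).
Proof. exact: is_deriveM. Qed.

Lemma dC (c : R) x v : is_derive x v (fun=> c) 0.
Proof. exact: is_derive_cst. Qed.

Lemma dZ (c : R) f x v df : is_derive x v f df ->
  is_derive x v (fun y => c * f y) (c * df).
Proof. exact: is_deriveZ. Qed.

Lemma dS m (f : 'I_m -> V -> R) x v (df : 'I_m -> R) :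
  (forall i, is_derive x v (f i) (df i)) ->
  is_derive x v (fun y => \sum_i f i y) (\sum_i df i).
Proof.
move=> h; rewrite (_ : (fun _ => _) = \sum_(i < m) f i); first exact: is_derive_sum.
by apply/funext => y; rewrite fct_sumE.
Qed.

Lemma dE f x v a b : is_derive x v f a -> a = b -> is_derive x v f b.
Proof. by move=> h <-. Qed.

(** Together with [d_at_line], this identifies directional derivatives with one-variable derivatives
    along lines, so that the chain rule and the mean value theorem carry over from the real line. *)
Lemma d_line f x v s d : is_derive (s *: v + x) v f d ->
  is_derive s 1 (fun r : R => f (r *: v + x)) d.
Proof.
have E : (fun h : R => h^-1 *: (((fun r : R => f (r *: v + x)) \o shift s) (h *: (1 : R)) -
      (fun r : R => f (r *: v + x)) s)) =
    (fun h => h^-1 *: ((f \o shift (s *: v + x)) (h *: v) - f (s *: v + x))).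
  by apply/funext => h /=; rewrite scaler1 scalerDl addrA.
by move=> [fd <-]; split; rewrite /derivable /derive E.
Qed.

Lemma d_at_line f x v d : is_derive (0 : R) 1 (fun r : R => f (r *: v + x)) d ->
  is_derive x v f d.
Proof.
have E : (fun h : R => h^-1 *: (((fun r : R => f (r *: v + x)) \o shift 0) (h *: (1 : R)) -
      (fun r : R => f (r *: v + x)) 0)) =
    (fun h => h^-1 *: ((f \o shift x) (h *: v) - f x)).
  by apply/funext => h /=; rewrite scaler1 addr0 scale0r add0r.
by move=> [fd <-]; split; move: fd; rewrite /derivable /derive E.
Qed.

End alg.

Lemma dcomp {V : normedModType R} (f : V -> R) (h : R -> R) x v df dh :
  is_derive x v f df -> is_derive (f x) 1 h dh ->
  is_derive x v (fun y => h (f y)) (dh * df).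
Proof.
move=> H1 H2; apply: d_at_line.
have H1' : is_derive (0 : R) 1 (fun r : R => f (r *: v + x)) df.
  by apply: d_line; rewrite scale0r add0r.
have H2' : is_derive (f (0 *: v + x)) 1 h dh by rewrite scale0r add0r.
exact: (@is_derive1_comp _ h (fun r : R => f (r *: v + x)) 0 _ _ H2' H1').
Qed.

Lemma d_cont (f : R -> R) (x d : R) : is_derive x 1 f d -> {for x, continuous f}.
Proof. by move=> [h _]; apply/differentiable_continuous/derivable1_diffP. Qed.

Lemma MVT_oo (f df : R -> R) (a b : R) : a < b ->
  (forall x, a <= x <= b -> is_derive x 1 f (df x)) ->
  exists2 c, a < c < b & f b - f a = df c * (b - a).
Proof.
move=> ab h; have [||c hc E] := @MVT R f df a b ab.
- by move=> z; rewrite in_itv/= => /andP[? ?]; apply: h; lra.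
- apply: continuous_in_subspaceT => z; rewrite inE/= in_itv/= => /h.
  exact: d_cont.
by exists c => //; move: hc; rewrite in_itv.
Qed.

Lemma MVT_bound (f df : R -> R) (a b C : R) (x y : R) :
  (forall z, a < z < b -> is_derive z 1 f (df z)) ->
  (forall z, a < z < b -> `|df z| <= C) ->
  a < x < b -> a < y < b -> `|f y - f x| <= C * `|y - x|.
Proof.
move=> h1 h2; wlog xy : x y / x <= y.
  move=> W hx hy; have [xy|/ltW xy] := leP x y; first exact: W.
  by rewrite (distrC (f y)) (distrC y); exact: W.
move=> hx hy; move: xy; rewrite le_eqVlt => /predU1P[->|xy].
  by rewrite !subrr normr0 mulr0.
have [|c hc ->] := @MVT_oo f df x y xy; first by move=> z hz; apply: h1; lra.
by rewrite normrM ler_wpM2r//; apply: h2; lra.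
Qed.
End calculus.

Section continuity.
Context {R : realType} {T : topologicalType}.
Implicit Types f g : T -> R.
Lemma cD f g : continuous f -> continuous g -> continuous (fun x => f x + g x).
Proof. by move=> cf cg x; apply: cvgD; [exact: cf|exact: cg]. Qed.
Lemma cB f g : continuous f -> continuous g -> continuous (fun x => f x - g x).
Proof. by move=> cf cg x; apply: cvgB; [exact: cf|exact: cg]. Qed.
Lemma cN f : continuous f -> continuous (fun x => - f x).
Proof. by move=> cf x; apply: cvgN; exact: cf. Qed.
Lemma cM f g : continuous f -> continuous g -> continuous (fun x => f x * g x).
Proof. by move=> cf cg x; apply: cvgM; [exact: cf|exact: cg]. Qed.
Lemma cC (c : R) : continuous (fun _ : T => c).
Proof. by move=> x; exact: cvg_cst. Qed.
Lemma cX f k : continuous f -> continuous (fun x => f x ^+ k).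
Proof.
move=> cf; elim: k => [|k IH]; first by rewrite (_ : (fun _ => _) = fun=> 1)//; exact: cC.
rewrite (_ : (fun _ => _) = fun x => f x * f x ^+ k); first exact: cM.
by apply/funext => x; rewrite exprS.
Qed.
Lemma cS m (f : 'I_m -> T -> R) : (forall i, continuous (f i)) ->
  continuous (fun x => \sum_i f i x).
Proof.
move=> h; rewrite (_ : (fun _ => _) = \sum_(i < m) f i); last first.
  by apply/funext => y; rewrite fct_sumE.
elim/big_ind : _ => //; first exact: (@cC 0).
by move=> a b ca cb; exact: cD.
Qed.
Lemma cA f : continuous f -> continuous (fun x => `|f x|).
Proof. by move=> cf x; apply: cvg_norm; exact: cf. Qed.
Lemma cMax f g : continuous f -> continuous g ->
  continuous (fun x => Num.max (f x) (g x)).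
Proof. by move=> cf cg x; apply: (@continuous_max _ _ f g); [exact: cf|exact: cg]. Qed.
Lemma cMin f g : continuous f -> continuous g ->
  continuous (fun x => Num.min (f x) (g x)).
Proof. by move=> cf cg x; apply: (@continuous_min _ _ f g); [exact: cf|exact: cg]. Qed.
Lemma ccomp {S : topologicalType} (f : T -> S) (g : S -> R) :
  continuous f -> continuous g -> continuous (fun x => g (f x)).
Proof. by move=> cf cg x; apply: continuous_comp; [exact: cf|exact: cg]. Qed.
Lemma cpair {S1 S2 : topologicalType} (f : T -> S1) (g : T -> S2) :
  continuous f -> continuous g -> continuous (fun x => (f x, g x)).
Proof. by move=> cf cg x; apply: cvg_pair; [exact: cf|exact: cg]. Qed.
End continuity.

Section slices.
Context {R : realType} {S T : topologicalType}.
Lemma cslice1 (f : S -> T -> R) t : continuous (fun z => f z.1 z.2) ->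
  continuous (fun x => f x t).
Proof.
move=> cf; apply: (@ccomp _ _ _ (fun x => (x, t)) (fun z => f z.1 z.2)) => //.
by apply: cpair; [move=> x; exact: cvg_id|move=> x; exact: cvg_cst].
Qed.
Lemma cslice2 (f : S -> T -> R) x : continuous (fun z => f z.1 z.2) ->
  continuous (fun t => f x t).
Proof.
move=> cf; apply: (@ccomp _ _ _ (fun t => (x, t)) (fun z => f z.1 z.2)) => //.
by apply: cpair; [move=> t; exact: cvg_cst|move=> t; exact: cvg_id].
Qed.
End slices.

Section cube.
Context {R : realType} {n : nat}.
Implicit Types x : 'rV[R]_n.

Lemma coord_le_norm x i : `|x ord0 i| <= `|x|.
Proof.
have /mapP[j Hj ->] : `|x ord0 i| \in [seq `|x y.1 y.2| | y : 'I_1 * 'I_n].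
  by apply/mapP; exists (ord0, i) => //=; rewrite mem_enum.
by rewrite -[leRHS]/(mx_norm x) mx_normrE; apply/bigmax_geP; right => /=; exists j.
Qed.

Lemma norm_leP x (N : R) : 0 <= N -> (forall i, `|x ord0 i| <= N) -> `|x| <= N.
Proof.
move=> N0 h; rewrite -[leLHS]/(mx_norm x) mx_normrE; apply/bigmax_leP; split => //.
by move=> [i j] _ /=; rewrite (ord1 i).
Qed.

Lemma closed_cube (N : R) : closed [set x : 'rV[R]_n | `|x| <= N].
Proof.
have c : continuous (fun x : 'rV[R]_n => `|x| : R) by exact: (@norm_continuous R 'rV[R]_n).
rewrite (_ : [set _ | _] = (fun x : 'rV[R]_n => `|x| : R) @^-1` [set y | y <= N])//.
apply: closed_comp; last exact: closed_le.
by move=> x _; exact: c.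
Qed.

Lemma compact_cube (N : R) : compact [set x : 'rV[R]_n | `|x| <= N].
Proof.
apply: bounded_closed_compact; last exact: closed_cube.
by exists N; split; [exact: num_real|move=> y yN x /= xN; apply: le_trans xN (ltW yN)].
Qed.

Lemma cont_bounded_cube (f : 'rV[R]_n -> R) (N : R) : continuous f ->
  exists2 C, 0 <= C & forall x, `|x| <= N -> `|f x| <= C.
Proof.
move=> cf; have := @continuous_compact _ _ f _ (continuous_subspaceT cf) (@compact_cube N).
move=> /compact_bounded [M [_ hM]]; exists (`|M| + 1) => // x xN.
by apply: (hM (`|M| + 1)) => //; rewrite (le_lt_trans (ler_norm _))// ltrDl.
Qed.

Lemma cont_bounded_cyl (f : 'rV[R]_n * R -> R) (N a b : R) : continuous f ->
  exists2 C, 0 <= C & forall x t, `|x| <= N -> a <= t <= b -> `|f (x, t)| <= C.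
Proof.
move=> cf; have cc := @compact_setX _ _ _ _ (@compact_cube N) (@segment_compact R a b).
have := @continuous_compact _ _ f _ (continuous_subspaceT cf) cc.
move=> /compact_bounded [M [_ hM]]; exists (`|M| + 1) => // x t xN ht.
apply: (hM (`|M| + 1)) => //; first by rewrite (le_lt_trans (ler_norm _))// ltrDl.
by exists (x, t) => //; split => //=; rewrite in_itv.
Qed.
End cube.

#[export] Hint Extern 0 (0 <= `|_|) => exact: normr_ge0 : core.

(** * Integrals of continuous functions of bounded support *)

Section integral.
Context {R : realType} {n : nat}.
Notation mu := (@lebesgue_rV R n).
Implicit Types f g : 'rV[R]_n -> R.

Definition I (f : 'rV[R]_n -> R) : R := \int[mu]_x f x.

(** The bound is in the sup norm of row vectors, so supports lie in cubes, whose measure is a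
    product of lengths. *)
Definition supp_in (N : R) f := forall x, N < `|x| -> f x = 0.

Definition Cc f := continuous f /\ exists N, supp_in N f.

Lemma measurable_cube (N : R) : measurable [set x : 'rV[R]_n | `|x| <= N].
Proof. by apply: closed_measurable_rV; exact: closed_cube. Qed.

Lemma cube_box (N : R) : 0 <= N -> [set x : 'rV[R]_n | `|x| <= N] =
  [set x | forall i, `[(- N)%R, N]%classic (x ord0 i)].
Proof.
move=> N0; apply/seteqP; split => x /=.
  by move=> xN i; rewrite in_itv/= -ler_norml (le_trans (coord_le_norm _ _)).
by move=> h; apply: norm_leP => // i; rewrite ler_norml; have := h i; rewrite in_itv.
Qed.

Lemma lebesgue_cube (N : R) : 0 <= N ->
  mu [set x : 'rV[R]_n | `|x| <= N] = ((2 * N) ^+ n)%:E.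
Proof.
move=> N0; rewrite cube_box//.
rewrite (lebesgue_rV_box (A := fun=> `[(- N)%R, N]%classic)); last first.
  by move=> i; exact: measurable_itv.
transitivity (\big[mule/1%E]_(i < n) (2 * N)%:E)%E.
  apply: eq_bigr => i _; rewrite lebesgue_measure_itv/= lte_fin.
  case: ifPn; first by rewrite -EFinD opprK => _; congr EFin; lra.
  by rewrite -leNgt => h; congr EFin; lra.
by rewrite prodEFin prodr_const card_ord.
Qed.

Lemma lebesgue_cube_fin (N : R) : (mu [set x : 'rV[R]_n | (`|x| <= N)%R] < +oo)%E.
Proof.
have [N0|N0] := leP 0 N; first by rewrite lebesgue_cube// ltry.
rewrite (_ : [set _ | _] = set0) ?measure0 ?ltry//.
apply/seteqP; split => x //=; have := normr_ge0 x; lra.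
Qed.

Lemma supp_integrable (N C : R) f : measurable_fun setT f -> supp_in N f ->
  (forall x, `|f x| <= C) -> mu.-integrable setT (EFin \o f).
Proof.
move=> mf sf bf.
have -> : f = f \_ [set x : 'rV[R]_n | `|x| <= N].
  apply/funext => x; rewrite patchE; case: ifPn => //.
  by rewrite notin_setE /= => /negP; rewrite -ltNge => /sf.
rewrite -restrict_EFin; apply/(integrable_mkcond _ (measurable_cube N)).
apply: measurable_bounded_integrable.
- exact: measurable_cube.
- exact: lebesgue_cube_fin.
- exact: measurable_funTS.
- exists C; split; first exact: num_real.
  by move=> M CM x _ /=; apply: le_trans (bf x) (ltW CM).
Qed.

Lemma Cc_bounded f : Cc f -> exists C, forall x, `|f x| <= C.
Proof.
move=> [cf [N sf]]; have [C C0 hC] := cont_bounded_cube _ N cf.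
exists C => x; have [/hC//|/sf ->] := leP `|x| N.
by rewrite normr0.
Qed.

Lemma Cc_integrable f : Cc f -> mu.-integrable setT (EFin \o f).
Proof.
move=> cf; have [C hC] := Cc_bounded _ cf; case: cf => cf [N sf].
by apply: supp_integrable sf hC; exact: continuous_measurable_rV.
Qed.

Lemma CcD f g : Cc f -> Cc g -> Cc (fun x => f x + g x).
Proof.
move=> [cf [N sf]] [cg [M sg]]; split; first exact: cD.
by exists (Num.max N M) => x; rewrite gt_max => /andP[/sf -> /sg ->]; rewrite addr0.
Qed.
Lemma CcMl f g : Cc f -> continuous g -> Cc (fun x => f x * g x).
Proof.
move=> [cf [N sf]] cg; split; first exact: cM.
by exists N => x /sf ->; rewrite mul0r.
Qed.
Lemma CcMr f g : continuous f -> Cc g -> Cc (fun x => f x * g x).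
Proof.
move=> cf [cg [N sf]]; split; first exact: cM.
by exists N => x /sf ->; rewrite mulr0.
Qed.
Lemma CcN f : Cc f -> Cc (fun x => - f x).
Proof. by move=> [cf [N sf]]; split; [exact: cN|exists N => x /sf ->; rewrite oppr0]. Qed.
Lemma CcB f g : Cc f -> Cc g -> Cc (fun x => f x - g x).
Proof. by move=> cf cg; apply: CcD => //; exact: CcN. Qed.
Lemma Cc0 : Cc (fun _ : 'rV[R]_n => 0).
Proof. by split; [exact: cC|exists 0]. Qed.
Lemma CcZ (c : R) f : Cc f -> Cc (fun x => c * f x).
Proof. by move=> cf; apply: CcMr => //; exact: cC. Qed.
Lemma CcS m (f : 'I_m -> 'rV[R]_n -> R) : (forall i, Cc (f i)) ->
  Cc (fun x => \sum_i f i x).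
Proof.
move=> h; rewrite (_ : (fun _ => _) = \sum_(i < m) f i); last first.
  by apply/funext => y; rewrite fct_sumE.
by elim/big_ind : _ => //; [exact: Cc0|move=> a b ca cb; exact: CcD].
Qed.

Lemma I_D f g : Cc f -> Cc g -> I (fun x => f x + g x) = I f + I g.
Proof. by move=> cf cg; rewrite /I RintegralD//; exact: Cc_integrable. Qed.
Lemma I_B f g : Cc f -> Cc g -> I (fun x => f x - g x) = I f - I g.
Proof. by move=> cf cg; rewrite /I RintegralB//; exact: Cc_integrable. Qed.
Lemma I_Z (c : R) f : Cc f -> I (fun x => c * f x) = c * I f.
Proof. by move=> cf; rewrite /I RintegralZl//; exact: Cc_integrable. Qed.
Lemma I_N f : Cc f -> I (fun x => - f x) = - I f.
Proof.
move=> cf; rewrite -mulN1r -I_Z//; congr I.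
by apply/funext => x; rewrite mulN1r.
Qed.
Lemma I0 : I (fun=> 0) = 0.
Proof. by rewrite /I /Rintegral integral0. Qed.
Lemma I_S m (f : 'I_m -> 'rV[R]_n -> R) : (forall i, Cc (f i)) ->
  I (fun x => \sum_i f i x) = \sum_i I (f i).
Proof.
elim: m f => [|m IH] f h.
  by rewrite big_ord0 -[RHS]I0; congr I; apply/funext => x; rewrite big_ord0.
rewrite big_ord_recr /= -(IH (fun i => f (widen_ord (leqnSn m) i)))// -I_D//.
  by congr I; apply/funext => x; rewrite big_ord_recr.
by apply: CcS => i.
Qed.
Lemma I_le f g : Cc f -> Cc g -> (forall x, f x <= g x) -> I f <= I g.
Proof. by move=> cf cg h; apply: le_Rintegral => //; exact: Cc_integrable. Qed.
Lemma I_ge0 f : (forall x, 0 <= f x) -> 0 <= I f.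
Proof. by move=> h; exact: Rintegral_ge0. Qed.
Lemma I_ext f g : (forall x, f x = g x) -> I f = I g.
Proof. by move=> h; congr I; exact/funext. Qed.

End integral.

(** * Differentiation under the integral *)

Section param.
Context {R : realType} {n : nat}.
Notation mu := (@lebesgue_rV R n).

Definition ev (i : 'I_n) : 'rV[R]_n := delta_mx ord0 i.

Lemma d_unique {V : normedModType R} (f : V -> R) (x v : V) a b :
  is_derive x v f a -> is_derive x v f b -> a = b.
Proof. by move=> [_ <-] [_ <-]. Qed.

Lemma cube_cst_integrable (N C : R) :
  mu.-integrable setT (EFin \o (fun x : 'rV[R]_n => C * \1_[set x : 'rV[R]_n | `|x| <= N] x)).
Proof.
apply: (@supp_integrable _ _ N `|C|).
- apply: measurable_funM => //; apply: measurable_indic; exact: measurable_cube.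
- move=> x Nx; rewrite indicE memNset ?mulr0//=.
  by apply/negP; rewrite -ltNge.
- move=> x; rewrite indicE normrM ler_piMr//; case: (_ \in _) => //=.
    by rewrite normr1.
  by rewrite normr0 ler01.
Qed.

(** Dominated convergence along sequences suffices for a limit in a punctured neighbourhood. The
    majorant is asked for [h != 0] because it is applied to difference quotients. *)
Lemma I_cvg_dnbhs (A : R -> 'rV[R]_n -> R) (A0 : 'rV[R]_n -> R) (N C : R) :
  (forall h, measurable_fun setT (A h)) ->
  measurable_fun setT A0 -> 0 <= C ->
  (forall h x, h != 0 -> `|A h x| <= C * \1_[set x : 'rV[R]_n | `|x| <= N] x) ->
  (forall x, A h x @[h --> 0^'] --> A0 x) ->
  I (A h) @[h --> 0^'] --> I A0.
Proof.
move=> mA mA0 C0 bA cA; apply/cvgr_dnbhsP => w [w0 wc].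
have cw x : A (w k) x @[k --> \oo] --> A0 x.
  by have /cvgr_dnbhsP := cA x; apply; split.
have [|||||i1 i2 i3] := @dominated_convergence _ _ _ mu setT measurableT
   (fun k x => (A (w k) x)%:E) (EFin \o A0)
   (EFin \o (fun x => C * \1_[set x : 'rV[R]_n | `|x| <= N] x)).
- by move=> k; apply/measurable_EFinP.
- exact/measurable_EFinP.
- by apply: aeW => x _; apply/fine_cvgP; split => /=; [exact: nearW|exact: cw].
- exact: cube_cst_integrable.
- by apply: aeW => x k _; rewrite /= lee_fin; exact: bA.
apply: fine_cvg; rewrite fineK; first exact: i3.
exact: integrable_fin_num.
Qed.

Lemma I_deriv (F F' : 'rV[R]_n -> R -> R) (a b t N C : R) : a < t < b -> 0 <= C ->
  (forall s, a < s < b -> continuous (F^~ s)) ->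
  (forall s, a < s < b -> supp_in N (F^~ s)) ->
  (forall x s, a < s < b -> is_derive s 1 (F x) (F' x s)) ->
  (forall x s, a < s < b -> `|F' x s| <= C) ->
  is_derive t 1 (fun s => I (F^~ s)) (I (F'^~ t)).
Proof.
move=> tab C0 cF sF dF bF.
have ain s : `]a, b[%classic s -> a < s < b by rewrite /= in_itv.
have tin : `]a, b[%classic t by rewrite /= in_itv.
pose G (x : 'rV[R]_n) := C * \1_[set x : 'rV[R]_n | `|x| <= N] x.
have p1 s x : a < s < b -> partial1of2 (fun s x => F x s) s x = F' x s.
  by move=> h; rewrite partial1of2E; have [_ ->] := dF x s h.
have iF s : `]a, b[%classic s -> mu.-integrable setT (EFin \o (fun x => F x s)).
  move=> /ain h; apply: Cc_integrable; split; first exact: cF.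
  by exists N; exact: sF.
have dF' s (x : 'rV[R]_n) : `]a, b[%classic s -> [set: 'rV[R]_n] x ->
    derivable ((fun s x => F x s)^~ x) s 1.
  by move=> /ain h _; have [] := dF x s h.
have G0 x : 0 <= G x by rewrite /G mulr_ge0.
have iG : mu.-integrable setT (EFin \o G) by exact: cube_cst_integrable.
have bG s (x : 'rV[R]_n) : `]a, b[%classic s -> [set: 'rV[R]_n] x ->
    `|partial1of2 (fun s x => F x s) s x| <= G x.
  move=> /ain h _; rewrite p1// /G indicE.
  have [xN|Nx] := leP `|x| N; first by rewrite mem_set// mulr1; exact: bF.
  (* Off the cube [F x] vanishes at all nearby times, hence so does its time derivative. *)
  rewrite (_ : F' x s = 0) ?normr0 ?mulr_ge0//.
  apply: (@d_unique _ (F x) s 1); first exact: dF.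
  apply: (@near_eq_is_derive _ _ _ (fun=> 0)).
  near=> r; rewrite (sF r)//; apply/andP; split; near: r.
    by apply: lt_nbhsr; case/andP: h.
  by apply: lt_nbhsl; case/andP: h.
have D1 := @derivable_under_integral _ _ _ mu (fun s x => F x s) setT
  measurableT t a b tin iF dF' G G0 iG bG.
have D2 := @differentiation_under_integral _ _ _ mu (fun s x => F x s) setT
  measurableT t a b tin iF dF' G G0 iG bG.
split; first exact: D1.
rewrite -derive1E D2; apply: I_ext => x; exact: p1.
Unshelve. all: by end_near. Qed.

Definition clamp (a b t : R) : R := Num.max a (Num.min t b).

Lemma clampE a b t : a <= t <= b -> clamp a b t = t.
Proof. by move=> /andP[at_ tb]; rewrite /clamp min_l// max_r. Qed.

Lemma clamp_in a b t : a <= b -> a <= clamp a b t <= b.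
Proof.
by move=> ab; rewrite /clamp le_max lexx/= ge_max ab/= ge_min lexx orbT.
Qed.

Lemma clamp_continuous a b : continuous (clamp a b).
Proof.
apply: (@cMax _ _ (fun=> a)); first exact: cC.
by apply: (@cMin _ _ id (fun=> b)); [move=> x; exact: cvg_id|exact: cC].
Qed.

(** Joint continuity on R^n x [a, b], encoded by clamping the time: the composition rules for
    functions continuous everywhere apply, and compactness of [a, b] gives uniform bounds on
    cylinders. *)
Definition cab (a b : R) (f : 'rV[R]_n -> R -> R) :=
  continuous (fun z : 'rV[R]_n * R => f z.1 (clamp a b z.2)).

Lemma cabD a b f g : cab a b f -> cab a b g -> cab a b (fun x t => f x t + g x t).
Proof. exact: cD. Qed.
Lemma cabM a b f g : cab a b f -> cab a b g -> cab a b (fun x t => f x t * g x t).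
Proof. exact: cM. Qed.
Lemma cab_slice a b f t : a <= t <= b -> cab a b f -> continuous (f^~ t).
Proof.
move=> h cf; have := @cslice1 R _ _ (fun x s => f x (clamp a b s)) t cf.
by rewrite clampE.
Qed.
Lemma cab_bound a b f N : cab a b f -> exists2 C, 0 <= C &
  forall x t, `|x| <= N -> a <= t <= b -> `|f x t| <= C.
Proof.
move=> cf; have [C C0 h] := cont_bounded_cyl _ N a b cf.
exists C => // x t xN tab.
by have := h x t xN tab; rewrite /= clampE.
Qed.

Lemma I_deriv_cab (F F' : 'rV[R]_n -> R -> R) (a b t N : R) : a < t < b ->
  cab a b F -> cab a b F' ->
  (forall s, a < s < b -> supp_in N (F^~ s)) ->
  (forall s, a < s < b -> supp_in N (F'^~ s)) ->
  (forall x s, a < s < b -> is_derive s 1 (F x) (F' x s)) ->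
  is_derive t 1 (fun s => I (F^~ s)) (I (F'^~ t)).
Proof.
move=> tab cF cF' sF sF' dF.
have [C C0 hC] := cab_bound _ _ _ N cF'.
apply: (@I_deriv _ _ a b t N C) => //.
  by move=> s h; apply: cab_slice cF; lra.
move=> x s h; have [xN|Nx] := leP `|x| N; first by apply: hC => //; lra.
by rewrite (sF' s h x Nx) normr0.
Qed.

Lemma I_cab_cont (F : 'rV[R]_n -> R -> R) (a b N : R) : a < b ->
  cab a b F -> (forall s, a < s < b -> supp_in N (F^~ s)) ->
  forall t, a < t < b -> {for t, continuous (fun s => I (F^~ s))}.
Proof.
move=> ab cF sF t tab.
have [C C0 hC] := cab_bound _ _ _ N cF.
have tin s : s \in `]a, b[%classic -> a < s < b by rewrite inE /= in_itv.
apply: (@continuity_under_integral _ _ _ mu (fun s x => F x s) setT measurableT a b _ _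
   (fun x => C * \1_[set x : 'rV[R]_n | `|x| <= N] x)).
- move=> s; rewrite /= in_itv/= => h; apply: Cc_integrable; split.
    by apply: cab_slice cF; lra.
  by exists N; exact: sF.
- apply: aeW => x _ s /tin h.
  have cs : continuous (fun r => F x (clamp a b r)) by exact: (@cslice2 R _ _ (fun x s => F x (clamp a b s)) x cF).
  rewrite /continuous_at -[X in _ --> F x X](@clampE a b); last lra.
  apply: cvg_trans (cs s); apply: near_eq_cvg; near=> r.
  rewrite clampE//; apply/andP; split; apply: ltW; near: r.
    by apply: lt_nbhsr; case/andP: h.
  by apply: lt_nbhsl; case/andP: h.
- exact: cube_cst_integrable.
- move=> s; rewrite /= in_itv/= => h; apply: aeW => x _.
  rewrite indicE; have [xN|Nx] := leP `|x| N.
    by rewrite mem_set// mulr1; apply: hC => //; lra.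
  by rewrite (sF s h x Nx) normr0 mulr_ge0.
- by rewrite inE /= in_itv.
Unshelve. all: by end_near. Qed.

Lemma cont_affine (c : R) (b : 'rV[R]_n) : continuous (fun x : 'rV[R]_n => c *: x + b).
Proof.
move=> x; apply: (@cvgD _ 'rV[R]_n _ (nbhs x) _ (fun x => c *: x) (fun=> b)).
  exact: scaler_continuous.
exact: cvg_cst.
Qed.

Lemma Cc_translate (f : 'rV[R]_n -> R) (b : 'rV[R]_n) (c : R) : 0 < c -> Cc f ->
  Cc (fun x => f (c *: x + b)).
Proof.
move=> c0 [cf [N sf]]; split.
  exact: (ccomp _ _ (cont_affine c b) cf).
exists ((`|N| + `|b|) / c) => x; rewrite ltr_pdivrMr// => h; apply: sf.
have : `|c *: x| <= `|c *: x + b| + `|b|.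
  by rewrite -[X in `|X| <= _](addrK b) (le_trans (ler_normB _ _)).
rewrite mx_normZ (gtr0_norm c0) -/(Num.norm x) => h2.
have := ler_norm N; move: h h2; rewrite mulrC; lra.
Qed.

(** The change of variables is known for nonnegative functions; here f = (f + |f|) - |f|. *)
Lemma I_affine (f : 'rV[R]_n -> R) (b : 'rV[R]_n) (c : R) : 0 < c -> Cc f ->
  c ^+ n * I (fun x => f (c *: x + b)) = I f.
Proof.
move=> c0.
have H g : Cc g -> (forall x, 0 <= g x) ->
    c ^+ n * I (fun x => g (c *: x + b)) = I g.
  move=> cg g0; have /(congr1 fine) := @ge0_integral_affine R n c b (EFin \o g) c0
    (proj2 (measurable_EFinP _ _) (@continuous_measurable_rV _ _ g cg.1)) (fun x => g0 x).
  move=> E; rewrite [RHS]/I /Rintegral -[RHS]E fineM//.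
  have /integrable_fin_num := Cc_integrable _ (Cc_translate _ b _ c0 cg).
  exact.
move=> cf.
have ca : Cc (fun x => `|f x|).
  split; first exact: cA cf.1.
  by case: cf => _ [N sf]; exists N => x /sf ->; rewrite normr0.
have cs : Cc (fun x => f x + `|f x|) by exact: CcD.
have -> : f = (fun x => (f x + `|f x|) - `|f x|) by apply/funext => x; rewrite addrK.
rewrite [RHS]I_B// (I_B (fun x => f (c *: x + b) + `|f (c *: x + b)|)
   (fun x => `|f (c *: x + b)|)); first last.
- exact: (Cc_translate _ b _ c0 ca).
- exact: (Cc_translate _ b _ c0 cs).
rewrite mulrBr (H (fun x => f x + `|f x|))// ?(H (fun x => `|f x|))//.
by move=> x; have := ler_norm (- f x); rewrite normrN; lra.
Qed.

Lemma supp_deriv (f f' : 'rV[R]_n -> R) v N : supp_in N f ->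
  (forall x, is_derive x v f (f' x)) -> supp_in N f'.
Proof.
move=> sf df x Nx; refine (@d_unique _ f x v _ _ (df x) _).
apply: (@near_eq_is_derive _ _ _ (fun=> 0)).
near=> y; rewrite sf//; near: y.
have /cvgr_gt : `|y| @[y --> x] --> (`|x| : R) by exact: (@norm_continuous R 'rV[R]_n).
exact.
Unshelve. all: by end_near. Qed.

Lemma CcV (f f' : 'rV[R]_n -> R) v : Cc f -> continuous f' ->
  (forall x, is_derive x v f (f' x)) -> Cc f'.
Proof. by move=> [_ [N sf]] cf df; split => //; exists N; exact: supp_deriv sf df. Qed.

(** By translation invariance the integral of f(s e_i + x) does not depend on s; its derivative at s
    = 0 is the integral of the partial derivative. This avoids Fubini. *)
Lemma I_div (f f' : 'rV[R]_n -> R) i : Cc f -> continuous f' ->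
  (forall x, is_derive x (ev i) f (f' x)) -> I f' = 0.
Proof.
move=> cf cf' df.
have cCf' := CcV _ _ _ cf cf' df.
have [C hC] := Cc_bounded _ cCf'.
have C0 : 0 <= C by exact: le_trans (hC 0).
case: (cf) => [ccf [N sf]].
have D : is_derive (0 : R) 1 (fun s => I (fun x => f (s *: ev i + x))) (I (fun x => f' (0 *: ev i + x))).
  apply: (@I_deriv (fun x s => f (s *: ev i + x)) (fun x s => f' (s *: ev i + x)) (-1) 1 0
     (N + `|ev i|) C) => //.
  - lra.
  - move=> s _; rewrite (_ : (fun _ => _) = fun x => f (1 *: x + s *: ev i)).
      exact: (ccomp _ _ (cont_affine 1 (s *: ev i)) ccf).
    by apply/funext => x; rewrite scale1r addrC.
  - move=> s /andP[s1 s2] x h; apply: sf.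
    have sev : `|s *: ev i| <= `|ev i|.
      by rewrite normrZ ler_piMl// ler_norml; lra.
    have : `|x| <= `|s *: ev i + x| + `|s *: ev i|.
      by rewrite -[X in `|X| <= _](addrK (s *: ev i)) (addrC x) ler_normB.
    lra.
  - by move=> x s _; apply: d_line; exact: df.
have E : (fun s : R => I (fun x => f (s *: ev i + x))) = fun=> I f.
  apply/funext => s; rewrite -[RHS](@I_affine f (s *: ev i) 1)// expr1n mul1r.
  by apply: I_ext => x; rewrite scale1r addrC.
rewrite E in D.
have -> : I f' = I (fun x => f' (0 *: ev i + x)).
  by apply: I_ext => x; rewrite scale0r add0r.
exact: (d_unique _ _ _ _ _ D (dC _ _ _)).
Qed.

Lemma I_ibp (f f' g g' : 'rV[R]_n -> R) i : Cc f -> continuous f' ->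
  continuous g -> continuous g' ->
  (forall x, is_derive x (ev i) f (f' x)) ->
  (forall x, is_derive x (ev i) g (g' x)) ->
  I (fun x => f x * g' x) = - I (fun x => f' x * g x).
Proof.
move=> cf cf' cg cg' df dg.
have ccf' := CcV _ _ _ cf cf' df.
have c1 : Cc (fun x => f x * g' x) by exact: CcMl.
have c2 : Cc (fun x => f' x * g x) by exact: CcMl.
apply/eqP; rewrite -addr_eq0 -I_D//; apply/eqP.
apply: (@I_div (fun x => f x * g x) _ i).
- exact: CcMl.
- by apply: cD; [exact: c1.1|exact: c2.1].
- move=> x; refine (dE _ _ _ _ _ (dM _ _ _ _ _ _ (df x) (dg x)) _).
  by rewrite (mulrC (g x)).
Qed.
End param.

Set Implicit Arguments.
Unset Strict Implicit.
Arguments dD {R V f g x v df dg} _ _.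
Arguments dB {R V f g x v df dg} _ _.
Arguments dN {R V f x v df} _.
Arguments dM {R V f g x v df dg} _ _.
Arguments dC {R V} c x v.
Arguments dZ {R V} c {f x v df} _.
Arguments dS {R V m f x v df} _.
Arguments dE {R V f x v a b} _ _.
Arguments d_line {R V f x v s d} _.
Arguments d_at_line {R V f x v d} _.
Arguments dcomp {R V f h x v df dh} _ _.
Arguments d_unique {R V f x v a b} _ _.
Section K.
Context {R : realType} {n : nat}.
Notation rV := 'rV[R]_n.

Lemma cab_const (a b : R) (f : rV -> R) : continuous f -> cab a b (fun x _ => f x).
Proof. by move=> cf; apply: (@ccomp _ _ _ (fun z : rV * R => z.1) f) => // z; exact: cvg_fst. Qed.

Lemma cabS (a b : R) m (f : 'I_m -> rV -> R -> R) : (forall i, cab a b (f i)) ->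
  cab a b (fun x t => \sum_i f i x t).
Proof. by move=> h; apply: (@cS _ _ m (fun i (z : rV * R) => f i z.1 (clamp a b z.2))). Qed.

Lemma cab_slice2 (a b : R) (f : rV -> R -> R) x t : a < t < b -> cab a b f ->
  {for t, continuous (f x)}.
Proof.
move=> h cF.
have cs := @cslice2 R _ _ (fun x s => f x (clamp a b s)) x cF.
rewrite /prop_for /continuous_at -[X in _ --> f x X](@clampE _ a b); last lra.
apply: cvg_trans (cs t); apply: near_eq_cvg; near=> r.
rewrite clampE//; apply/andP; split; apply: ltW; near: r.
  by apply: lt_nbhsr; case/andP: h.
by apply: lt_nbhsl; case/andP: h.
Unshelve. all: by end_near. Qed.

Lemma quot_bound (f df : R -> R) (a b C t h : R) : 
  (forall z, a < z < b -> is_derive z 1 f (df z)) ->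
  (forall z, a < z < b -> `|df z| <= C) -> a < t < b -> a < h + t < b -> h != 0 ->
  `|h^-1 * (f (h + t) - f t)| <= C.
Proof.
move=> h1 h2 t1 t2 h0; rewrite normrM normfV mulrC ler_pdivrMr ?normr_gt0//.
by apply: le_trans (MVT_bound _ _ _ _ _ _ _ h1 h2 t1 t2) _; rewrite addrK.
Qed.

Lemma quot_cvg (f : R -> R) (t d : R) : is_derive t 1 f d ->
  h^-1 * (f (h + t) - f t) @[h --> 0^'] --> d.
Proof.
move=> [fd <-]; move: fd; rewrite /derivable /derive.
rewrite (_ : (fun h : R => h^-1 *: ((f \o shift t) (h *: 1) - f t)) =
  (fun h => h^-1 * (f (h + t) - f t)))//.
by apply/funext => h; rewrite /= scaler1.
Qed.

Lemma shift_cvg (f : R -> R) (t : R) : {for t, continuous f} ->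
  f (h + t) @[h --> 0^'] --> f t.
Proof.
move=> cf; have c0 : h + t @[h --> 0^'] --> t.
  rewrite -[X in _ --> X]add0r; apply: cvgD; last exact: cvg_cst.
  by move=> A; exact: nbhs_dnbhs.
exact: (cvg_comp _ _ c0 cf).
Qed.

Lemma is_derive_quot (f : R -> R) (t d : R) :
  h^-1 * (f (h + t) - f t) @[h --> 0^'] --> d -> is_derive t 1 f d.
Proof.
move=> H.
have E : (fun h : R => h^-1 *: ((f \o shift t) (h *: 1) - f t)) =
  (fun h => h^-1 * (f (h + t) - f t)).
  by apply/funext => h; rewrite /= scaler1.
split; rewrite /derivable /derive E; last exact: cvg_lim H.
by apply/cvg_ex; exists d.
Qed.

(* [v1 i] need not be differentiable in [t]: the difference quotients of [v] in [t] are
   integrated by parts in [x] before the limit is taken. *)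
Lemma deriv_weighted_gradient (v vt P Pt : rV -> R -> R) (v1 v2 P1 : 'I_n -> rV -> R -> R) (a b t N : R) :
  a < t < b ->
  cab a b v -> cab a b vt -> (forall i, cab a b (v1 i)) -> (forall i, cab a b (v2 i)) ->
  cab a b P -> cab a b Pt -> (forall i, cab a b (P1 i)) ->
  (forall i x s, a < s < b -> is_derive x (ev i) (v^~ s) (v1 i x s)) ->
  (forall i x s, a < s < b -> is_derive x (ev i) ((v1 i)^~ s) (v2 i x s)) ->
  (forall i x s, a < s < b -> is_derive x (ev i) (P^~ s) (P1 i x s)) ->
  (forall x s, a < s < b -> is_derive s 1 (v x) (vt x s)) ->
  (forall x s, a < s < b -> is_derive s 1 (P x) (Pt x s)) ->
  (forall s, a < s < b -> supp_in N (P^~ s)) ->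
  is_derive t 1 (fun s => I (fun x => P x s * \sum_i v1 i x s ^+ 2))
   (I (fun x => Pt x t * (\sum_i v1 i x t ^+ 2)
        - vt x t * (\sum_i (P x t * (2 * v2 i x t) + P1 i x t * (2 * v1 i x t))))).
Proof.
move=> tab cv cvt cv1 cv2 cP cPt cP1 dv dv1 dP dvt dPt sP.
have tab' : a <= t <= b by lra.
have sl f : cab a b f -> forall s, a < s < b -> continuous (f^~ s).
  by move=> cf s h; apply: cab_slice cf; lra.
have sP1 i s : a < s < b -> supp_in N (P1 i ^~ s).
  by move=> h; apply: supp_deriv (sP s h) (fun x => dP i x s h).
have sPt x s : a < s < b -> N < `|x| -> Pt x s = 0.
  move=> h Nx; refine (d_unique (dPt x s h) _).
  apply: (@near_eq_is_derive _ _ _ (fun=> 0)).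
  near=> r; rewrite (sP r)//; apply/andP; split; near: r.
    by apply: lt_nbhsr; case/andP: h.
  by apply: lt_nbhsl; case/andP: h.
pose W x s := \sum_i v1 i x s ^+ 2.
(* The divergence of P(t) (grad v(s) + grad v(t)). It appears because |grad v(s)|^2 - |grad v(t)|^2
   is the product of the difference and the sum of the gradients, and the difference is integrated
   by parts. *)
pose T x s := \sum_i (P x t * (v2 i x s + v2 i x t) + P1 i x t * (v1 i x s + v1 i x t)).
have cW : cab a b W.
  by apply: cabS => i; apply: cX; exact: cv1.
have cT : cab a b T.
  by apply: cabS => i; apply: cabD; apply: cabM; rewrite ?cabD//;
    try (apply: cab_const; apply: sl => //); apply: cabD => //; apply: cab_const; apply: sl.
have [CW CW0 hCW] := cab_bound a b W N cW.
have [CT CT0 hCT] := cab_bound a b T N cT.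
have [CP CP0 hCP] := cab_bound a b Pt N cPt.
have [Cv Cv0 hCv] := cab_bound a b vt N cvt.
pose Q h x := h^-1 * (P x (h + t) - P x t) * W x (h + t)
  - h^-1 * (v x (h + t) - v x t) * T x (h + t).
(* The value 0 for increments leaving ]a, b[ is a default: dominated convergence is applied with one
   majorant for all [h != 0]. *)
pose A h x := if a < h + t < b then Q h x else 0.
pose A0 x := Pt x t * W x t - vt x t * T x t.
have cA h : continuous (A h).
  have [ht|nht] := boolP (a < h + t < b); last first.
    rewrite (_ : A h = fun=> 0); first exact: cC.
    by apply/funext => x; rewrite /A (negbTE nht).
  rewrite (_ : A h = Q h); last by apply/funext => x; rewrite /A ht.
  have h2 : a <= h + t <= b by lra.
  apply: cB; apply: cM; try (apply: cM; first exact: cC); try (apply: cB; apply: sl => //).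
    exact: (cab_slice _ _ _ _ h2 cW).
  exact: (cab_slice _ _ _ _ h2 cT).
have cA0 : continuous A0.
  apply: cB; apply: cM; try (by apply: sl).
have bA h x : h != 0 -> `|A h x| <= (CP * CW + Cv * CT) * \1_[set x : rV | `|x| <= N] x.
  move=> h0; rewrite /A; case: ifPn => [ht|_]; last first.
    by rewrite normr0 mulr_ge0// addr_ge0// mulr_ge0.
  have h2 : a <= h + t <= b by lra.
  rewrite indicE; have [xN|Nx] := leP `|x| N.
    rewrite (mem_set (xN : [set x : rV | `|x| <= N] x)) mulr1 (le_trans (ler_normB _ _))// lerD// normrM ler_pM//.
    - apply: (quot_bound (fun z hz => dPt x z hz)) => // z hz; apply: hCP => //; lra.
    - exact: hCW.
    - apply: (quot_bound (fun z hz => dvt x z hz)) => // z hz; apply: hCv => //; lra.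
    - exact: hCT.
  rewrite (_ : (x \in _) = false) ?mulr0; last first.
    by apply/negbTE; rewrite notin_setE /=; apply/negP; rewrite -ltNge.
  rewrite /Q /T (sP _ ht)// (sP _ tab)// subr0 mulr0 mul0r sub0r normrN.
  rewrite big1 ?mulr0 ?normr0// => i _.
  by rewrite (sP1 i _ tab)// !mul0r addr0.
have lA x : A h x @[h --> 0^'] --> A0 x.
  have E : {near (0 : R)^', (fun h => Q h x) =1 (fun h => A h x)}.
    have e1 : \forall h \near (0 : R)^', a < h + t < b.
      have : \forall h \near (0 : R), a < h + t < b.
        have c0 : h + t @[h --> (0 : R)] --> t.
          rewrite -[X in _ --> X]add0r; apply: cvgD; [exact: cvg_id|exact: cvg_cst].
        have [ta tb] := andP tab.
        near=> h; apply/andP; split; near: h.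
          exact: (cvgr_gt t c0).
        exact: (cvgr_lt t c0).
      exact: nbhs_dnbhs.
    by apply: filterS e1 => h hh; rewrite /A hh.
  apply: cvg_trans (near_eq_cvg E) _.
  apply: cvgB; apply: cvgM.
  - exact/quot_cvg/dPt.
  - exact: (@shift_cvg (W x) t (cab_slice2 tab cW)).
  - exact/quot_cvg/dvt.
  - exact: (@shift_cvg (T x) t (cab_slice2 tab cT)).
have LI := @I_cvg_dnbhs R n A A0 N (CP * CW + Cv * CT) (fun h => continuous_measurable_rV _ _ (cA h))
   (continuous_measurable_rV _ _ cA0) (addr_ge0 (mulr_ge0 CP0 CW0) (mulr_ge0 Cv0 CT0)) bA lA.
have -> : I (fun x => Pt x t * (\sum_i v1 i x t ^+ 2)
        - vt x t * (\sum_i (P x t * (2 * v2 i x t) + P1 i x t * (2 * v1 i x t)))) = I A0.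
  apply: I_ext => x; rewrite /A0 /W /T; congr (_ - _ * _); apply: eq_bigr => i _; ring.
apply: is_derive_quot.
apply: cvg_trans LI; apply: near_eq_cvg.
have e1 : \forall h \near (0 : R)^', a < h + t < b.
  have : \forall h \near (0 : R), a < h + t < b.
    have c0 : h + t @[h --> (0 : R)] --> t.
      rewrite -[X in _ --> X]add0r; apply: cvgD; [exact: cvg_id|exact: cvg_cst].
    have [ta tb] := andP tab.
    near=> h; apply/andP; split; near: h.
      exact: (cvgr_gt t c0).
    exact: (cvgr_lt t c0).
  exact: nbhs_dnbhs.
apply: filterS e1 => h ht; rewrite /A ht.
have CcP s : a < s < b -> Cc (P^~ s).
  by move=> hs; split; [exact: sl|exists N; exact: sP].
have CcP1 i s : a < s < b -> Cc (P1 i ^~ s).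
  by move=> hs; split; [exact: sl|exists N; exact: sP1].
pose s1 i x := v1 i x (h + t) + v1 i x t.
pose s2 i x := v2 i x (h + t) + v2 i x t.
pose d x := v x (h + t) - v x t.
have cs1 i : continuous (s1 i) by apply: cD; exact: sl.
have cs2 i : continuous (s2 i) by apply: cD; exact: sl.
have cd : continuous d by apply: cB; exact: sl.
have ibp i : I (fun x => (P x t * s1 i x) * (v1 i x (h + t) - v1 i x t)) =
    - I (fun x => (P x t * s2 i x + s1 i x * P1 i x t) * d x).
  apply: (@I_ibp _ _ (fun x => P x t * s1 i x) (fun x => P x t * s2 i x + s1 i x * P1 i x t)
     d (fun x => v1 i x (h + t) - v1 i x t) i) => //.
  - by apply: CcMl => //; exact: CcP.
  - by apply: cD; apply: cM => //; apply: sl.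
  - by apply: cB; apply: sl.
  - by move=> x; refine (dM (dP i x t tab) (dD _ _)); exact: dv1.
  - by move=> x; apply: dB; exact: dv.
have cW' s : a < s < b -> continuous (W^~ s) by move=> hs; exact: sl.
have CcS1 : forall i, Cc (fun x => P x t * s1 i x * (v1 i x (h + t) - v1 i x t)).
  by move=> i; apply: CcMl; [apply: CcMl => //; exact: CcP|apply: cB; exact: sl].
have CcS2 : forall i, Cc (fun x => (P x t * s2 i x + s1 i x * P1 i x t) * d x).
  move=> i; apply: CcMl => //; apply: CcD.
    by apply: CcMl => //; exact: CcP.
  by apply: CcMr => //; exact: CcP1.
have -> : I (fun x => P x (h + t) * (\sum_i v1 i x (h + t) ^+ 2)) =
    I (fun x => P x (h + t) * W x (h + t)) by [].
rewrite -[X in _ = h^-1 * (_ - X)]/(I (fun x => P x t * W x t)).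
have cPW s : a < s < b -> Cc (fun x => P x s * W x s).
  by move=> hs; apply: CcMl; [exact: CcP|exact: cW'].
have cPQ : Cc (fun x => (P x (h + t) - P x t) * W x (h + t)).
  by apply: CcMl; [apply: CcB; exact: CcP|exact: cW'].
(* The increment of P W splits into (P(t+h) - P(t)) W(t+h) and P(t) (W(t+h) - W(t)). Integration by
   parts moves the gradient of v(t+h) - v(t) in the second part onto P and the sum of gradients, so
   only v itself is differentiated in time. *)
have E : I (fun x => P x (h + t) * W x (h + t)) - I (fun x => P x t * W x t) =
   I (fun x => (P x (h + t) - P x t) * W x (h + t)) - I (fun x => d x * T x (h + t)).
  rewrite -I_B; [|exact: cPW|exact: cPW].
  transitivity (I (fun x => (P x (h + t) - P x t) * W x (h + t) +
      \sum_i (P x t * s1 i x * (v1 i x (h + t) - v1 i x t)))).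
    apply: I_ext => x; rewrite mulrBl -addrA; congr (_ + _).
    transitivity (- (P x t * W x (h + t)) + P x t * (W x (h + t) - W x t)); first by ring.
    congr (_ + _); rewrite /W -sumrB mulr_sumr; apply: eq_bigr => i _.
    by rewrite /s1; ring.
  rewrite I_D//; last exact: CcS.
  congr (_ + _); rewrite I_S//.
  under eq_bigr do rewrite ibp.
  rewrite sumrN -I_S//; congr (- _); apply: I_ext => x.
  by rewrite /T mulr_sumr; apply: eq_bigr => i _; rewrite /s1 /s2; ring.
have CdT : Cc (fun x => d x * T x (h + t)).
  apply: CcMr => //; apply: CcS => i; apply: CcD; apply: CcMl.
  - exact: CcP.
  - exact: cs2.
  - exact: CcP1.
  - exact: cs1.
rewrite E mulrBr -!I_Z// -I_B; [|exact: CcZ|exact: CcZ].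
by apply: I_ext => x; rewrite /Q /d; ring.
Unshelve. all: by end_near. Qed.

End K.

Unset Implicit Arguments.
Set Strict Implicit.

(** * Powers, coordinates and static identities *)

Section powers.
Context {R : realType}.

Lemma cont_powR_pos (a x : R) : 0 < x -> {for x, continuous (fun r => r `^ a)}.
Proof. by move=> x0; exact: (d_cont _ _ _ (is_derive1_powR a x0)). Qed.

Lemma cont_abs_powR (a : R) : 0 < a -> continuous (fun r : R => `|r| `^ a).
Proof.
move=> a0 x; have [->|x0] := eqVneq x 0.
  rewrite /continuous_at normr0 powR0 ?gt_eqF//; apply/cvgrPdist_lt => e e0.
  have H : \forall r \near (0 : R), `|r| < e `^ a^-1.
    exact: (@nbhs0_lt R R _ (powR_gt0 a^-1 e0)).
  apply: filterS H => r re.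
  rewrite sub0r normrN ger0_norm ?powR_ge0//.
  rewrite -[X in _ < X]powRr1 ?(ltW e0)// -(mulVf (lt0r_neq0 a0)) powRrM.
  by rewrite gt0_ltr_powR// ?nnegrE ?powR_ge0.
apply: (@continuous_comp _ _ _ (fun r : R => `|r|) (fun r => r `^ a)).
  exact: (@norm_continuous R R).
by apply: cont_powR_pos; rewrite normr_gt0.
Qed.

(** Away from the origin this is the derivative of a power. At the origin the difference quotient
    has size |h|^p, at most |h| for |h| < 1. *)
Lemma d_abs_powR (p r : R) : 1 < p ->
  is_derive r 1 (fun r : R => `|r| `^ (p + 1)) ((p + 1) * (`|r| `^ (p - 1) * r)).
Proof.
move=> p1; have [r0|r0|->] := ltgtP r 0.
- apply: (@near_eq_is_derive _ _ _ (fun s => (- s) `^ (p + 1))).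
    near=> s; rewrite ltr0_norm//; near: s; exact: lt_nbhsl.
  have nr0 : 0 < - r by rewrite oppr_gt0.
  have d1 : is_derive r 1 (fun s : R => - s) (-1) by apply: dN; exact: is_derive_id.
  refine (dE (dcomp (h := fun s => s `^ (p + 1)) d1 (is_derive1_powR (p + 1) nr0)) _).
  rewrite addrK ltr0_norm// -(@mulr_powRB1 _ (- r) p) ?(ltW nr0)//; last lra.
  by ring.
- apply: (@near_eq_is_derive _ _ _ (fun s => s `^ (p + 1))).
    near=> s; rewrite gtr0_norm//; near: s; exact: lt_nbhsr.
  refine (dE (is_derive1_powR (p + 1) r0) _).
  rewrite addrK gtr0_norm// -(@mulr_powRB1 _ r p) ?(ltW r0)//; last lra.
  by ring.
- rewrite mulr0 mulr0; apply: is_derive_quot.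
  rewrite normr0 powR0; last by rewrite gt_eqF//; lra.
  apply/cvgrPdist_lt => e e0; near=> h.
  have h0 : h != 0 by near: h; exact: nbhs_dnbhs_neq.
  have nh0 : 0 < `|h| by rewrite normr_gt0.
  have h1 : `|h| < Num.min 1 e.
    near: h; apply: (@dnbhs0_lt R R).
    by rewrite lt_min ltr01 e0.
  move: h1; rewrite lt_min => /andP[h1 he].
  rewrite sub0r normrN subr0 addr0 normrM normfV (ger0_norm (powR_ge0 _ _)).
  rewrite -(@mulr_powRB1 _ `|h| (p + 1)) ?addrK//; last lra.
  rewrite mulKf ?gt_eqF//; apply: le_lt_trans he.
  rewrite -[leRHS]powRr1//; apply: ger_powR; last lra.
  by rewrite nh0 ltW.
Unshelve. all: by end_near. Qed.

(** [pwf] is the nonlinearity of the equation and [pwF] is p + 1 times its primitive; moreover r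
    [pwf] r = [pwF] r. *)
Definition pwF (p : R) (r : R) : R := `|r| `^ (p + 1).
Definition pwf (p : R) (r : R) : R := `|r| `^ (p - 1) * r.

Lemma pwf_cont p : 1 < p -> continuous (pwf p).
Proof.
move=> p1; apply: cM; first by apply: cont_abs_powR; lra.
by move=> x; exact: cvg_id.
Qed.
Lemma pwF_cont p : 1 < p -> continuous (pwF p).
Proof. by move=> p1; apply: cont_abs_powR; lra. Qed.
Lemma pwF_ge0 p r : 0 <= pwF p r. Proof. exact: powR_ge0. Qed.
Lemma pwfr p r : 1 < p -> r * pwf p r = pwF p r.
Proof.
move=> p1; rewrite /pwf /pwF mulrCA -expr2 -real_normK ?num_real//.
have E1 : `|r| * `|r| `^ (p - 1) = `|r| `^ p by rewrite mulr_powRB1//; lra.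
have E2 : `|r| * `|r| `^ p = `|r| `^ (p + 1).
  by rewrite -(@mulr_powRB1 _ `|r| (p + 1)) ?addrK//; lra.
by rewrite expr2 mulrCA (mulrC (_ `^ _)) E1 E2.
Qed.
End powers.

Section coords.
Context {R : realType} {n : nat}.
Notation rV := 'rV[R]_n.

Lemma d_coord i j (x : rV) :
  is_derive x (ev j) (fun y : rV => y ord0 i : R) ((i == j)%:R).
Proof.
apply: d_at_line.
rewrite (_ : (fun _ => _) = fun r => (i == j)%:R * r + x ord0 i); last first.
  by apply/funext => r; rewrite !mxE eqxx /= eq_sym mulrC.
have d1 : is_derive (0 : R) 1 (fun r : R => r) 1 by exact: is_derive_id.
by refine (dE (dD (dZ _ d1) (dC _ _ _)) _); rewrite mulr1 addr0.
Qed.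

(** The Gaussian and the cutoffs need the Euclidean distance, whereas the norm of row vectors is the
    sup norm. The square is a polynomial and so differentiable everywhere. *)
Definition sq (c x : rV) : R := \sum_i (x ord0 i - c ord0 i) ^+ 2.

Lemma cont_coord i : continuous (fun y : rV => y ord0 i : R).
Proof. exact: coord_continuous. Qed.

Lemma cont_sq c : continuous (sq c).
Proof.
by apply: cS => i; apply: cX; apply: cB; [exact: cont_coord|exact: cC].
Qed.

Lemma d_coordB i j (c x : rV) :
  is_derive x (ev j) (fun y : rV => y ord0 i - c ord0 i) ((i == j)%:R).
Proof. by refine (dE (dB (d_coord i j x) (dC _ _ _)) _); rewrite subr0. Qed.

Lemma sum_delta (F : 'I_n -> R) j : \sum_i F i * (i == j)%:R = F j.
Proof.
rewrite (bigD1 j)//= eqxx mulr1 big1 ?addr0// => i /negbTE ->.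
by rewrite mulr0.
Qed.

Lemma d_sq c x j : is_derive x (ev j) (sq c) (2 * (x ord0 j - c ord0 j)).
Proof.
refine (dE (dS (fun i => dM (d_coordB i j c x) (d_coordB i j c x))) _).
rewrite -[RHS](sum_delta (fun i => 2 * (x ord0 i - c ord0 i)) j).
by apply: eq_bigr => i _; ring.
Qed.

Lemma sq_ge0 c x : 0 <= sq c x.
Proof. by apply: sumr_ge0 => i _; exact: sqr_ge0. Qed.
End coords.

Section static.
Context {R : realType} {n : nat}.
Notation rV := 'rV[R]_n.
Variables (u : rV -> R) (G H : 'I_n -> rV -> R) (w : rV -> R) (w1 : 'I_n -> rV -> R) (c : rV).
Hypothesis cu : continuous u.
Hypothesis cG : forall i, continuous (G i).
Hypothesis cH : forall i, continuous (H i).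
Hypothesis dG : forall i x, is_derive x (ev i) u (G i x).
Hypothesis dH : forall i x, is_derive x (ev i) (G i) (H i x).
Hypothesis cw : Cc w.
Hypothesis cw1 : forall i, continuous (w1 i).
Hypothesis dw : forall i x, is_derive x (ev i) w (w1 i x).

Let X i (x : rV) : R := x ord0 i - c ord0 i.
(** [Nf] is |grad u|^2, [Lf] the Laplacian of u, [Sf] the radial derivative (x - c) . grad u, [WGf]
    is grad w . grad u and [XWf] is (x - c) . grad w, for the weight w. *)
Definition Nf (x : rV) := \sum_i G i x ^+ 2.
Definition Lf (x : rV) := \sum_i H i x.
Definition Sf (x : rV) := \sum_i (x ord0 i - c ord0 i) * G i x.
Definition WGf (x : rV) := \sum_i w1 i x * G i x.
Definition XWf (x : rV) := \sum_i (x ord0 i - c ord0 i) * w1 i x.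

Let cXc i : continuous (X i).
Proof. by apply: cB; [exact: cont_coord|exact: cC]. Qed.

Lemma cont_Nf : continuous Nf.
Proof. by apply: cS => i; apply: cX; exact: cG. Qed.
Lemma cont_Lf : continuous Lf.
Proof. exact: cS. Qed.

Let Ccw1 i : Cc (w1 i).
Proof. exact: (CcV _ _ _ cw (cw1 i) (dw i)). Qed.

Lemma Cc_WGf : Cc WGf.
Proof. by apply: CcS => i; apply: CcMl. Qed.
Lemma Cc_XWf : Cc XWf.
Proof. by apply: CcS => i; apply: CcMr => //; exact: cXc. Qed.

(** Formally an integration by parts using the mixed second derivatives of u. To do without them,
    translate: the integral of P(x) |grad u(x + s e_i)|^2 equals that of P(x - s e_i) |grad u(x)|^2.
    The left side is differentiated at s = 0 by [deriv_weighted_gradient], with s in the role of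
    time, and the right side directly. *)
Lemma shift_identity (P : rV -> R) (P1 : 'I_n -> rV -> R) i : Cc P ->
  (forall j, continuous (P1 j)) ->
  (forall j x, is_derive x (ev j) P (P1 j x)) ->
  I (fun x => P1 i x * Nf x - 2 * (G i x * (P x * Lf x + \sum_j P1 j x * G j x))) = 0.
Proof.
move=> cP cP1 dP.
case: (cP) => [ccP [N sP]].
have cP1' j : Cc (P1 j) by exact: (CcV _ _ _ cP (cP1 j) (dP j)).
have cl (f : rV -> R) : continuous f -> cab (-1) 1 (fun x s => f (s *: ev i + x)).
  move=> cf; apply: (@ccomp _ _ _ (fun z : rV * R => (clamp (-1) 1 z.2) *: ev i + z.1) f) => //.
  move=> z; apply: (@cvgD _ rV); last exact: cvg_fst.
  apply: cvgZr_tmp; apply: (@ccomp _ _ _ (fun z : rV * R => z.2) (clamp (-1) 1)).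
    by move=> y; exact: cvg_snd.
  exact: clamp_continuous.
have dl (f f' : rV -> R) j : (forall x, is_derive x (ev j) f (f' x)) ->
   forall x s, is_derive x (ev j) (fun x => f (s *: ev i + x)) (f' (s *: ev i + x)).
  move=> df x s; apply: d_at_line.
  rewrite (_ : (fun r => _) = (fun r => f (r *: ev j + (s *: ev i + x)))); last first.
    by apply/funext => r; rewrite addrCA.
  by apply: d_line; rewrite scale0r add0r.
have t0 : -1 < (0 : R) < 1 by lra.
have K1 := @deriv_weighted_gradient R n (fun x s => u (s *: ev i + x)) (fun x s => G i (s *: ev i + x))
   (fun x _ => P x) (fun _ _ => 0) (fun j x s => G j (s *: ev i + x)) (fun j x s => H j (s *: ev i + x))
   (fun j x _ => P1 j x) (-1) 1 0 N t0 (cl _ cu) (cl _ (cG i)) (fun j => cl _ (cG j))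
   (fun j => cl _ (cH j)) (cab_const ccP) (cab_const (@cC _ _ 0)) (fun j => cab_const (cP1 j))
   (fun j x s _ => dl u (G j) j (dG j) x s) (fun j x s _ => dl (G j) (H j) j (dH j) x s)
   (fun j x s _ => dP j x) (fun x s _ => d_line (dG i _)) (fun x s _ => dC _ _ _) (fun s _ => sP).
have cNP : cab (-1) 1 (fun x s => P (- s *: ev i + x) * Nf x).
  apply: cabM; last by apply: cab_const; exact: cont_Nf.
  apply: (@ccomp _ _ _ (fun z : rV * R => (- clamp (-1) 1 z.2) *: ev i + z.1) P) => //.
  move=> z; apply: (@cvgD _ rV); last exact: cvg_fst.
  apply: cvgZr_tmp; apply: cvgN; apply: (@ccomp _ _ _ (fun z : rV * R => z.2) (clamp (-1) 1)).
    by move=> y; exact: cvg_snd.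
  exact: clamp_continuous.
have cNP1 : cab (-1) 1 (fun x s => - P1 i (- s *: ev i + x) * Nf x).
  apply: cabM; last by apply: cab_const; exact: cont_Nf.
  apply: cN; apply: (@ccomp _ _ _ (fun z : rV * R => (- clamp (-1) 1 z.2) *: ev i + z.1) (P1 i)) => //.
  move=> z; apply: (@cvgD _ rV); last exact: cvg_fst.
  apply: cvgZr_tmp; apply: cvgN; apply: (@ccomp _ _ _ (fun z : rV * R => z.2) (clamp (-1) 1)).
    by move=> y; exact: cvg_snd.
  exact: clamp_continuous.
have sN (f : rV -> R) : supp_in N f -> forall s : R, -1 < s < 1 ->
    supp_in (N + `|ev i : rV|) (fun x => f (- s *: ev i + x)).
  move=> sf s /andP[s1 s2] x h; apply: sf.
  have sev : `|- s *: ev i : rV| <= `|ev i : rV|.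
    by rewrite normrZ normrN ler_piMl// ler_norml; lra.
  have : `|x| <= `|- s *: ev i + x| + `|- s *: ev i : rV|.
    by rewrite -[X in `|X| <= _](addrK (- s *: ev i)) (addrC x) ler_normB.
  lra.
have sP1 := supp_deriv P (P1 i) (ev i) N sP (dP i).
have K2 := @I_deriv_cab R n (fun x s => P (- s *: ev i + x) * Nf x)
  (fun x s => - P1 i (- s *: ev i + x) * Nf x) (-1) 1 0 (N + `|ev i : rV|) t0 cNP cNP1.
have {}K2 : is_derive (0 : R) 1 (fun s => I (fun x => P (- s *: ev i + x) * Nf x))
   (I (fun x => - P1 i (- 0 *: ev i + x) * Nf x)).
  apply: K2.
  - by move=> s hs x hx; rewrite (sN _ sP s hs x hx) mul0r.
  - by move=> s hs x hx; rewrite (sN _ sP1 s hs x hx) oppr0 mul0r.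
  - move=> x s _.
    have d1 : is_derive (- s) 1 (fun r : R => P (r *: ev i + x)) (P1 i (- s *: ev i + x)).
      exact: d_line.
    have d2 : is_derive s 1 (fun r : R => - r) (-1) by apply: dN; exact: is_derive_id.
    refine (dE (dM (dcomp d2 d1) (dC (Nf x) _ _)) _).
    by ring.
have E s : I (fun x => P x * \sum_j G j (s *: ev i + x) ^+ 2) = I (fun x => P (- s *: ev i + x) * Nf x).
  rewrite -[RHS](@I_affine R n _ (s *: ev i) 1)//; last first.
    apply: CcMl; last exact: cont_Nf.
    rewrite (_ : (fun _ => _) = fun x => P (1 *: x + - s *: ev i)); first exact: Cc_translate.
    by apply/funext => x; rewrite scale1r addrC.
  rewrite expr1n mul1r; apply: I_ext => x.
  rewrite scale1r scaleNr [X in P (_ + X)]addrC addKr /Nf; congr (_ * _).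
  by apply: eq_bigr => j _; rewrite addrC.
have {}K1 := d_unique K1 (eq_ind_r (fun f => is_derive (0 : R) 1 f _) K2 (funext E)).
have cNfP : Cc (fun x => P1 i x * Nf x) by apply: CcMl => //; exact: cont_Nf.
have cGG : Cc (fun x => P x * Lf x + \sum_j P1 j x * G j x).
  by apply: CcD; [apply: CcMl => //; exact: cont_Lf|apply: CcS => j; apply: CcMl].
rewrite I_B//; last by apply: CcZ; apply: CcMr.
have -> : I (fun x => P1 i x * Nf x) = - I (fun x => - P1 i (- 0 *: ev i + x) * Nf x).
  rewrite -I_N; first by apply: I_ext => x; rewrite oppr0 scale0r add0r mulNr opprK.
  rewrite (_ : (fun _ => _) = fun x => - (P1 i x * Nf x)); first exact: CcN.
  by apply/funext => x; rewrite oppr0 scale0r add0r mulNr.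
rewrite -K1 -I_N; last first.
  rewrite (_ : (fun _ => _) = fun x => - (G i x * (\sum_j (P x * (2 * H j x) + P1 j x * (2 * G j x))))).
    apply: CcN; apply: CcMr => //; apply: CcS => j; apply: CcD; apply: CcMl => //; apply: cM => //; exact: cC.
  by apply/funext => x; rewrite mul0r sub0r scale0r add0r.
rewrite -I_B; first last.
- by apply: CcZ; apply: CcMr.
- rewrite (_ : (fun _ => _) = fun x => (G i x * (\sum_j (P x * (2 * H j x) + P1 j x * (2 * G j x))))).
    apply: CcMr => //; apply: CcS => j; apply: CcD; apply: CcMl => //; apply: cM => //; exact: cC.
  by apply/funext => x; rewrite mul0r sub0r scale0r add0r opprK.
rewrite -[RHS](@I0 R n); apply: I_ext => x.
rewrite mul0r sub0r opprK scale0r add0r mulrCA -mulrBr /Lf mulr_sumr -big_split /= mulr_sumr.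
by rewrite -sumrB big1 ?mulr0// => j _; ring.
Qed.

(** The Pohozaev identity with weight: [shift_identity] for P = w (x_i - c_i), summed over i. *)
Lemma pohozaev : I (fun x => (n%:R * w x + XWf x) * Nf x
    - 2 * (w x * Sf x * Lf x + Sf x * WGf x + w x * Nf x)) = 0.
Proof.
have H1 i := @shift_identity (fun x => w x * X i x)
  (fun j x => w x * (i == j)%:R + X i x * w1 j x) i (CcMl _ _ cw (cXc i))
  (fun j => cD _ _ (cM _ _ cw.1 (@cC _ _ _)) (cM _ _ (cXc i) (cw1 j)))
  (fun j x => dM (dw j x) (d_coordB i j c x)).
have C1 i : Cc (fun x => (w x * (i == i)%:R + X i x * w1 i x) * Nf x - 2 *
      (G i x * (w x * X i x * Lf x + \sum_j (w x * (i == j)%:R + X i x * w1 j x) * G j x))).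
  apply: CcB.
    apply: CcMl; last exact: cont_Nf.
    apply: CcD; first by apply: CcMl => //; exact: cC.
    exact: CcMr.
  apply: CcZ; apply: CcMr => //; apply: CcD.
    by apply: CcMl; [apply: CcMl|exact: cont_Lf].
  apply: CcS => j; apply: CcMl => //; apply: CcD; first by apply: CcMl => //; exact: cC.
  exact: CcMr.
transitivity (\sum_i I (fun x => (w x * (i == i)%:R + X i x * w1 i x) * Nf x - 2 *
      (G i x * (w x * X i x * Lf x + \sum_j (w x * (i == j)%:R + X i x * w1 j x) * G j x)))).
  rewrite -I_S//; apply: I_ext => x.
  have E1 : \sum_i (w x * (i == i)%:R + X i x * w1 i x) * Nf x = (n%:R * w x + XWf x) * Nf x.
    rewrite -mulr_suml big_split /= /XWf; congr ((_ + _) * _).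
    transitivity (\sum_(i < n) w x); first by apply: eq_bigr => i _; rewrite eqxx mulr1.
    by rewrite sumr_const card_ord mulr_natl.
  have E2 i : \sum_j (w x * (i == j)%:R + X i x * w1 j x) * G j x = w x * G i x + X i x * WGf x.
    rewrite /WGf mulr_sumr -(sum_delta (fun j => w x * G j x) i) -big_split /=.
    by apply: eq_bigr => j _; rewrite (eq_sym i); ring.
  rewrite sumrB E1 -mulr_sumr; congr (_ - _ * _).
  under eq_bigr do rewrite E2.
  rewrite [w x * Sf x]mulrC /Sf /Nf -!mulrA !mulr_suml mulr_sumr -!big_split /=.
  by apply: eq_bigr => i _; rewrite /X; ring.
by rewrite big1.
Qed.

(** The divergence of the field w h (x - c) integrates to zero. *)
Lemma div_radial (h : rV -> R) (h1 : 'I_n -> rV -> R) : continuous h ->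
  (forall i, continuous (h1 i)) -> (forall i x, is_derive x (ev i) h (h1 i x)) ->
  I (fun x => w x * (\sum_i X i x * h1 i x) + (n%:R * w x + XWf x) * h x) = 0.
Proof.
move=> ch ch1 dh.
pose F i x := w x * X i x * h x.
pose F1 i x := w x * X i x * h1 i x + h x * (w x * 1 + X i x * w1 i x).
have cF i : Cc (F i) by apply: CcMl => //; exact: CcMl.
have cF1 i : continuous (F1 i).
  apply: cD; first by apply: cM => //; apply: cM => //; exact: cw.1.
  by apply: cM => //; apply: cD; apply: cM => //; [exact: cw.1|exact: cC].
have d i x : is_derive x (ev i) (F i) (F1 i x).
  refine (dM (dM (dw i x) _) (dh i x)).
  by refine (dE (d_coordB i i c x) _); rewrite eqxx.
have Z i : I (F1 i) = 0 by apply: (I_div _ _ i (cF i) (cF1 i)).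
have cF1' i : Cc (F1 i) by exact: (CcV _ _ _ (cF i) (cF1 i) (d i)).
transitivity (\sum_i I (F1 i)); last by rewrite big1.
rewrite -I_S//; apply: I_ext => x; rewrite /F1 big_split /=; congr (_ + _).
  by rewrite mulr_sumr; apply: eq_bigr => i _; ring.
rewrite -mulr_sumr mulrC big_split /= /XWf; congr (_ * (_ + _)).
by rewrite sumr_const card_ord mulr1 mulr_natl.
Qed.

(** The divergence of w u grad u integrates to zero. *)
Lemma ibp_lap : I (fun x => w x * u x * Lf x + w x * Nf x + u x * WGf x) = 0.
Proof.
pose F i x := w x * u x * G i x.
pose F1 i x := w x * u x * H i x + G i x * (w x * G i x + u x * w1 i x).
have cF i : Cc (F i) by apply: CcMl => //; exact: CcMl.
have cF1 i : continuous (F1 i).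
  apply: cD; first by apply: cM => //; apply: cM => //; exact: cw.1.
  by apply: cM => //; apply: cD; apply: cM => //; exact: cw.1.
have d i x : is_derive x (ev i) (F i) (F1 i x).
  exact: (dM (dM (dw i x) (dG i x)) (dH i x)).
have Z i : I (F1 i) = 0 by apply: (I_div _ _ i (cF i) (cF1 i)).
have cF1' i : Cc (F1 i) by exact: (CcV _ _ _ (cF i) (cF1 i) (d i)).
transitivity (\sum_i I (F1 i)); last by rewrite big1.
rewrite -I_S//; apply: I_ext => x; rewrite /F1 /Lf /Nf /WGf !mulr_sumr -!big_split /=.
by apply: eq_bigr => i _; ring.
Qed.

End static.

(** * The localized energy *)

(* [V], [G i], [H i] are the derivatives of [u] in [t], [x_i] and twice in [x_i].  No mixed or
   higher derivatives are available, and the time derivative only on [(-2, 0)]; see [rtime]. *)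
Record Sol {R : realType} {n : nat} (p : R) (u V : 'rV[R]_n -> R -> R)
    (G H : 'I_n -> 'rV[R]_n -> R -> R) : Prop := MkSol {
  sol_cu : continuous (fun z : 'rV[R]_n * R => u z.1 z.2);
  sol_cV : continuous (fun z : 'rV[R]_n * R => V z.1 z.2);
  sol_cG : forall i, continuous (fun z : 'rV[R]_n * R => G i z.1 z.2);
  sol_cH : forall i, continuous (fun z : 'rV[R]_n * R => H i z.1 z.2);
  sol_dG : forall i (x : 'rV[R]_n) (t : R), is_derive x (ev i) (u^~ t) (G i x t);
  sol_dH : forall i (x : 'rV[R]_n) (t : R), is_derive x (ev i) ((G i)^~ t) (H i x t);
  sol_dt : forall (x : 'rV[R]_n) (t : R), -2 < t < 0 -> is_derive t 1 (u x) (V x t);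
  sol_eq : forall (x : 'rV[R]_n) (t : R), V x t = \sum_i H i x t + pwf p (u x t) }.

(** * The Gaussian weight *)

Section gauss.
Context {R : realType} {n : nat}.
Notation rV := 'rV[R]_n.
Implicit Types a b t : R.

Lemma cab_cont a b (f : rV -> R -> R) :
  continuous (fun z : rV * R => f z.1 z.2) -> cab a b f.
Proof.
move=> cf; apply: (@ccomp _ _ _ (fun z : rV * R => (z.1, clamp a b z.2)) (fun z => f z.1 z.2)) => //.
apply: cpair; first by move=> z; exact: cvg_fst.
apply: (@ccomp _ _ _ (fun z : rV * R => z.2) (clamp a b)).
  by move=> z; exact: cvg_snd.
exact: clamp_continuous.
Qed.

Lemma cab_time a b (f : R -> R) : a <= b ->
  (forall s, a <= s <= b -> {for s, continuous f}) -> cab a b (fun (_ : rV) s => f s).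
Proof.
move=> ab cf z; apply: (@continuous_comp _ _ _ (fun z : rV * R => clamp a b z.2) f).
  apply: (@ccomp _ _ _ (fun z : rV * R => z.2) (clamp a b)).
    by move=> y; exact: cvg_snd.
  exact: clamp_continuous.
by apply: cf; exact: clamp_in.
Qed.

Lemma cab_comp a b (f : rV -> R -> R) (h : R -> R) : cab a b f -> continuous h ->
  cab a b (fun x t => h (f x t)).
Proof. by move=> cf ch; apply: (@ccomp _ _ _ (fun z : rV * R => f z.1 (clamp a b z.2)) h). Qed.

Lemma cabN a b (f : rV -> R -> R) : cab a b f -> cab a b (fun x t => - f x t).
Proof. exact: cN. Qed.
Lemma cabB a b (f h : rV -> R -> R) : cab a b f -> cab a b h ->
  cab a b (fun x t => f x t - h x t).
Proof. exact: cB. Qed.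
Lemma cabX a b (f : rV -> R -> R) k : cab a b f -> cab a b (fun x t => f x t ^+ k).
Proof. exact: cX. Qed.

Variables (b0 t1 : R) (c : rV).

(* [expR (b0 * ln (t1 - t)) = (t1 - t)^b0] : the powers of [t1 - t] in the weight are kept symbolic. *)
Definition gam (x : rV) (t : R) : R :=
  expR (b0 * ln (t1 - t) - sq c x * (4 * (t1 - t))^-1).

Lemma d_gam_x x t i :
  is_derive x (ev i) (gam^~ t) (- ((x ord0 i - c ord0 i) * (2 * (t1 - t))^-1) * gam x t).
Proof.
refine (dE (dcomp (h := expR) (dB (dC (b0 * ln (t1 - t)) x (ev i))
   (dM (d_sq c x i) (dC ((4 * (t1 - t))^-1) x (ev i)))) (is_derive_expR _)) _).
rewrite -/(gam x t) (_ : (4 * (t1 - t))^-1 = 2^-1 * (2 * (t1 - t))^-1); last first.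
  by rewrite -invfM; congr (_^-1); ring.
by move: ((2 * (t1 - t))^-1) (gam x t) => k e; field.
Qed.

Lemma d_gam_t x t : t < t1 ->
  is_derive t 1 (gam x) (- (b0 / (t1 - t) + sq c x / (4 * (t1 - t) ^+ 2)) * gam x t).
Proof.
move=> tt; have h : 0 < t1 - t by rewrite subr_gt0.
have d1 : is_derive t 1 (fun s : R => t1 - s) (-1).
  by refine (dE (dB (dC t1 t 1) (is_derive_id _ _)) _); rewrite sub0r.
have h4 : 4 * (t1 - t) != 0 by rewrite gt_eqF//; lra.
have d2 : is_derive t 1 (fun s : R => (4 * (t1 - s))^-1) (1 / (4 * (t1 - t) ^+ 2)).
  refine (dE (@is_deriveV _ (fun s : R => 4 * (t1 - s)) t _ _ h4 (dZ 4 d1)) _).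
  rewrite /GRing.scale /=; field; exact: lt0r_neq0.
refine (dE (dcomp (h := expR) (dB (dZ b0 (dcomp d1 (is_derive1_ln h)))
   (dM (dC (sq c x) t 1) d2)) (is_derive_expR _)) _).
by rewrite -/(gam x t); field; exact: lt0r_neq0.
Qed.

Lemma cab_inv a b : a <= b -> b < t1 -> cab a b (fun (_ : rV) s => (t1 - s)^-1).
Proof.
move=> ab bt; apply: cab_time => // s hs; apply: cvgV; first by rewrite gt_eqF//; lra.
by apply: cvgB; [exact: cvg_cst|exact: cvg_id].
Qed.

Lemma cab_gam a b : a <= b -> b < t1 -> cab a b gam.
Proof.
move=> ab bt; apply: cab_comp; last exact: continuous_expR.
apply: cabB.
  apply: (cab_time a b (fun s => b0 * ln (t1 - s))) => // s hs.
  apply: cvgM; first exact: cvg_cst.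
  apply: (@continuous_comp _ _ _ (fun s => t1 - s) (@ln R)).
    by apply: cvgB; [exact: cvg_cst|exact: cvg_id].
  by apply: continuous_ln; lra.
apply: cabM; first by apply: (cab_const (cont_sq c)).
apply: (cab_time a b (fun s => (4 * (t1 - s))^-1)) => // s hs.
apply: cvgV; first by rewrite gt_eqF//; lra.
by apply: cvgM; [exact: cvg_cst|apply: cvgB; [exact: cvg_cst|exact: cvg_id]].
Qed.

Lemma cont_gam t : continuous (gam^~ t).
Proof.
apply: (ccomp (fun x => b0 * ln (t1 - t) - sq c x * (4 * (t1 - t))^-1) expR); last exact: continuous_expR.
by apply: cB; [exact: cC|apply: cM; [exact: cont_sq|exact: cC]].
Qed.
End gauss.

(** Reduces an identity between integrals to a pointwise one, which [ring] or [field] can check once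
    the integrands are replaced by variables. *)
Lemma I_comb0 {R : realType} {n : nat} (s : seq (R * ('rV[R]_n -> R))) :
  foldr (fun q P => Cc q.2 /\ P) True s ->
  (forall x, foldr (fun q a => q.1 * q.2 x + a) 0 s = 0) ->
  foldr (fun q a => q.1 * I q.2 + a) 0 s = 0.
Proof.
move=> cs h0; rewrite -[RHS](@I0 R n) -(funext h0) {h0}.
suff [_ ->] : Cc (fun x => foldr (fun q a => q.1 * q.2 x + a) 0 s) /\
  foldr (fun q a => q.1 * I q.2 + a) 0 s =
   I (fun x => foldr (fun q a => q.1 * q.2 x + a) 0 s) by [].
elim: s cs => [_|[k f] s IH /= [cf /IH[cs ->]]] /=; first by rewrite I0; split => //; exact: Cc0.
by split; [apply: CcD => //; exact: CcZ|rewrite I_D ?I_Z//; exact: CcZ].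
Qed.

Section energy.
Context {R : realType} {n : nat}.
Notation rV := 'rV[R]_n.
Variables (p : R) (u V : rV -> R -> R) (G H : 'I_n -> rV -> R -> R).
Hypothesis p1 : 1 < p.
Hypothesis sol : Sol p u V G H.
Variables (phi : rV -> R) (phi1 : 'I_n -> rV -> R).
Hypothesis cphi : Cc phi.
Hypothesis cphi1 : forall i, continuous (phi1 i).
Hypothesis dphi : forall i x, is_derive x (ev i) phi (phi1 i x).
Variables (t1 : R) (c : rV).
Hypothesis t10 : t1 <= 0.

Definition kap : R := (2 * (p - 1))^-1.
(* The exponent of [t1 - t]: [- n / 2] comes from the heat kernel and [2 / (p - 1)] makes the
   energy scale invariant. *)
Definition bex : R := 4 * kap - n%:R / 2.
Notation g := (gam bex t1 c).
Definition om (x : rV) (t : R) : R := phi x * g x t.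
Definition omt (x : rV) (t : R) : R :=
  phi x * (- (bex / (t1 - t) + sq c x / (4 * (t1 - t) ^+ 2)) * g x t).
Definition om1 i (x : rV) (t : R) : R :=
  phi x * (- ((x ord0 i - c ord0 i) * (2 * (t1 - t))^-1) * g x t) + g x t * phi1 i x.
Definition N2 (x : rV) (t : R) : R := \sum_i G i x t ^+ 2.
Definition XG (x : rV) (t : R) : R := \sum_i (x ord0 i - c ord0 i) * G i x t.
Definition BG (x : rV) (t : R) : R := \sum_i phi1 i x * g x t * G i x t.
Definition XB (x : rV) (t : R) : R := \sum_i (x ord0 i - c ord0 i) * (phi1 i x * g x t).
(** Since 2 [kap] = 1/(p-1), this is -1/2 times the derivative at l = 1 of the rescalings
    l^(2/(p-1)) u(c + l (x - c), t1 + l^2 (t - t1)). It vanishes for solutions self-similar about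
    (c, t1), and its square is the dissipation of the energy. *)
Definition Pf (x : rV) (t : R) : R := (t1 - t) * V x t - XG x t / 2 - 2 * kap * u x t.

Definition A1 (t : R) : R := I (fun x => om x t * N2 x t).
Definition A2 (t : R) : R := I (fun x => om x t * pwF p (u x t)).
Definition A3 (t : R) : R := I (fun x => om x t * u x t ^+ 2).
(** In the similarity variables y = (x - c) / sqrt(t1 - t), w = (t1 - t)^(1/(p-1)) u this is the
    integral of |grad w|^2 / 2 - |w|^(p+1) / (p+1) + w^2 / (2(p-1)) against e^(-|y|^2/4), with
    cutoff. Staying in the original variables avoids transforming the equation. *)
Definition En (t : R) : R := (t1 - t) / 2 * A1 t - (t1 - t) / (p + 1) * A2 t + kap * A3 t.

Let ccphi : continuous phi := cphi.1.

Lemma d_om x t i : is_derive x (ev i) (om^~ t) (om1 i x t).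
Proof. exact: dM (dphi i x) (d_gam_x _ _ _ _ _ _). Qed.

Lemma d_omt x t : t < t1 -> is_derive t 1 (om x) (omt x t).
Proof.
move=> tt; refine (dE (dM (dC (phi x) t 1) (d_gam_t bex t1 c x t tt)) _).
by rewrite mulr0 addr0.
Qed.

Lemma cab_om a b : a <= b -> b < t1 -> cab a b om.
Proof.
by move=> ab bt; apply: cabM; [apply: cab_const; exact: ccphi|exact: cab_gam].
Qed.

Lemma cab_omt a b : a <= b -> b < t1 -> cab a b omt.
Proof.
move=> ab bt; apply: cabM; first by apply: cab_const; exact: ccphi.
apply: cabM; last exact: cab_gam.
apply: cabN; apply: cabD.
  by apply: cabM; [apply: cab_const; exact: cC|exact: cab_inv].
apply: cabM; first by apply: cab_const; exact: cont_sq.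
apply: (cab_time a b (fun s => (4 * (t1 - s) ^+ 2)^-1)) => // s hs.
apply: cvgV; first by rewrite gt_eqF// pmulr_rgt0// exprn_gt0//; lra.
apply: cvgM; first exact: cvg_cst.
apply: (@cX _ _ (fun s => t1 - s)); apply: cB; [exact: cC|by move=> y; exact: cvg_id].
Qed.

Lemma cab_om1 a b i : a <= b -> b < t1 -> cab a b (om1 i).
Proof.
move=> ab bt; apply: cabD; apply: cabM.
- by apply: cab_const; exact: ccphi.
- apply: cabM; last exact: cab_gam.
  apply: cabN; apply: cabM.
    by apply: cab_const; apply: cB; [exact: cont_coord|exact: cC].
  apply: (cab_time a b (fun s => (2 * (t1 - s))^-1)) => // s hs.
  apply: cvgV; first by rewrite gt_eqF//; lra.
  by apply: cvgM; [exact: cvg_cst|apply: cvgB; [exact: cvg_cst|exact: cvg_id]].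
- exact: cab_gam.
- by apply: cab_const.
Qed.

Lemma Cc_om t : Cc (om^~ t).
Proof. by apply: CcMl; [exact: cphi|exact: cont_gam]. Qed.

Lemma cont_om1 i t : continuous (om1 i ^~ t).
Proof.
apply: cD; apply: cM.
- exact: ccphi.
- apply: cM; last exact: cont_gam.
  apply: cN; apply: cM; last exact: cC.
  by apply: cB; [exact: cont_coord|exact: cC].
- exact: cont_gam.
- exact: cphi1.
Qed.

Let sl f t : continuous (fun z : rV * R => f z.1 z.2) -> continuous (fun x => f x t : R).
Proof. by move=> cf; exact: cslice1. Qed.
Let cu t : continuous (u^~ t). Proof. exact: sl (sol_cu _ _ _ _ _ sol). Qed.
Let cV t : continuous (V^~ t). Proof. exact: sl (sol_cV _ _ _ _ _ sol). Qed.
Let cG i t : continuous (G i ^~ t). Proof. exact: sl (sol_cG _ _ _ _ _ sol i). Qed.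
Let cH i t : continuous (H i ^~ t). Proof. exact: sl (sol_cH _ _ _ _ _ sol i). Qed.

Lemma XWf_om x t : XWf (fun i => om1 i ^~ t) c x =
  - (sq c x / (2 * (t1 - t))) * om x t + XB x t.
Proof.
rewrite /XWf /XB /om1 /om /sq mulr_suml -sumrN mulr_suml -big_split /=.
by apply: eq_bigr => i _; ring.
Qed.

Lemma WGf_om x t : WGf (fun i => G i ^~ t) (fun i => om1 i ^~ t) x =
  - (XG x t / (2 * (t1 - t))) * om x t + BG x t.
Proof.
rewrite /WGf /BG /om1 /om /XG mulr_suml -sumrN mulr_suml -big_split /=.
by apply: eq_bigr => i _; ring.
Qed.

Let Lt t := Lf (fun i => H i ^~ t).
Let WGo t := WGf (fun i => G i ^~ t) (fun i => om1 i ^~ t).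
Let XWo t := XWf (fun i => om1 i ^~ t) c.

Let supp_ex : exists N, forall t, supp_in N (om^~ t).
Proof.
by case: cphi => _ [N sN]; exists N => t x /sN h; rewrite /om h mul0r.
Qed.

Section at_time.
Variable t : R.
Hypothesis ht : -2 < t < t1.

(** A compact window [a, b] around t, strictly between -2 and t1, on which the weight is regular and
    the equation holds. *)
Let a : R := (t - 2) / 2.
Let b : R := (t + t1) / 2.
Let tab : a < t < b. Proof. by have := ht; rewrite /a /b; lra. Qed.
Let ab : a <= b. Proof. by have := ht; rewrite /a /b; lra. Qed.
Let bt : b < t1. Proof. by have := ht; rewrite /b; lra. Qed.
Let in2 s : a < s < b -> -2 < s < 0. Proof. by rewrite /a /b; move: t10 ht; lra. Qed.
Let int1 s : a < s < b -> s < t1. Proof. by rewrite /b; move: ht; lra. Qed.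

Lemma d_A1 : is_derive t 1 A1
  (I (fun x => omt x t * N2 x t - 2 * V x t * (om x t * Lt t x + WGo t x))).
Proof.
have [N sN] := supp_ex.
refine (dE (@deriv_weighted_gradient R n u V om omt G H om1 a b t N tab
  (cab_cont a b _ (sol_cu _ _ _ _ _ sol)) (cab_cont a b _ (sol_cV _ _ _ _ _ sol))
  (fun i => cab_cont a b _ (sol_cG _ _ _ _ _ sol i)) (fun i => cab_cont a b _ (sol_cH _ _ _ _ _ sol i))
  (cab_om a b ab bt) (cab_omt a b ab bt) (fun i => cab_om1 a b i ab bt)
  (fun i x s _ => sol_dG _ _ _ _ _ sol i x s) (fun i x s _ => sol_dH _ _ _ _ _ sol i x s)
  (fun i x s _ => d_om x s i) (fun x s hs => sol_dt _ _ _ _ _ sol x s (in2 s hs))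
  (fun x s hs => d_omt x s (int1 s hs)) (fun s _ => sN s)) _).
apply: I_ext => x; rewrite -/(N2 x t); congr (_ - _).
rewrite /Lt /Lf /WGo /WGf !mulr_sumr -big_split /= !mulr_sumr.
by apply: eq_bigr => i _; ring.
Qed.

Lemma d_A2 : is_derive t 1 A2
  (I (fun x => omt x t * pwF p (u x t) + om x t * ((p + 1) * pwf p (u x t) * V x t))).
Proof.
have [N sN] := supp_ex.
have sNt s : supp_in N (omt^~ s) \/ True by right.
have cuab := cab_cont a b _ (sol_cu _ _ _ _ _ sol).
apply: (@I_deriv_cab R n (fun x s => om x s * pwF p (u x s))
  (fun x s => omt x s * pwF p (u x s) + om x s * ((p + 1) * pwf p (u x s) * V x s)) a b t N tab).
- apply: cabM; first exact: cab_om.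
  by apply: cab_comp => //; exact: pwF_cont.
- apply: cabD; apply: cabM; [exact: cab_omt| |exact: cab_om|].
    by apply: cab_comp => //; exact: pwF_cont.
  apply: cabM; last exact: (cab_cont a b _ (sol_cV _ _ _ _ _ sol)).
  apply: cabM; first by apply: cab_const; exact: cC.
  by apply: cab_comp => //; exact: pwf_cont.
- by move=> s _ x Nx; rewrite (sN s x Nx) mul0r.
- move=> s hs x Nx; rewrite (sN s x Nx) mul0r addr0.
  rewrite (_ : omt x s = 0) ?mul0r// /omt.
  have := sN s x Nx; rewrite /om => /eqP; rewrite mulf_eq0 => /orP[/eqP ->|].
    by rewrite mul0r.
  by rewrite /gam expR_eq0.
- move=> x s hs.
  refine (dE (dM (d_omt x s (int1 s hs)) (dcomp (h := pwF p) (sol_dt _ _ _ _ _ sol x s (in2 s hs))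
     (d_abs_powR p _ p1))) _).
  by rewrite /pwF /pwf; ring.
Qed.

Lemma d_A3 : is_derive t 1 A3
  (I (fun x => omt x t * u x t ^+ 2 + om x t * (2 * u x t * V x t))).
Proof.
have [N sN] := supp_ex.
have cuab := cab_cont a b _ (sol_cu _ _ _ _ _ sol).
apply: (@I_deriv_cab R n (fun x s => om x s * u x s ^+ 2)
  (fun x s => omt x s * u x s ^+ 2 + om x s * (2 * u x s * V x s)) a b t N tab).
- by apply: cabM; [exact: cab_om|exact: cabX].
- apply: cabD; apply: cabM; [exact: cab_omt|exact: cabX|exact: cab_om|].
  apply: cabM; last exact: (cab_cont a b _ (sol_cV _ _ _ _ _ sol)).
  by apply: cabM => //; apply: cab_const; exact: cC.
- by move=> s _ x Nx; rewrite (sN s x Nx) mul0r.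
- move=> s hs x Nx; rewrite (sN s x Nx) mul0r addr0.
  rewrite (_ : omt x s = 0) ?mul0r// /omt.
  have := sN s x Nx; rewrite /om => /eqP; rewrite mulf_eq0 => /orP[/eqP ->|].
    by rewrite mul0r.
  by rewrite /gam expR_eq0.
- move=> x s hs.
  have du := sol_dt _ _ _ _ _ sol x s (in2 s hs).
  refine (dE (dM (d_omt x s (int1 s hs)) (dM du du)) _).
  by ring.
Qed.

Let cN2 : continuous (N2^~ t). Proof. by apply: cS => i; apply: cX; exact: cG. Qed.
Let cXG : continuous (XG^~ t).
Proof. by apply: cS => i; apply: cM => //; apply: cB; [exact: cont_coord|exact: cC]. Qed.
Let cPf : continuous (Pf^~ t).
Proof.
apply: cB; first apply: cB.
- by apply: cM => //; exact: cC.
- by apply: cM => //; exact: cC.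
- by apply: cM => //; exact: cC.
Qed.
Let cLt : continuous (Lt t). Proof. by apply: cS => i. Qed.
Let cpF : continuous (fun x => pwF p (u x t)).
Proof. exact: (ccomp (u^~ t) (pwF p) (cu t) (pwF_cont p p1)). Qed.
Let cpf : continuous (fun x => pwf p (u x t)).
Proof. exact: (ccomp (u^~ t) (pwf p) (cu t) (pwf_cont p p1)). Qed.
Let Ccphi1 i : Cc (phi1 i).
Proof. exact: (CcV _ _ _ cphi (cphi1 i) (dphi i)). Qed.

Lemma Cc_BG : Cc (BG^~ t).
Proof.
apply: CcS => i; apply: CcMl => //; apply: CcMl => //; exact: cont_gam.
Qed.
Lemma Cc_XB : Cc (XB^~ t).
Proof.
apply: CcS => i; apply: CcMr; first by apply: cB; [exact: cont_coord|exact: cC].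
apply: CcMl => //; exact: cont_gam.
Qed.
Let CcWGo : Cc (WGo t).
Proof. exact: (Cc_WGf _ (om^~ t) (fun i => om1 i ^~ t) (fun i => cG i t) (Cc_om t)
  (fun i => cont_om1 i t) (fun i x => d_om x t i)). Qed.
Let CcXWo : Cc (XWo t).
Proof. exact: (Cc_XWf (om^~ t) (fun i => om1 i ^~ t) c (Cc_om t)
  (fun i => cont_om1 i t) (fun i x => d_om x t i)). Qed.
Let Ccomt : Cc (omt^~ t).
Proof.
apply: CcMl => //; apply: cM; last exact: cont_gam.
apply: cN; apply: cD; first exact: cC.
by apply: cM; [exact: cont_sq|exact: cC].
Qed.

(** All terms except the first contain the gradient of the cutoff and so live on its transition
    layer. *)
Definition dissip x := om x t * Pf x t ^+ 2 / (t1 - t) + Pf x t * BG x t +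
  XB x t * (N2 x t / 4 - pwF p (u x t) / (2 * (p + 1)) + kap * u x t ^+ 2 / (2 * (t1 - t))).

Lemma Cc_dissip : Cc dissip.
Proof.
apply: CcD; first apply: CcD.
- by apply: CcMl; [apply: CcMl; [exact: Cc_om|exact: cX]|exact: cC].
- by apply: CcMr => //; exact: Cc_BG.
- apply: CcMl; first exact: Cc_XB.
  apply: cD; first apply: cB.
  + by apply: cM => //; exact: cC.
  + by apply: cM => //; exact: cC.
  + by apply: cM; [apply: cM; [exact: cC|exact: cX]|exact: cC].
Qed.

(** Integrands with zero integral: the Pohozaev identity, the radial divergence identity for
    |u|^(p+1) and for u^2, and the divergence of [om] u grad u. *)
Let Z1 x := (n%:R * om x t + XWo t x) * N2 x t
    - 2 * (om x t * XG x t * Lt t x + XG x t * WGo t x + om x t * N2 x t).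
Let Z2 x := om x t * (\sum_i (x ord0 i - c ord0 i) * ((p + 1) * (pwf p (u x t)) * G i x t))
   + (n%:R * om x t + XWo t x) * pwF p (u x t).
Let Z3 x := om x t * (\sum_i (x ord0 i - c ord0 i) * (2 * u x t * G i x t))
   + (n%:R * om x t + XWo t x) * u x t ^+ 2.
Let Z4 x := om x t * u x t * Lt t x + om x t * N2 x t + u x t * WGo t x.

Let IZ1 : I Z1 = 0.
Proof.
exact: (pohozaev (u^~ t) (fun i => G i ^~ t) (fun i => H i ^~ t) (om^~ t)
  (fun i => om1 i ^~ t) c (cu t) (fun i => cG i t) (fun i => cH i t) (fun i x => sol_dG _ _ _ _ _ sol i x t)
  (fun i x => sol_dH _ _ _ _ _ sol i x t) (Cc_om t) (fun i => cont_om1 i t) (fun i x => d_om x t i)).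
Qed.
Let IZ2 : I Z2 = 0.
Proof.
apply: (div_radial (om^~ t) (fun i => om1 i ^~ t) c (Cc_om t) (fun i => cont_om1 i t) (fun i x => d_om x t i)
  (fun x => pwF p (u x t)) (fun i x => (p + 1) * pwf p (u x t) * G i x t)) => //.
  by move=> i; apply: cM => //; apply: cM => //; exact: cC.
move=> i x; refine (dE (dcomp (h := pwF p) (sol_dG _ _ _ _ _ sol i x t) (d_abs_powR p _ p1)) _).
by rewrite /pwf; ring.
Qed.
Let IZ3 : I Z3 = 0.
Proof.
apply: (div_radial (om^~ t) (fun i => om1 i ^~ t) c (Cc_om t) (fun i => cont_om1 i t) (fun i x => d_om x t i)
  (fun x => u x t ^+ 2) (fun i x => 2 * u x t * G i x t)) => //.
- exact: cX.
- by move=> i; apply: cM => //; apply: cM => //; exact: cC.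
- move=> i x; have du := sol_dG _ _ _ _ _ sol i x t.
  refine (dE (dM du du) _); ring.
Qed.
Let IZ4 : I Z4 = 0.
Proof.
exact: (ibp_lap (u^~ t) (fun i => G i ^~ t) (fun i => H i ^~ t) (om^~ t)
  (fun i => om1 i ^~ t) (cu t) (fun i => cG i t) (fun i => cH i t) (fun i x => sol_dG _ _ _ _ _ sol i x t)
  (fun i x => sol_dH _ _ _ _ _ sol i x t) (Cc_om t) (fun i => cont_om1 i t) (fun i x => d_om x t i)).
Qed.

Let CcZ1 : Cc Z1.
Proof.
apply: CcB.
  apply: CcMl => //; apply: CcD => //; apply: CcZ; exact: Cc_om.
apply: CcZ; apply: CcD; first apply: CcD.
- by apply: CcMl => //; apply: CcMl => //; exact: Cc_om.
- exact: CcMr.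
- by apply: CcMl => //; exact: Cc_om.
Qed.
Let Ccrad h (h1 : 'I_n -> rV -> R) : continuous h -> (forall i, continuous (h1 i)) ->
  Cc (fun x => om x t * (\sum_i (x ord0 i - c ord0 i) * h1 i x) + (n%:R * om x t + XWo t x) * h x).
Proof.
move=> ch ch1; apply: CcD; apply: CcMl => //; first exact: Cc_om.
  by apply: cS => i; apply: cM => //; apply: cB; [exact: cont_coord|exact: cC].
by apply: CcD => //; apply: CcZ; exact: Cc_om.
Qed.
Let CcZ2 : Cc Z2.
Proof.
apply: (Ccrad (fun x => pwF p (u x t)) (fun i x => (p + 1) * pwf p (u x t) * G i x t)) => // i.
by apply: cM => //; apply: cM => //; exact: cC.
Qed.
Let CcZ3 : Cc Z3.
Proof.
apply: (Ccrad (fun x => u x t ^+ 2) (fun i x => 2 * u x t * G i x t)); first exact: cX.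
by move=> i; apply: cM => //; apply: cM => //; exact: cC.
Qed.
Let CcZ4 : Cc Z4.
Proof.
apply: CcD; first apply: CcD.
- by apply: CcMl => //; apply: CcMl => //; exact: Cc_om.
- by apply: CcMl => //; exact: Cc_om.
- exact: CcMr.
Qed.

Let tau0 : t1 - t != 0. Proof. by rewrite gt_eqF//; move: ht; lra. Qed.
Let pp0 : p + 1 != 0. Proof. by rewrite gt_eqF//; move: p1; lra. Qed.
Let pm0 : p - 1 != 0. Proof. by rewrite gt_eqF//; move: p1; lra. Qed.

Let solV (x : rV) : V x t = Lt t x + pwf p (u x t).
Proof. exact: (sol_eq _ _ _ _ _ sol). Qed.

Let sumXf (k : rV -> R) (x : rV) : \sum_i (x ord0 i - c ord0 i) * (k x * G i x t) = k x * XG x t.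
Proof. by rewrite /XG mulr_sumr; apply: eq_bigr => i _; ring. Qed.

Lemma deriv_energy : is_derive t 1 En (- I dissip).
Proof.
have d1 : is_derive t 1 (fun s : R => t1 - s) (-1).
  by refine (dE (dB (dC t1 t 1) (is_derive_id _ _)) _); rewrite sub0r.
refine (dE (dD (dB (dM (dM d1 (dC _ _ _)) d_A1) (dM (dM d1 (dC _ _ _)) d_A2)) (dZ kap d_A3)) _).
have C1 : Cc (fun x => omt x t * N2 x t - 2 * V x t * (om x t * Lt t x + WGo t x)).
  apply: CcB; first exact: CcMl.
  by apply: CcMr; [apply: cM => //; exact: cC|apply: CcD => //; apply: CcMl => //; exact: Cc_om].
have C2 : Cc (fun x => omt x t * pwF p (u x t) + om x t * ((p + 1) * pwf p (u x t) * V x t)).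
  apply: CcD; first exact: CcMl.
  by apply: CcMl; [exact: Cc_om|apply: cM => //; apply: cM => //; exact: cC].
have C3 : Cc (fun x => omt x t * u x t ^+ 2 + om x t * (2 * u x t * V x t)).
  apply: CcD; first by apply: CcMl => //; exact: cX.
  by apply: CcMl; [exact: Cc_om|apply: cM => //; apply: cM => //; exact: cC].
have C4 : Cc (fun x => om x t * N2 x t) by apply: CcMl => //; exact: Cc_om.
have C5 : Cc (fun x => om x t * pwF p (u x t)) by apply: CcMl => //; exact: Cc_om.
(* The first five entries make up the derivative of [En] and the sixth is the dissipation. The
   multiples of [Z1], [Z2], [Z3] cancel the terms in |x - c|^2 that come from the time derivative of
   the weight; [Z4] exchanges [om] u times the Laplacian for first-order terms. *)
have E x : foldr (fun q a => q.1 * q.2 x + a) 0 [:: ((t1 - t) / 2,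
     fun x => omt x t * N2 x t - 2 * V x t * (om x t * Lt t x + WGo t x));
     (- (1 / 2), fun x => om x t * N2 x t);
     (- ((t1 - t) / (p + 1)), fun x => omt x t * pwF p (u x t) + om x t * ((p + 1) * pwf p (u x t) * V x t));
     (1 / (p + 1), fun x => om x t * pwF p (u x t));
     (kap, fun x => omt x t * u x t ^+ 2 + om x t * (2 * u x t * V x t)); (1, dissip);
     (- (1 / 4), Z1); (1 / (2 * (p + 1)), Z2); (- (kap / (2 * (t1 - t))), Z3); (2 * kap, Z4)] = 0.
  rewrite /= /dissip /Z1 /Z2 /Z3 /Z4 /Pf.
  rewrite (sumXf (fun x => 2 * u x t)).
  rewrite (_ : \sum_i _ = (p + 1) * pwf p (u x t) * XG x t); last first.
    by rewrite -(sumXf (fun x => (p + 1) * pwf p (u x t))); apply: eq_bigr => i _; ring.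
  rewrite /XWo /WGo XWf_om WGf_om solV -(pwfr _ _ p1).
  rewrite (_ : omt x t = - (bex / (t1 - t) + sq c x / (4 * (t1 - t) ^+ 2)) * om x t); last first.
    by rewrite /omt /om; ring.
  rewrite /bex /kap.
  move: (om x t) (N2 x t) (XG x t) (BG x t) (XB x t) (Lt t x) (u x t) (pwf p (u x t)) (sq c x).
  move=> w N S B X L v f q.
  by field; rewrite tau0 pp0 pm0.
have := I_comb0 _ _ E; rewrite /= IZ1 IZ2 IZ3 IZ4 => H0.
apply/eqP; rewrite -subr_eq0 -[X in _ == X]H0; first last.
  have CD := Cc_dissip; by repeat (split; [assumption|]).
by apply/eqP; rewrite /A1 /A2; field; rewrite tau0 pp0.
Qed.

(** The equation tested with [om] u, its first-order terms being expressed through [En] and [Pf].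
    This is how smallness of the energy and of the dissipation at one time passes to the integral of
    |u|^(p+1). *)
Lemma A2_identity : (p - 1) / (p + 1) * ((t1 - t) * A2 t) =
  2 * En t + I (fun x => om x t * u x t * Pf x t) + (t1 - t) * I (fun x => u x t * BG x t).
Proof.
have C1 : Cc (fun x => om x t * N2 x t) by apply: CcMl => //; exact: Cc_om.
have C2 : Cc (fun x => om x t * pwF p (u x t)) by apply: CcMl => //; exact: Cc_om.
have C3 : Cc (fun x => om x t * u x t ^+ 2) by apply: CcMl; [exact: Cc_om|exact: cX].
have C4 : Cc (fun x => om x t * u x t * Pf x t).
  by apply: CcMl => //; apply: CcMl => //; exact: Cc_om.
have C5 : Cc (fun x => u x t * BG x t) by apply: CcMr => //; exact: Cc_BG.
have E x : foldr (fun q a => q.1 * q.2 x + a) 0 [::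
    (- (t1 - t), fun x => om x t * pwF p (u x t));
    (t1 - t, fun x => om x t * N2 x t); (2 * kap, fun x => om x t * u x t ^+ 2);
    (1, fun x => om x t * u x t * Pf x t); (t1 - t, fun x => u x t * BG x t);
    (- (t1 - t), Z4)] = 0.
  rewrite /= /Z4 /Pf /WGo WGf_om solV -(pwfr _ _ p1).
  move: (om x t) (N2 x t) (XG x t) (BG x t) (Lt t x) (u x t) (pwf p (u x t)) kap.
  move=> w N S B L v f k.
  by field; rewrite tau0.
have := I_comb0 _ _ E; rewrite /= IZ4 => H0.
apply/eqP; rewrite -subr_eq0 -oppr_eq0 -[X in _ == X]H0; first last.
  by repeat (split; [assumption|]).
by apply/eqP; rewrite /En /A1 /A2 /A3; field; exact: pp0.
Qed.

(** The weighted L^2 balance. Integrated in time, it gives an instant at which the gradient term,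
    and hence the energy, is small. *)
Lemma deriv_A3 : is_derive t 1 A3 (- 2 * A1 t + 2 * A2 t - 4 * kap / (t1 - t) * A3 t
  - 2 * I (fun x => u x t * BG x t) - 1 / (2 * (t1 - t)) * I (fun x => XB x t * u x t ^+ 2)).
Proof.
refine (dE d_A3 _).
have C1 : Cc (fun x => om x t * N2 x t) by apply: CcMl => //; exact: Cc_om.
have C2 : Cc (fun x => om x t * pwF p (u x t)) by apply: CcMl => //; exact: Cc_om.
have C3 : Cc (fun x => om x t * u x t ^+ 2) by apply: CcMl; [exact: Cc_om|exact: cX].
have C5 : Cc (fun x => u x t * BG x t) by apply: CcMr => //; exact: Cc_BG.
have C6 : Cc (fun x => XB x t * u x t ^+ 2) by apply: CcMl; [exact: Cc_XB|exact: cX].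
have C7 : Cc (fun x => omt x t * u x t ^+ 2 + om x t * (2 * u x t * V x t)).
  apply: CcD; first by apply: CcMl => //; exact: cX.
  by apply: CcMl; [exact: Cc_om|apply: cM => //; apply: cM => //; exact: cC].
have E x : foldr (fun q a => q.1 * q.2 x + a) 0 [::
    (1, fun x => omt x t * u x t ^+ 2 + om x t * (2 * u x t * V x t));
    (2, fun x => om x t * N2 x t); (- 2, fun x => om x t * pwF p (u x t));
    (4 * kap / (t1 - t), fun x => om x t * u x t ^+ 2);
    (2, fun x => u x t * BG x t); (1 / (2 * (t1 - t)), fun x => XB x t * u x t ^+ 2);
    (- 2, Z4); (- (1 / (2 * (t1 - t))), Z3)] = 0.
  rewrite /= /Z4 /Z3 (sumXf (fun x => 2 * u x t)) /XWo /WGo XWf_om WGf_om.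
  rewrite solV -(pwfr _ _ p1).
  rewrite (_ : omt x t = - (bex / (t1 - t) + sq c x / (4 * (t1 - t) ^+ 2)) * om x t); last first.
    by rewrite /omt /om; ring.
  rewrite /bex.
  move: (om x t) (N2 x t) (XG x t) (BG x t) (XB x t) (Lt t x) (u x t) (pwf p (u x t)) (sq c x) kap.
  move=> w N S B X L v f q k.
  by field; rewrite tau0.
have := I_comb0 _ _ E; rewrite /= IZ3 IZ4 => H0.
apply/eqP; rewrite -subr_eq0 -[X in _ == X]H0; first last.
  by repeat (split; [assumption|]).
by apply/eqP; rewrite /A1 /A2 /A3; field; rewrite tau0.
Qed.
End at_time.
End energy.

(** * The local L^2 balance without Gaussian weight *)

Section caccioppoli.
Context {R : realType} {n : nat}.
Notation rV := 'rV[R]_n.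
Variables (p : R) (u V : rV -> R -> R) (G H : 'I_n -> rV -> R -> R).
Hypothesis p1 : 1 < p.
Hypothesis sol : Sol p u V G H.
Variables (zeta : rV -> R) (zeta1 : 'I_n -> rV -> R).
Hypothesis czeta : Cc zeta.
Hypothesis czeta1 : forall i, continuous (zeta1 i).
Hypothesis dzeta : forall i x, is_derive x (ev i) zeta (zeta1 i x).

(** This is the source of control on the integral of |grad u|^2, which enters the error terms of the
    energy. *)
Lemma caccioppoli_deriv (t : R) : -2 < t < 0 ->
  is_derive t 1 (fun s => I (fun x => zeta x * u x s ^+ 2))
   (- 2 * I (fun x => zeta x * \sum_i G i x t ^+ 2)
    - 2 * I (fun x => u x t * \sum_i zeta1 i x * G i x t)
    + 2 * I (fun x => zeta x * pwF p (u x t))).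
Proof.
move=> ht.
have [cz [N sN]] := czeta.
have cu s : continuous (u^~ s) by exact: cslice1 (sol_cu _ _ _ _ _ sol).
have cG i s : continuous (G i^~ s) by exact: cslice1 (sol_cG _ _ _ _ _ sol i).
have cH i s : continuous (H i^~ s) by exact: cslice1 (sol_cH _ _ _ _ _ sol i).
have cV s : continuous (V^~ s) by exact: cslice1 (sol_cV _ _ _ _ _ sol).
have Cz1 i : Cc (zeta1 i) by exact: (CcV _ _ _ czeta (czeta1 i) (dzeta i)).
have cF : continuous (fun x => pwF p (u x t)).
  exact: (ccomp (u^~ t) (pwF p) (cu t) (pwF_cont p p1)).
have cN : continuous (fun x => \sum_i G i x t ^+ 2) by apply: cS => i; apply: cX.
have D : is_derive t 1 (fun s => I (fun x => zeta x * u x s ^+ 2))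
    (I (fun x => zeta x * (2 * u x t * V x t))).
  have cuab := cab_cont (-2) 0 _ (sol_cu _ _ _ _ _ sol).
  apply: (@I_deriv_cab R n (fun x s => zeta x * u x s ^+ 2)
    (fun x s => zeta x * (2 * u x s * V x s)) (-2) 0 t N ht).
  - by apply: cabM; [exact: cab_const|exact: cabX].
  - apply: cabM; first exact: cab_const.
    apply: cabM; last exact: (cab_cont _ _ _ (sol_cV _ _ _ _ _ sol)).
    by apply: cabM => //; apply: cab_const; exact: cC.
  - by move=> s _ x Nx; rewrite (sN x Nx) mul0r.
  - by move=> s _ x Nx; rewrite (sN x Nx) mul0r.
  - move=> x s hs; have du := sol_dt _ _ _ _ _ sol x s hs.
    by refine (dE (dM (dC (zeta x) s 1) (dM du du)) _); ring.
refine (dE D _).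
have IZ := ibp_lap (u^~ t) (fun i => G i ^~ t) (fun i => H i ^~ t) zeta zeta1 (cu t)
  (fun i => cG i t) (fun i => cH i t) (fun i x => sol_dG _ _ _ _ _ sol i x t)
  (fun i x => sol_dH _ _ _ _ _ sol i x t) czeta czeta1 dzeta.
have C1 : Cc (fun x => zeta x * (2 * u x t * V x t)).
  by apply: CcMl => //; apply: cM => //; apply: cM => //; exact: cC.
have C2 : Cc (fun x => zeta x * \sum_i G i x t ^+ 2) by exact: CcMl.
have C3 : Cc (fun x => u x t * \sum_i zeta1 i x * G i x t).
  by apply: CcMr => //; apply: CcS => i; exact: CcMl.
have C4 : Cc (fun x => zeta x * pwF p (u x t)) by exact: CcMl.
have C5 : Cc (fun x => zeta x * u x t * Lf (fun i => H i^~ t) x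
    + zeta x * Nf (fun i => G i^~ t) x + u x t * WGf (fun i => G i^~ t) zeta1 x).
  apply: CcD; first apply: CcD => //.
    by apply: CcMl; [exact: CcMl|apply: cS => i].
  exact: C3.
have E x : foldr (fun q a => q.1 * q.2 x + a) 0 [::
    (1, fun x => zeta x * (2 * u x t * V x t));
    (2, fun x => zeta x * \sum_i G i x t ^+ 2);
    (2, fun x => u x t * \sum_i zeta1 i x * G i x t);
    (- 2, fun x => zeta x * pwF p (u x t));
    (- 2, fun x => zeta x * u x t * Lf (fun i => H i^~ t) x
    + zeta x * Nf (fun i => G i^~ t) x + u x t * WGf (fun i => G i^~ t) zeta1 x)] = 0.
  rewrite /= (sol_eq _ _ _ _ _ sol) -(pwfr _ _ p1) /Lf /Nf /WGf; ring.
have := I_comb0 _ _ E; rewrite /= IZ => H0.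
apply/eqP; rewrite -subr_eq0 -[X in _ == X]H0; first by apply/eqP; ring.
by repeat (split; [assumption|]).
Qed.
End caccioppoli.

(** * Cutoffs and Gaussian bounds *)

Section cutoff.
Context {R : realType}.

Definition c3 (s : R) : R := Num.max s 0 ^+ 3.

Lemma c3_ge0 s : 0 <= c3 s. Proof. by rewrite exprn_ge0// le_max lexx orbT. Qed.
Lemma max0_ge0 (s : R) : 0 <= Num.max s 0. Proof. by rewrite le_max lexx orbT. Qed.
Lemma max0_cont : continuous (fun s : R => Num.max s 0).
Proof. by apply: (@cMax _ _ id (fun=> 0)); [move=> x; exact: cvg_id|exact: cC]. Qed.
Lemma c3_cont : continuous c3. Proof. exact: (cX _ 3 max0_cont). Qed.
Lemma c3_homo s r : s <= r -> c3 s <= c3 r.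
Proof.
move=> sr; apply: lerXn2r; rewrite ?nnegrE ?max0_ge0//.
by rewrite ge_max !le_max sr/= lexx orbT.
Qed.
Lemma c3_le0 s : s <= 0 -> c3 s = 0.
Proof. by move=> s0; rewrite /c3 max_r// expr0n. Qed.
Lemma c31 : c3 1 = 1.
Proof. by rewrite /c3 max_l ?ler01// expr1n. Qed.

Lemma d_c3 (s : R) : is_derive s 1 c3 (3 * Num.max s 0 ^+ 2).
Proof.
have [s0|s0|->] := ltgtP s 0.
- rewrite expr0n mulr0.
  apply: (@near_eq_is_derive _ _ _ (fun=> 0)).
  near=> r; rewrite c3_le0//; apply: ltW; near: r; exact: lt_nbhsl.
- apply: (@near_eq_is_derive _ _ _ (fun r : R => r * (r * r))).
    near=> r; rewrite /c3 max_l; first by rewrite !exprS expr0 mulr1.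
    by apply: ltW; near: r; exact: lt_nbhsr.
  have d1 : is_derive s 1 (fun r : R => r) 1 by exact: is_derive_id.
  by refine (dE (dM d1 (dM d1 d1)) _); ring.
- rewrite expr0n mulr0; apply: is_derive_quot.
  rewrite c3_le0//; apply/cvgrPdist_lt => e e0; near=> h.
  have h0 : h != 0 by near: h; exact: nbhs_dnbhs_neq.
  have h1 : `|h| < Num.min 1 e.
    by near: h; apply: (@dnbhs0_lt R R); rewrite lt_min ltr01 e0.
  move: h1; rewrite lt_min => /andP[h1 he].
  rewrite sub0r normrN subr0 addr0; apply: le_lt_trans he.
  have [hp|hn] := leP h 0; first by rewrite c3_le0// mulr0 normr0.
  rewrite /c3 max_l ?(ltW hn)// exprS mulKf// normrX.
  by rewrite expr2 ler_piMl// ltW.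
Unshelve. all: by end_near. Qed.

Context {n : nat}.
Notation rV := 'rV[R]_n.

(** To be used with q = |x - c|^2 / r^2: equal to 1 for q <= 9/16 and to 0 for q >= 1, so the
    transition lies between radii 3r/4 and r. The factor 16/7 maps [9/16, 1] onto [0, 1]. *)
Definition chi (q : R) : R := c3 (1 - c3 (16 / 7 * (q - 9 / 16))).
Definition chi' (q : R) : R :=
  3 * Num.max (1 - c3 (16 / 7 * (q - 9 / 16))) 0 ^+ 2 *
  - (3 * Num.max (16 / 7 * (q - 9 / 16)) 0 ^+ 2 * (16 / 7)).

Lemma chi_ge0 q : 0 <= chi q. Proof. exact: c3_ge0. Qed.
Lemma chi_le1 q : chi q <= 1.
Proof. by rewrite /chi -[leRHS]c31; apply: c3_homo; rewrite lerBlDr lerDl c3_ge0. Qed.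
Lemma chi_in q : q <= 9 / 16 -> chi q = 1.
Proof. by move=> h; rewrite /chi (c3_le0 (_ * _)) ?subr0 ?c31//; lra. Qed.
Lemma chi_out q : 1 <= q -> chi q = 0.
Proof.
move=> h; rewrite /chi c3_le0// subr_le0 -[leLHS]c31; apply: c3_homo; lra.
Qed.
Lemma chi_homo q r : q <= r -> chi r <= chi q.
Proof.
move=> qr; apply: c3_homo; rewrite lerD2l lerN2; apply: c3_homo; lra.
Qed.
Lemma chi_cont : continuous chi.
Proof.
apply: (ccomp (fun q : R => 1 - c3 (16 / 7 * (q - 9 / 16))) c3); last exact: c3_cont.
apply: cB; first exact: cC.
apply: (ccomp (fun q : R => 16 / 7 * (q - 9 / 16)) c3); last exact: c3_cont.
by apply: cM; [exact: cC|apply: cB; [move=> x; exact: cvg_id|exact: cC]].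
Qed.
Lemma d_chi (q : R) : is_derive q 1 chi (chi' q).
Proof.
have d1 : is_derive q 1 (fun r : R => r) 1 by exact: is_derive_id.
have d2 := dZ (16 / 7) (dB d1 (dC (9 / 16) q 1)).
refine (dE (dcomp (h := c3) (dB (dC 1 q 1) (dcomp (h := c3) d2 (d_c3 _))) (d_c3 _)) _).
by rewrite /chi' subr0 mulr1 sub0r.
Qed.
Lemma chi'_cont : continuous chi'.
Proof.
have c1 : continuous (fun q : R => 16 / 7 * (q - 9 / 16)).
  by apply: cM; [exact: cC|apply: cB; [move=> x; exact: cvg_id|exact: cC]].
apply: cM.
  apply: cM; first exact: cC.
  apply: cX; apply: (ccomp (fun q : R => 1 - c3 (16 / 7 * (q - 9 / 16))) (fun s : R => Num.max s 0)).
    by apply: cB; [exact: cC|apply: (ccomp _ c3 c1); exact: c3_cont].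
  exact: max0_cont.
apply: cN; apply: cM; last exact: cC.
apply: cM; first exact: cC.
by apply: cX; apply: (ccomp _ (fun s : R => Num.max s 0) c1); exact: max0_cont.
Qed.
Lemma chi'_in q : q <= 9 / 16 -> chi' q = 0.
Proof.
move=> h; rewrite /chi' (_ : Num.max (16 / 7 * (q - 9 / 16)) 0 = 0); first by ring.
by apply: max_r; lra.
Qed.
Lemma chi'_out q : 1 <= q -> chi' q = 0.
Proof.
move=> h; rewrite /chi' (_ : Num.max (1 - _) 0 = 0); first by ring.
by apply: max_r; rewrite subr_le0 -[leLHS]c31; apply: c3_homo; lra.
Qed.
(* [c3 >= 0] vanishes to third order, so its derivative is bounded by [c3 ^ (2/3)]. *)
Lemma chi'_sq q : 0 <= q -> q * chi' q ^+ 2 <= 500 * chi q.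
Proof.
move=> q0; have [q1|q1] := leP 1 q.
  by rewrite chi'_out// expr0n mulr0; apply: mulr_ge0; [exact: ler0n|exact: chi_ge0].
have [qi|qi] := leP q (9 / 16).
  by rewrite chi'_in// expr0n mulr0; apply: mulr_ge0; [exact: ler0n|exact: chi_ge0].
rewrite /chi' /chi /c3.
set s := Num.max (16 / 7 * (q - 9 / 16)) 0.
have s01 : 0 <= s <= 1 by rewrite max0_ge0 ge_max ler01 andbT; lra.
set m := Num.max (1 - s ^+ 3) 0.
have m01 : 0 <= m <= 1.
  rewrite max0_ge0 ge_max ler01 andbT /= lerBlDr lerDl exprn_ge0//.
  by case/andP: s01.
have m3 : 0 <= m ^+ 3 by rewrite exprn_ge0//; case/andP: m01.
have m4 : m ^+ 4 <= m ^+ 3.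
  by case/andP: m01 => ? ?; rewrite [leLHS]exprS ler_piMl.
have s4 : s ^+ 4 <= 1.
  by case/andP: s01 => ? ?; rewrite exprn_ile1.
have s4p : 0 <= s ^+ 4 by rewrite exprn_ge0//; case/andP: s01.
rewrite (_ : _ ^+ 2 = (16 / 7) ^+ 2 * 81 * (m ^+ 4 * s ^+ 4)); last by ring.
have h1 : m ^+ 4 * s ^+ 4 <= m ^+ 3.
  apply: le_trans m4; rewrite ler_piMr// exprn_ge0//; by case/andP: m01.
have h2 : 0 <= m ^+ 4 * s ^+ 4 by rewrite mulr_ge0// exprn_ge0//; case/andP: m01.
apply: (@le_trans _ _ ((16 / 7) ^+ 2 * 81 * (m ^+ 4 * s ^+ 4))).
  by rewrite ler_piMl ?(ltW q1)// mulr_ge0//; lra.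
by nra.
Qed.

Definition cut (c : rV) (r : R) (x : rV) : R := chi (sq c x / r ^+ 2).
Definition cut1 (c : rV) (r : R) i (x : rV) : R :=
  chi' (sq c x / r ^+ 2) * (2 * (x ord0 i - c ord0 i) / r ^+ 2).

Lemma cut_ge0 c r x : 0 <= cut c r x. Proof. exact: chi_ge0. Qed.
Lemma cut_le1 c r x : cut c r x <= 1. Proof. exact: chi_le1. Qed.
Lemma d_cut (c : rV) (r : R) i (x : rV) : is_derive x (ev i) (cut c r) (cut1 c r i x).
Proof.
refine (dE (dcomp (h := chi) (dM (d_sq c x i) (dC (r ^- 2) x (ev i))) (d_chi _)) _).
by rewrite /cut1 mulr0 add0r; congr (_ * _); rewrite mulrC.
Qed.
Lemma cut_cont c r : continuous (cut c r).
Proof.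
apply: (ccomp (fun x => sq c x / r ^+ 2) chi); last exact: chi_cont.
by apply: cM; [exact: cont_sq|exact: cC].
Qed.
Lemma cut1_cont c r i : continuous (cut1 c r i).
Proof.
apply: cM.
  apply: (ccomp (fun x => sq c x / r ^+ 2) chi'); last exact: chi'_cont.
  by apply: cM; [exact: cont_sq|exact: cC].
apply: cM; last exact: cC.
by apply: cM; [exact: cC|apply: cB; [exact: cont_coord|exact: cC]].
Qed.

Lemma cut_in c r x : 0 < r -> sq c x <= 9 / 16 * r ^+ 2 -> cut c r x = 1.
Proof. by move=> r0 h; apply: chi_in; rewrite ler_pdivrMr// exprn_gt0. Qed.
Lemma cut_out c r x : 0 < r -> r ^+ 2 <= sq c x -> cut c r x = 0.
Proof. by move=> r0 h; apply: chi_out; rewrite ler_pdivlMr ?exprn_gt0// mul1r. Qed.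
Lemma cut1_in c r i x : 0 < r -> sq c x <= 9 / 16 * r ^+ 2 -> cut1 c r i x = 0.
Proof. by move=> r0 h; rewrite /cut1 chi'_in ?mul0r// ler_pdivrMr// exprn_gt0. Qed.
Lemma cut1_out c r i x : 0 < r -> r ^+ 2 <= sq c x -> cut1 c r i x = 0.
Proof. by move=> r0 h; rewrite /cut1 chi'_out ?mul0r// ler_pdivlMr ?exprn_gt0// mul1r. Qed.

Lemma coord_sq (c x : rV) i : (x ord0 i - c ord0 i) ^+ 2 <= sq c x.
Proof.
rewrite /sq (bigD1 i)//= lerDl sumr_ge0// => j _; exact: sqr_ge0.
Qed.

Lemma sq_norm (c x : rV) : sq c x <= n%:R * `|x - c| ^+ 2.
Proof.
rewrite /sq; apply: (@le_trans _ _ (\sum_(i < n) `|x - c| ^+ 2)).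
  apply: ler_sum => i _; rewrite -real_normK ?num_real//.
  apply: lerXn2r; rewrite ?nnegrE//.
  have := coord_le_norm (x - c) i; by rewrite !mxE.
by rewrite sumr_const card_ord mulr_natl.
Qed.

Lemma norm_sq (c x : rV) (r : R) : 0 <= r -> sq c x <= r ^+ 2 -> `|x - c| <= r.
Proof.
move=> r0 h; apply: norm_leP => // i; rewrite !mxE.
rewrite -(@ler_pXn2r _ 2) ?nnegrE// real_normK ?num_real//.
exact: le_trans (coord_sq c x i) h.
Qed.

Lemma cut_supp c r : 0 < r -> supp_in (`|c| + r) (cut c r).
Proof.
move=> r0 x h; apply: cut_out => //.
rewrite leNgt; apply/negP => h2.
have := norm_sq c x r (ltW r0) (ltW h2) => h3.
have : `|x| <= `|x - c| + `|c| by rewrite -[X in `|X| <= _](subrK c) ler_normD.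
lra.
Qed.

Lemma Cc_cut c r : 0 < r -> Cc (cut c r).
Proof. by move=> r0; split; [exact: cut_cont|exists (`|c| + r); exact: cut_supp]. Qed.

(** Bounding the squared gradient by the cutoff itself lets Young's inequality absorb gradient terms
    into integrals carrying the same cutoff. *)
Lemma cut1_sq c r x : 1 <= r -> \sum_i cut1 c r i x ^+ 2 <= 2000 * cut c r x.
Proof.
move=> r1; have r0 : 0 < r by lra.
have -> : \sum_i cut1 c r i x ^+ 2 =
   4 / r ^+ 2 * (sq c x / r ^+ 2 * chi' (sq c x / r ^+ 2) ^+ 2).
  transitivity (\sum_i (4 / r ^+ 2 * chi' (sq c x / r ^+ 2) ^+ 2 / r ^+ 2) *
      (x ord0 i - c ord0 i) ^+ 2).
    by apply: eq_bigr => i _; rewrite /cut1; field; rewrite gt_eqF.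
  by rewrite -mulr_sumr -/(sq c x); field; rewrite gt_eqF.
have q0 : 0 <= sq c x / r ^+ 2 by rewrite divr_ge0 ?sq_ge0// exprn_ge0// ltW.
have h := chi'_sq _ q0.
have h0 : 0 <= sq c x / r ^+ 2 * chi' (sq c x / r ^+ 2) ^+ 2 by rewrite mulr_ge0// sqr_ge0.
have r2 : 4 / r ^+ 2 <= 4.
  by rewrite ler_pdivrMr ?exprn_gt0// ler_peMr// exprn_ege1.
have r2p : 0 <= 4 / r ^+ 2 by rewrite divr_ge0// exprn_ge0// ltW.
apply: (@le_trans _ _ (4 * (500 * chi (sq c x / r ^+ 2)))).
  by apply: ler_pM.
by rewrite mulrA /cut; lra.
Qed.

Lemma cut_le_cut2 c r x : 0 < r -> cut c r x <= cut c (2 * r) x.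
Proof.
move=> r0; have [h|h] := leP (r ^+ 2) (sq c x).
  by rewrite cut_out// cut_ge0.
rewrite (cut_in c (2 * r)); first exact: cut_le1.
  by rewrite mulr_gt0.
have : 0 < r ^+ 2 by rewrite exprn_gt0.
by rewrite exprMn; lra.
Qed.

Lemma I_cut c r : 0 < r -> I (cut c r) = r ^+ n * I (cut 0 1).
Proof.
move=> r0; rewrite -(@I_affine R n (cut c r) c r r0 (Cc_cut c r r0)); congr (_ * _).
apply: I_ext => x; rewrite /cut /sq; congr chi.
rewrite expr1n divr1 mulr_suml; apply: eq_bigr => i _; rewrite !mxE.
by field; rewrite gt_eqF.
Qed.

Lemma I_cut_gt0 : 0 < I (cut (0 : rV) 1).
Proof.
have [d d0 hd] : exists2 d : R, 0 < d & n%:R * d ^+ 2 <= 9 / 16.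
  (* The cube of this half-side lies in the ball of radius 3/4, where the cutoff is 1; the successor
     keeps the denominator positive in dimension 0. *)
  exists (3 / 4 / (n.+1%:R)); first by rewrite divr_gt0// ltr0n.
  have n1 : (1 : R) <= n.+1%:R by rewrite ler1n.
  have nn : (n%:R : R) <= n.+1%:R by rewrite ler_nat.
  rewrite exprMn exprVn mulrCA; apply: (@le_trans _ _ ((3 / 4) ^+ 2 * 1)); last by lra.
  rewrite ler_wpM2l ?sqr_ge0// ler_pdivrMr ?exprn_gt0 ?ltr0n// mul1r.
  apply: le_trans nn _; by rewrite expr2 ler_peMr// ler0n.
have -> : 0 = 0 * fine (@lebesgue_rV R n [set x : rV | `|x| <= d]) by rewrite mul0r.
apply: (@lt_le_trans _ _ (1 * fine (@lebesgue_rV R n [set x : rV | `|x| <= d]))).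
  rewrite mul0r mul1r lebesgue_cube ?(ltW d0)//= exprn_gt0// mulr_gt0//.
rewrite -(Rintegral_cst _ (measurable_cube d)) Rintegral_mkcond.
apply: le_Rintegral => //.
- apply: (@supp_integrable _ _ d 1).
  + by apply/(measurable_restrictT _ (measurable_cube d)); exact: measurable_cst.
  + by move=> x Nx; rewrite /= patchE memNset//=; apply/negP; rewrite -ltNge.
  + by move=> x; rewrite patchE; case: ifP; rewrite ?normr0 ?normr1.
- exact: Cc_integrable (Cc_cut 0 1 ltr01).
- move=> x _; rewrite patchE; case: ifPn => [|_]; last exact: cut_ge0.
  rewrite inE /= => xd; rewrite cut_in// expr1n mulr1.
  apply: le_trans (sq_norm _ _) _; apply: le_trans hd.
  by rewrite subr0 ler_wpM2l ?ler0n// lerXn2r ?nnegrE ?(ltW d0).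
Qed.
End cutoff.

(** * The mass of the Gaussian weight *)

Section gauss_bound.
Context {R : realType} {n : nat}.
Notation rV := 'rV[R]_n.
Notation gs := (fun x : rV => expR (- (sq 0 x / 4))).

Let cgs : continuous gs.
Proof.
apply: (ccomp (fun x => - (sq 0 x / 4)) expR); last exact: continuous_expR.
by apply: cN; apply: cM; [exact: cont_sq|exact: cC].
Qed.

(* Beyond a fixed radius [e^(-|x|^2/4)] is at most [2^(-n-1)] times its dilation by 2,
   so the integral is at most a constant plus half of itself. *)
Lemma gauss_cut_bound : exists2 C : R, 0 < C & forall r, 0 < r ->
  I (fun x => cut 0 r x * gs x) <= C.
Proof.
have [q0 q00 hq0] : exists2 q0 : R, 0 < q0 &
    forall q, q0 ^+ 2 * (9 / 16) <= q -> expR (- (3 * q / 16)) <= (2 ^+ n.+1)^-1.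
  (* Large enough for 1 + 3q/16, a lower bound of e^(3q/16), to exceed 2^(n+1). *)
  exists (8 * (2 ^+ n.+1)); first by rewrite mulr_gt0// exprn_gt0.
  move=> q hq; rewrite expRN lef_pV2 ?posrE ?expR_gt0 ?exprn_gt0//.
  apply: le_trans (expR_ge1Dx _); apply: (@le_trans _ _ (3 * q / 16)); last by lra.
  have t1 : (1 : R) <= 2 ^+ n.+1 by apply: exprn_ege1; lra.
  by move: (2 ^+ n.+1) t1 hq => t t1; nra.
pose V0 := I (cut (0 : rV) q0).
have V00 : 0 < V0.
  by rewrite /V0 I_cut// mulr_gt0 ?exprn_gt0// I_cut_gt0.
exists (2 * V0); first by rewrite mulr_gt0.
move=> r r0.
have Cr : Cc (fun x : rV => cut 0 r x * gs x) by apply: CcMl => //; exact: Cc_cut.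
have Cr2 : Cc (fun x : rV => cut 0 r (2 *: x + 0) * gs (2 *: x + 0)).
  exact: (Cc_translate _ _ _ _ Cr).
have E : I (fun x : rV => cut 0 r x * gs x) <=
    V0 + 2^-1 * I (fun x : rV => cut 0 r x * gs x).
  have sq2 (x : rV) : sq 0 (2^-1 *: x + 0) = sq 0 x / 4.
    by rewrite /sq mulr_suml; apply: eq_bigr => i _; rewrite !mxE; field.
  have Ch : Cc (fun x : rV => cut 0 r x * gs (2^-1 *: x + 0)).
    apply: CcMl; first exact: Cc_cut.
    exact: (ccomp _ _ (cont_affine _ _) cgs).
  set y := I (fun x : rV => cut 0 q0 x + (2 ^+ n.+1)^-1 * (cut 0 r x * gs (2^-1 *: x + 0))).
  apply: (@le_trans _ _ y); rewrite /y.
    apply: I_le => //; first by apply: CcD; [exact: Cc_cut|exact: CcZ].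
    move=> x; have [h|h] := leP (q0 ^+ 2 * (9 / 16)) (sq 0 x).
      apply: (@le_trans _ _ ((2 ^+ n.+1)^-1 * (cut 0 r x * gs (2^-1 *: x + 0)))); last first.
        by rewrite lerDr cut_ge0.
      rewrite mulrCA ler_wpM2l ?cut_ge0//.
      rewrite (_ : gs x = expR (- (3 * sq 0 x / 16)) * gs (2^-1 *: x + 0)).
        by rewrite ler_wpM2r ?expR_ge0// hq0.
      by rewrite -expRD sq2; congr expR; field.
    rewrite (cut_in 0 q0)//; last by lra.
    apply: (@le_trans _ _ 1); last first.
      by rewrite lerDl mulr_ge0 ?invr_ge0 ?exprn_ge0// mulr_ge0 ?cut_ge0 ?expR_ge0.
    rewrite -[leRHS]mulr1 ler_pM ?cut_ge0 ?expR_ge0 ?cut_le1//.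
    by rewrite -expR0 ler_expR oppr_le0 divr_ge0 ?sq_ge0.
  rewrite I_D; [|exact: Cc_cut|exact: CcZ].
  rewrite lerD2l I_Z// -(@I_affine R n _ 0 2 _ Ch)//.
  rewrite mulrA (_ : (2 ^+ n.+1)^-1 * 2 ^+ n = 2^-1); last first.
    by rewrite exprS invfM -mulrA mulVf ?mulr1// expf_neq0.
  have C2 : Cc (fun x : rV => cut 0 r (2 *: x + 0) * gs (2^-1 *: (2 *: x + 0) + 0)).
    exact: (Cc_translate _ _ _ _ Ch).
  rewrite ler_wpM2l ?invr_ge0//.
  apply: I_le => // x; rewrite addr0 scalerA mulVf// scale1r addr0.
  rewrite ler_wpM2r ?expR_ge0// /cut; apply: chi_homo.
  rewrite ler_pM2r ?invr_gt0 ?exprn_gt0//.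
  rewrite /sq; apply: ler_sum => i _; rewrite !mxE !subr0 exprMn.
  by have := sqr_ge0 (x ord0 i); lra.
by lra.
Qed.

(** The substitution x = c + sqrt(tau) y removes [c] and [tau], so one constant serves all centres,
    times and cutoffs. *)
Lemma gauss_bound : exists2 C : R, 0 < C & forall (phi : rV -> R) (c : rV) (tau : R),
  0 < tau -> Cc phi -> (forall x, 0 <= phi x <= 1) ->
  I (fun x => phi x * expR (- (n%:R / 2) * ln tau - sq c x * (4 * tau)^-1)) <= C.
Proof.
have [C C0 hC] := gauss_cut_bound; exists C => // phi c tau t0 cphi hphi.
pose s := Num.sqrt tau.
have s0 : 0 < s by rewrite sqrtr_gt0.
have ss : s ^+ 2 = tau by rewrite sqr_sqrtr// ltW.
have Cf : Cc (fun x => phi x * expR (- (n%:R / 2) * ln tau - sq c x * (4 * tau)^-1)).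
  apply: CcMl => //.
  apply: (ccomp (fun x => - (n%:R / 2) * ln tau - sq c x * (4 * tau)^-1) expR); last exact: continuous_expR.
  by apply: cB; [exact: cC|apply: cM; [exact: cont_sq|exact: cC]].
have Cp : Cc (fun x => phi (s *: x + c)) by exact: Cc_translate.
rewrite -(I_affine _ c s s0 Cf).
rewrite (I_ext _ (fun x => s ^- n * (phi (s *: x + c) * gs x))); last first.
  move=> x; rewrite mulrCA; congr (_ * _).
  rewrite expRD; congr (_ * _).
    rewrite -ss lnXn// mulr_natl -[s in RHS]lnK ?posrE// -expRM_natl -expRN; congr expR.
    by field.
  congr expR; congr (- _); rewrite /sq !mulr_suml; apply: eq_bigr => i _.
  by rewrite !mxE -ss; field; rewrite gt_eqF.
rewrite I_Z; last exact: CcMl.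
rewrite mulrA divff ?mul1r ?expf_neq0 ?gt_eqF//.
case: (Cp) => _ [N sN].
(* Since |x|^2 is at most n times the squared sup norm, the cutoff of this radius is 1 on the
   support of the rescaled [phi]. *)
pose r := 2 * (n%:R + 1) * (`|N| + 1).
have r0 : 0 < r by rewrite /r mulr_gt0// ?mulr_gt0// ?ltr_pwDr// ler0n.
apply: le_trans (hC r r0); apply: I_le.
- exact: CcMl.
- by apply: CcMl => //; exact: Cc_cut.
- move=> x; rewrite ler_wpM2r ?expR_ge0//.
  have [h|h] := leP `|x| N; last by rewrite sN// cut_ge0.
  rewrite cut_in//; first by case/andP: (hphi (s *: x + c)).
  apply: le_trans (sq_norm _ _) _; rewrite subr0.
  have xN : `|x| <= `|N| + 1 by apply: le_trans h _; rewrite (le_trans (ler_norm _))// lerDl.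
  rewrite /r exprMn; move: (xN) => /(lerXn2r 2); rewrite !nnegrE => /(_ (normr_ge0 _)).
  have n0 : 0 <= n%:R :> R by rewrite ler0n.
  move=> /(_ (addr_ge0 (normr_ge0 _) ler01)).
  have := sqr_ge0 (`|N| + 1); move: (`|x| ^+ 2) ((`|N| + 1) ^+ 2) => u v v0 uv.
  rewrite exprMn; nra.
Qed.
End gauss_bound.

(** * Decay of the localized energy *)

Section inequalities.
Context {R : realType}.

Lemma cauchy_schwarz m (a b : 'I_m -> R) :
  (\sum_i a i * b i) ^+ 2 <= (\sum_i a i ^+ 2) * (\sum_i b i ^+ 2).
Proof.
set sab := \sum_i a i * b i; set saa := \sum_i a i ^+ 2; set sbb := \sum_i b i ^+ 2.
have bb0 : 0 <= sbb by apply: sumr_ge0 => i _; exact: sqr_ge0.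
have H l : 0 <= saa - 2 * l * sab + l ^+ 2 * sbb.
  have -> : saa - 2 * l * sab + l ^+ 2 * sbb = \sum_i (a i - l * b i) ^+ 2.
    rewrite /saa /sab /sbb !mulr_sumr -sumrB -big_split /=.
    by apply: eq_bigr => i _; ring.
  by apply: sumr_ge0 => i _; exact: sqr_ge0.
have [b0|b0] := eqVneq sbb 0.
  have [s0|s0] := eqVneq sab 0; first by rewrite s0 b0 mulr0 expr0n.
  have := H ((saa + 1) / (2 * sab)); rewrite b0 mulr0 addr0.
  rewrite (_ : 2 * _ * sab = saa + 1); first by lra.
  by field.
have bp : 0 < sbb by rewrite lt_neqAle eq_sym b0.
have := H (sab / sbb).
rewrite (_ : _ + _ = (saa * sbb - sab ^+ 2) / sbb); last by field.
by rewrite pmulr_lge0 ?invr_gt0// subr_ge0.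
Qed.

Lemma abs_le_amgm (x y z : R) : 0 <= x -> 0 <= y -> z ^+ 2 <= 4 * x * y -> `|z| <= x + y.
Proof.
move=> x0 y0 h; rewrite -(@ler_pXn2r _ 2) ?nnegrE// ?addr_ge0//.
rewrite real_normK ?num_real//; have := sqr_ge0 (x - y); nra.
Qed.

(** Mean value inequality for a function whose derivative is known only through an upper bound; a
    derivative is chosen at each point. *)
Lemma MVT_ab (f df : R -> R) (a b : R) : a < b ->
  (forall x, a <= x <= b -> exists2 d, is_derive x 1 f d & d <= df x) ->
  exists2 c, a < c < b & f b - f a <= df c * (b - a).
Proof.
move=> ab h.
pose g (x : R) : R := get [set d : R | is_derive x 1 f d /\ d <= df x].
have hg (x : R) : a <= x <= b -> is_derive x 1 f (g x) /\ g x <= df x.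
  by move=> /h [d d1 d2]; rewrite /g; case: xgetP => [y _ []//|/(_ d)]; case.
have [c hc E] := MVT_oo f g a b ab (fun x hx => (hg x hx).1).
exists c => //; rewrite E ler_wpM2r ?subr_ge0 ?(ltW ab)//.
by apply: (hg c _).2; lra.
Qed.

(** Split at the level l: below it v^2 <= l^2, above it v^2 <= l^(1-p) |v|^(p+1). The free level
    replaces Hölder's inequality. *)
Lemma sq_le_lambda (p v l : R) : 1 < p -> 0 < l -> v ^+ 2 <= l ^+ 2 + l `^ (1 - p) * pwF p v.
Proof.
move=> p1 l0; rewrite -real_normK ?num_real// /pwF; have [vl|lv] := leP `|v| l.
  rewrite -[leLHS]addr0 lerD// ?mulr_ge0 ?powR_ge0//.
  by apply: lerXn2r; rewrite ?nnegrE ?(ltW l0)//.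
rewrite -[leLHS]add0r lerD ?sqr_ge0//.
have v0 : 0 < `|v| by exact: lt_trans lv.
rewrite (_ : p + 1 = 2 + (p - 1)); last by ring.
rewrite (@powRD _ `|v| 2 (p - 1)); last by apply/implyP => _; rewrite gt_eqF.
rewrite powR_mulrn// mulrCA ler_peMr ?sqr_ge0//.
rewrite (_ : 1 - p = - (p - 1)); last by ring.
rewrite powRN mulrC ler_pdivlMr ?powR_gt0// mul1r.
by apply: ge0_ler_powR; rewrite ?nnegrE ?(ltW l0) ?(ltW lv)//; lra.
Qed.
End inequalities.

Section decay.
Context {R : realType} {n : nat}.
Notation rV := 'rV[R]_n.
Variables (p : R) (u V : rV -> R -> R) (G H : 'I_n -> rV -> R -> R).
Hypothesis p1 : 1 < p.
Hypothesis sol : Sol p u V G H.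
Variables (t1 : R) (c : rV) (A k1 Q : R).
Hypothesis ht1 : - (1 / 4) < t1 < 0.
Hypothesis hA1 : 1 <= A.
Hypothesis k10 : 0 <= k1.
Hypothesis Q0 : 0 <= Q.
Notation kp := (kap p).
(** Room for the constants of [dissip_lower]: 1000 from Young's inequality with [cut1_sq], and 90 (1
    + [kap]) from the radial term. *)
Definition E0 : R := 1100 * (1 + kap p).
Notation phi := (cut (0 : rV) A).
Notation phi1 := (cut1 (0 : rV) A).
Notation zeta := (cut (0 : rV) (2 * A)).
Notation zeta1 := (cut1 (0 : rV) (2 * A)).
Notation zeta' := (cut (0 : rV) (4 * A)).
Notation g := (gam (@bex R n p) t1 c).
(** [k1] measures the smallness of the kernel on the layer where the cutoff varies, and [Q] the
    local size of [u]. The errors will all be multiples of [k1 * Q]. *)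
Hypothesis hg : forall x t, t1 - 1 <= t < t1 -> 9 / 16 * A ^+ 2 <= sq 0 x <= A ^+ 2 ->
  g x t * (E0 * A / (t1 - t)) <= k1.
Hypothesis hX : forall x, sq 0 x <= A ^+ 2 -> sq c x <= 4 * A ^+ 2.
Hypothesis hQF : forall t, -2 < t < 0 -> I (fun x => zeta' x * pwF p (u x t)) <= Q.
Hypothesis hQ2 : forall t, -2 < t < 0 -> I (fun x => zeta' x * u x t ^+ 2) <= Q.

Let A0 : 0 < A. Proof. by have := hA1; lra. Qed.
Let A20 : 0 < 2 * A. Proof. by have := hA1; lra. Qed.
Let A40 : 0 < 4 * A. Proof. by have := hA1; lra. Qed.
Let Asq : 1 <= A ^+ 2. Proof. by rewrite exprn_ege1. Qed.
Let kp0 : 0 < kp. Proof. by rewrite invr_gt0; have := p1; lra. Qed.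
Let t10 : t1 <= 0. Proof. by have := ht1; lra. Qed.
Let E00 : 1100 <= E0. Proof. by rewrite /E0; have := kp0; lra. Qed.

Notation N2' := (N2 G).
Notation om' := (om p phi t1 c).
Notation BG' := (BG p G phi1 t1 c).
Notation XB' := (XB p phi1 t1 c).
Notation P' := (Pf p u V G t1 c).

Let cu t : continuous (u^~ t). Proof. exact: cslice1 (sol_cu _ _ _ _ _ sol). Qed.
Let cV t : continuous (V^~ t). Proof. exact: cslice1 (sol_cV _ _ _ _ _ sol). Qed.
Let cG i t : continuous (G i ^~ t). Proof. exact: cslice1 (sol_cG _ _ _ _ _ sol i). Qed.
Let cN t : continuous (N2'^~ t). Proof. by apply: cS => i; apply: cX. Qed.
Let cF t : continuous (fun x => pwF p (u x t)).
Proof. exact: (ccomp (u^~ t) (pwF p) (cu t) (pwF_cont p p1)). Qed.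
Let cu2 t : continuous (fun x => u x t ^+ 2). Proof. exact: cX. Qed.
Let cP t : continuous (P'^~ t).
Proof.
apply: cB; first apply: cB.
- by apply: cM => //; exact: cC.
- apply: cM; last exact: cC.
  by apply: cS => i; apply: cM => //; apply: cB; [exact: cont_coord|exact: cC].
- by apply: cM => //; exact: cC.
Qed.
Let N0 x t : 0 <= N2' x t. Proof. by apply: sumr_ge0 => i _; exact: sqr_ge0. Qed.
Let g0 x t : 0 <= g x t. Proof. exact: expR_ge0. Qed.
Let Cphi : Cc phi. Proof. exact: Cc_cut. Qed.
Let Czeta : Cc zeta. Proof. exact: Cc_cut. Qed.
Let Czeta' : Cc zeta'. Proof. exact: Cc_cut. Qed.
Let Com t : Cc (om'^~ t). Proof. exact: (Cc_om p phi Cphi t1 c t). Qed.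
Let om0 x t : 0 <= om' x t. Proof. by rewrite mulr_ge0 ?cut_ge0. Qed.
Let cphi1 i : continuous (phi1 i). Proof. exact: cut1_cont. Qed.
Let dphi i x : is_derive x (ev i) phi (phi1 i x). Proof. exact: d_cut. Qed.

Let BGE x t : BG' x t = g x t * \sum_i phi1 i x * G i x t.
Proof. by rewrite /BG mulr_sumr; apply: eq_bigr => i _; ring. Qed.
Let XBE x t : XB' x t = g x t * \sum_i (x ord0 i - c ord0 i) * phi1 i x.
Proof. by rewrite /XB mulr_sumr; apply: eq_bigr => i _; ring. Qed.

(* Outside the annulus, where [phi1] vanishes, there is no error term. *)
Let BG_out x t : ~~ (9 / 16 * A ^+ 2 <= sq 0 x <= A ^+ 2) -> BG' x t = 0 /\ XB' x t = 0.
Proof.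
move=> h; have z i : phi1 i x = 0.
  move: h; rewrite negb_and -!ltNge => /orP[h|h].
    by apply: cut1_in => //; exact: ltW.
  by apply: cut1_out => //; exact: ltW.
rewrite BGE XBE !big1 ?mulr0// => i _; by rewrite z ?mulr0 ?mul0r.
Qed.
Let bsq x t : (\sum_i phi1 i x * G i x t) ^+ 2 <= 2000 * phi x * N2' x t.
Proof.
apply: le_trans (cauchy_schwarz _ _ _) _; apply: ler_wpM2r; first exact: N0.
exact: cut1_sq.
Qed.
Let xbsq x : sq 0 x <= A ^+ 2 -> `|\sum_i (x ord0 i - c ord0 i) * phi1 i x| <= 90 * A.
Proof.
move=> h; rewrite -(@ler_pXn2r _ 2) ?nnegrE// ?mulr_ge0 ?(ltW A0)//.
rewrite real_normK ?num_real//; apply: le_trans (cauchy_schwarz _ _ _) _.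
apply: (@le_trans _ _ (4 * A ^+ 2 * 2000)); last by rewrite exprMn; have := Asq; lra.
apply: ler_pM; rewrite ?sumr_ge0//; try by move=> i _; exact: sqr_ge0.
  exact: hX.
apply: le_trans (cut1_sq _ _ _ hA1) _; have := cut_le1 (0 : rV) A x; lra.
Qed.

Section time.
Variable t : R.
Hypothesis ht : t1 - 1 <= t < t1.
Let tau0 : 0 < t1 - t. Proof. by have := ht; lra. Qed.
Let tau1 : t1 - t <= 1. Proof. by have := ht; lra. Qed.
Let ht2 : -2 < t < 0. Proof. by have := ht; have := ht1; lra. Qed.
Let ht3 : -2 < t < t1. Proof. by have := ht; have := ht1; lra. Qed.
Let Atau : 1 <= A / (t1 - t).
Proof. by rewrite ler_pdivlMr// mul1r; have := tau1; have := hA1; lra. Qed.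
Let itau : 1 <= (t1 - t)^-1. Proof. by rewrite -[leLHS]invr1 lef_pV2 ?posrE. Qed.

Let ann x : 9 / 16 * A ^+ 2 <= sq 0 x <= A ^+ 2 -> [/\ zeta x = 1, g x t * (E0 * (A / (t1 - t))) <= k1
  & sq 0 x <= A ^+ 2].
Proof.
move=> h; split.
- by apply: cut_in => //; rewrite exprMn; have := Asq; lra.
- by rewrite (mulrA E0); exact: hg.
- by case/andP: h.
Qed.

(** Half of the square of [Pf] absorbs the product [Pf] [BG] by Young's inequality, because |grad
    phi|^2 <= 2000 phi. The rest lives where [zeta] is 1 and carries the kernel, so it is charged to
    [k1]. *)
Lemma dissip_lower x : om' x t * P' x t ^+ 2 / (t1 - t) / 2
   - k1 * (zeta x * (N2' x t + pwF p (u x t) + u x t ^+ 2)) <=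
  dissip p u V G phi phi1 t1 c t x.
Proof.
have F0 := pwF_ge0 p (u x t); have u0 := sqr_ge0 (u x t).
have [h|h] := boolP (9 / 16 * A ^+ 2 <= sq 0 x <= A ^+ 2); last first.
  have [b x0] := BG_out x t h; rewrite /dissip b x0 mulr0 mul0r !addr0.
  have : 0 <= om' x t * P' x t ^+ 2 / (t1 - t).
    by rewrite mulr_ge0 ?invr_ge0 ?(ltW tau0)// mulr_ge0// sqr_ge0.
  have : 0 <= k1 * (zeta x * (N2' x t + pwF p (u x t) + u x t ^+ 2)).
    by rewrite mulr_ge0// mulr_ge0 ?cut_ge0// addr_ge0// addr_ge0.
  lra.
have [z hk hs] := ann x h; rewrite z mul1r /dissip.
set T := A / (t1 - t) in hk *.
have h1 : `|P' x t * BG' x t| <= g x t * (phi x * P' x t ^+ 2 / (t1 - t) / 2 + 1000 * (t1 - t) * N2' x t).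
  rewrite BGE mulrCA normrM (ger0_norm (g0 _ _)) ler_wpM2l//.
  apply: abs_le_amgm.
  - by rewrite divr_ge0// mulr_ge0 ?invr_ge0 ?(ltW tau0)// mulr_ge0 ?sqr_ge0 ?cut_ge0.
  - apply: mulr_ge0; last exact: N0.
    by apply: mulr_ge0; [exact: ler0n|exact: ltW].
  - rewrite exprMn (_ : 4 * _ * _ = P' x t ^+ 2 * (2000 * phi x * N2' x t)).
      by rewrite ler_wpM2l ?sqr_ge0.
    by field; rewrite gt_eqF.
set XX := N2' x t / 4 - pwF p (u x t) / (2 * (p + 1)) + kp * u x t ^+ 2 / (2 * (t1 - t)).
have hXX : `|XX| <= (1 + kp) * (t1 - t)^-1 * (N2' x t + pwF p (u x t) + u x t ^+ 2).
  have i1 : 0 <= kp * u x t ^+ 2 / (t1 - t).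
    apply: mulr_ge0; first by apply: mulr_ge0 u0; exact: ltW.
    by rewrite invr_ge0; exact: ltW.
  have i2 : kp * u x t ^+ 2 / (2 * (t1 - t)) = kp * u x t ^+ 2 / (t1 - t) / 2.
    by field; rewrite gt_eqF.
  have i3 : 0 <= pwF p (u x t) / (2 * (p + 1)) <= pwF p (u x t).
    have := p1 => p1'; rewrite divr_ge0//=; last lra.
    by rewrite ler_pdivrMr; [rewrite ler_peMr//; lra|lra].
  have i4 : N2' x t + pwF p (u x t) + u x t ^+ 2 <= (t1 - t)^-1 * (N2' x t + pwF p (u x t) + u x t ^+ 2).
    by rewrite ler_peMl// addr_ge0// addr_ge0.
  have i5 : kp * u x t ^+ 2 / (t1 - t) <= kp * ((t1 - t)^-1 * (N2' x t + pwF p (u x t) + u x t ^+ 2)).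
    rewrite -mulrA ler_wpM2l ?(ltW kp0)// mulrC ler_wpM2l ?invr_ge0 ?(ltW tau0)//.
    by have := N0 x t; lra.
  rewrite (_ : (1 + kp) * _ * _ = (t1 - t)^-1 * (N2' x t + pwF p (u x t) + u x t ^+ 2)
     + kp * ((t1 - t)^-1 * (N2' x t + pwF p (u x t) + u x t ^+ 2))); last by ring.
  rewrite /XX i2; have := N0 x t => n0.
  apply: (@le_trans _ _ (N2' x t + pwF p (u x t) + u x t ^+ 2 + kp * u x t ^+ 2 / (t1 - t))).
    by rewrite ler_norml; lra.
  by lra.
have h2 : `|XB' x t * XX| <= g x t * (90 * A) * ((1 + kp) * (t1 - t)^-1 * (N2' x t + pwF p (u x t) + u x t ^+ 2)).
  rewrite normrM ler_pM// XBE normrM (ger0_norm (g0 _ _)) ler_wpM2l//.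
  exact: xbsq.
set S := N2' x t + pwF p (u x t) + u x t ^+ 2 in h2 *.
have S0 : 0 <= S by rewrite addr_ge0// addr_ge0.
have NS : N2' x t <= S by rewrite /S; lra.
have h3 : g x t * (1000 * (t1 - t) * N2' x t) + g x t * (90 * A) * ((1 + kp) * (t1 - t)^-1 * S) <= k1 * S.
  apply: le_trans (ler_wpM2r S0 hk).
  rewrite -(mulrA (g x t) (90 * A)) -(mulrA (g x t) (E0 * T)) -mulrDr.
  apply: ler_wpM2l; first exact: g0.
  have tN : (t1 - t) * N2' x t <= T * S by apply: ler_pM => //; [exact: ltW|have := Atau; have := tau1; rewrite -/T; lra].
  have TS : 0 <= T * S by rewrite mulr_ge0//; have := Atau; rewrite -/T; lra.
  have kTS : 0 <= kp * (T * S) by rewrite mulr_ge0// ltW.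
  rewrite (_ : 90 * A * ((1 + kp) * (t1 - t)^-1 * S) = 90 * (T * S) + 90 * (kp * (T * S))); last first.
    by rewrite /T; ring.
  rewrite (_ : E0 * T * S = 1100 * (T * S) + 1100 * (kp * (T * S))); last by rewrite /E0; ring.
  by rewrite -(mulrA 1000); lra.
move: h1 h2; rewrite !ler_norml => /andP[h1 _] /andP[h2 _].
rewrite /om -/XX.
move: h1 h2 h3; rewrite (mulrDr (g x t)).
rewrite (_ : phi x * g x t * P' x t ^+ 2 / (t1 - t) = 2 * (g x t * (phi x * P' x t ^+ 2 / (t1 - t) / 2))); last by field; rewrite gt_eqF.
move: (g x t * _) (P' x t * _) (XB' x t * _) (g x t * _) (g x t * (90 * A) * _) (k1 * S).
by move=> a1 a2 a3 a4 a5 a6; lra.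
Qed.

Lemma uBG_bound x : `|u x t * BG' x t| <= k1 * (zeta x * (N2' x t + u x t ^+ 2)).
Proof.
have u0 := sqr_ge0 (u x t).
have [h|h] := boolP (9 / 16 * A ^+ 2 <= sq 0 x <= A ^+ 2); last first.
  have [-> _] := BG_out x t h; rewrite mulr0 normr0.
  by rewrite mulr_ge0// mulr_ge0 ?cut_ge0// addr_ge0.
have [z hk hs] := ann x h; rewrite z mul1r.
have S0 : 0 <= N2' x t + u x t ^+ 2 by rewrite addr_ge0.
rewrite BGE mulrCA normrM (ger0_norm (g0 _ _)).
apply: le_trans (ler_wpM2r S0 hk); rewrite -mulrA ler_wpM2l//.
apply: (@le_trans _ _ (1000 * (N2' x t + u x t ^+ 2))); last first.
  rewrite ler_wpM2r//; have := Atau; have := E00 => a b.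
  by apply: (@le_trans _ _ (E0 * 1)); [lra|apply: ler_wpM2l; lra].
apply: (@le_trans _ _ (1000 * N2' x t + u x t ^+ 2 / 2)); last by lra.
apply: abs_le_amgm; [by apply: mulr_ge0; [exact: ler0n|exact: N0]|by apply: divr_ge0|].
rewrite exprMn (_ : 4 * _ * _ = u x t ^+ 2 * (2000 * N2' x t)); last by field.
rewrite ler_wpM2l//; apply: le_trans (bsq x t) _; rewrite ler_wpM2r//.
by have := cut_le1 (0 : rV) A x; lra.
Qed.

Lemma XBu_bound x : `|XB' x t * u x t ^+ 2| / (2 * (t1 - t)) <= k1 * (zeta x * u x t ^+ 2).
Proof.
have u0 := sqr_ge0 (u x t).
have [h|h] := boolP (9 / 16 * A ^+ 2 <= sq 0 x <= A ^+ 2); last first.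
  have [_ ->] := BG_out x t h; rewrite mul0r normr0 mul0r.
  by rewrite mulr_ge0// mulr_ge0 ?cut_ge0.
have [z hk hs] := ann x h; rewrite z mul1r.
apply: le_trans (ler_wpM2r u0 hk).
rewrite XBE 2!normrM (ger0_norm (g0 _ _)) (ger0_norm u0).
set xb := `|\sum_i _|.
rewrite (_ : g x t * xb * u x t ^+ 2 / (2 * (t1 - t)) = g x t * (xb / (2 * (t1 - t))) * u x t ^+ 2); last by ring.
apply: ler_wpM2r => //; apply: ler_wpM2l; first exact: g0.
apply: (@le_trans _ _ (90 * A / (2 * (t1 - t)))).
  apply: ler_wpM2r; first by rewrite invr_ge0; apply: mulr_ge0 => //; exact: ltW.
  exact: xbsq.
rewrite invfM !mulrA; apply: ler_wpM2r; first by rewrite invr_ge0; exact: ltW.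
by have := E00; have := A0; nra.
Qed.
End time.

Notation En' := (En p u G phi t1 c).
Notation A1' := (A1 p G phi t1 c).
Notation A2' := (A2 p u phi t1 c).
Notation A3' := (A3 p u phi t1 c).
Let Zf (s : R) : R := I (fun x => zeta x * u x s ^+ 2).
Let IN (s : R) : R := I (fun x => zeta x * N2' x s).
Let Dn (s : R) : R := I (fun x => om' x s * P' x s ^+ 2).
(** The corrected energy. The errors contain [k1 * IN], an integral of |grad u|^2; the derivative of
    the added term contains at most [- 4 * k1 * IN], which outweighs it. *)
Let L (s : R) : R := En' s + 4 * k1 * Zf s.
Definition k2 : R := 10000 * (k1 * Q).

Let kQ0 : 0 <= k1 * Q. Proof. exact: mulr_ge0. Qed.
Let k20 : 0 <= k2. Proof. by rewrite /k2; have := kQ0; lra. Qed.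
Let Cz (f : rV -> R) : continuous f -> Cc (fun x => zeta x * f x).
Proof. by move=> cf; exact: CcMl. Qed.
Let Cz' (f : rV -> R) : continuous f -> Cc (fun x => zeta' x * f x).
Proof. by move=> cf; exact: CcMl. Qed.
Let Co t (f : rV -> R) : continuous f -> Cc (fun x => om' x t * f x).
Proof. by move=> cf; exact: CcMl. Qed.
Let zz' x : zeta x <= zeta' x.
Proof.
rewrite (_ : 4 * A = 2 * (2 * A)); last by ring.
exact: cut_le_cut2.
Qed.
Let z0 x : 0 <= zeta x. Proof. exact: cut_ge0. Qed.
Let z'0 x : 0 <= zeta' x. Proof. exact: cut_ge0. Qed.

Let IzF t : -2 < t < 0 -> I (fun x => zeta x * pwF p (u x t)) <= Q.
Proof.
move=> h; apply: le_trans (hQF t h); apply: I_le.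
- exact: Cz.
- exact: Cz'.
- by move=> x; apply: ler_wpM2r => //; exact: pwF_ge0.
Qed.
Let Izu t : -2 < t < 0 -> Zf t <= Q.
Proof.
move=> h; apply: le_trans (hQ2 t h); apply: I_le.
- exact: Cz.
- exact: Cz'.
- by move=> x; apply: ler_wpM2r => //; exact: sqr_ge0.
Qed.
Let Izu0 t : 0 <= Zf t.
Proof. by apply: I_ge0 => x; apply: mulr_ge0 => //; exact: sqr_ge0. Qed.
Let IN0 t : 0 <= IN t.
Proof. by apply: I_ge0 => x; apply: mulr_ge0 => //; exact: N0. Qed.
Let A10 t : 0 <= A1' t.
Proof. by apply: I_ge0 => x; apply: mulr_ge0; [exact: om0|exact: N0]. Qed.
Let A20' t : 0 <= A2' t.
Proof. by apply: I_ge0 => x; apply: mulr_ge0; [exact: om0|exact: pwF_ge0]. Qed.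
Let A30 t : 0 <= A3' t.
Proof. by apply: I_ge0 => x; apply: mulr_ge0; [exact: om0|exact: sqr_ge0]. Qed.
Let Dn0 t : 0 <= Dn t.
Proof. by apply: I_ge0 => x; apply: mulr_ge0; [exact: om0|exact: sqr_ge0]. Qed.

Let INE t : I (fun x => zeta x * N2' x t) = IN t. Proof. by []. Qed.
Let ZfE t : I (fun x => zeta x * u x t ^+ 2) = Zf t. Proof. by []. Qed.

(** Of the two units of |grad u|^2 in the balance, one absorbs the term with the gradient of [zeta].
    The remainder, 2000 u^2, lies where the wider cutoff [zeta'] is 1. *)
Lemma Zder (t : R) : -2 < t < 0 -> exists2 d, is_derive t 1 Zf d & d <= - IN t + 2002 * Q.
Proof.
move=> h.
have cz1 i : continuous (zeta1 i) by exact: cut1_cont.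
have Cz1 i : Cc (zeta1 i) by exact: (CcV _ _ _ Czeta (cz1 i) (d_cut 0 (2 * A) i)).
eexists; first exact: (caccioppoli_deriv p u V G H p1 sol zeta zeta1 Czeta cz1 (d_cut 0 (2 * A)) t h).
have E : - 2 * I (fun x => u x t * \sum_i zeta1 i x * G i x t) <=
   I (fun x => zeta x * N2' x t + 2000 * (zeta' x * u x t ^+ 2)).
  rewrite -I_Z; last by apply: CcMr => //; apply: CcS => i; exact: CcMl.
  apply: I_le.
  - by apply: CcZ; apply: CcMr => //; apply: CcS => i; exact: CcMl.
  - by apply: CcD; [exact: Cz|apply: CcZ; exact: Cz'].
  - move=> x; set b := \sum_i _.
    have bs : b ^+ 2 <= 2000 * zeta x * N2' x t.
      apply: le_trans (cauchy_schwarz _ _ _) _; apply: ler_wpM2r; first exact: N0.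
      by apply: cut1_sq; have := hA1; lra.
    have [hs|hs] := leP (sq 0 x) (9 / 16 * (4 * A) ^+ 2).
      rewrite (cut_in 0 (4 * A))// mul1r.
      rewrite mulNr; apply: le_trans (ler_norm _) _; rewrite normrN.
      rewrite normrM ger0_norm; last by lra.
      have : `|u x t * b| <= zeta x * N2' x t / 2 + 1000 * u x t ^+ 2.
        apply: abs_le_amgm.
        + by apply: divr_ge0; [apply: mulr_ge0; [exact: z0|exact: N0]|lra].
        + by apply: mulr_ge0; [lra|exact: sqr_ge0].
        + rewrite exprMn (_ : 4 * _ * _ = u x t ^+ 2 * (2000 * zeta x * N2' x t)); last by field.
          by apply: ler_wpM2l bs; exact: sqr_ge0.
      by lra.
    have -> : b = 0.
      apply: big1 => i _; rewrite cut1_out ?mul0r//; apply: ltW; apply: le_lt_trans hs.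
      by rewrite !exprMn; have := Asq; lra.
    rewrite mulr0 mulr0; apply: addr_ge0; first by apply: mulr_ge0; [exact: z0|exact: N0].
    by apply: mulr_ge0; [lra|apply: mulr_ge0; [exact: z'0|exact: sqr_ge0]].
rewrite I_D in E; [|exact: Cz|apply: CcZ; exact: Cz'].
rewrite I_Z in E; last exact: Cz'.
have := hQ2 t h; have := IzF t h => q1 q2.
have E1 : I (fun x => zeta x * \sum_i G i x t ^+ 2) = IN t by [].
have E2 : I (fun x => zeta x * N2' x t) = IN t by [].
rewrite E1; rewrite E2 in E.
by lra.
Qed.

Section time2.
Variable t : R.
Hypothesis ht : t1 - 1 <= t < t1.
Let tau0 : 0 < t1 - t. Proof. by have := ht; lra. Qed.
Let tau1 : t1 - t <= 1. Proof. by have := ht; lra. Qed.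
Let ht2 : -2 < t < 0. Proof. by have := ht; have := ht1; lra. Qed.
Let ht3 : -2 < t < t1. Proof. by have := ht; have := ht1; lra. Qed.

Let CBG : Cc (fun x => u x t * BG' x t).
Proof. by apply: CcMr => //; exact: (Cc_BG p u V G H sol phi phi1 Cphi cphi1 dphi t1 c t). Qed.
Let CXB : Cc (fun x => XB' x t * u x t ^+ 2).
Proof. by apply: CcMl => //; exact: (Cc_XB p phi phi1 Cphi cphi1 dphi t1 c t). Qed.

Lemma energy_deriv_le : exists2 d, is_derive t 1 L d &
  d <= - (Dn t / (t1 - t) / 2) - k1 * IN t + k2.
Proof.
have [d dz hd] := Zder t ht2.
have dE1 := deriv_energy p u V G H p1 sol phi phi1 Cphi cphi1 dphi t1 c t10 t ht3.
eexists; first exact: (dD dE1 (dZ (4 * k1) dz)).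
have C1 := Cc_dissip p u V G H p1 sol phi phi1 Cphi cphi1 dphi t1 c t.
have CP : Cc (fun x => om' x t * P' x t ^+ 2) by apply: Co; exact: cX.
have Ctot : Cc (fun x => zeta x * (N2' x t + pwF p (u x t) + u x t ^+ 2)).
  by apply: Cz => //; apply: cD => //; exact: cD.
have E : Dn t / (t1 - t) / 2 - k1 * I (fun x => zeta x * (N2' x t + pwF p (u x t) + u x t ^+ 2))
    <= I (dissip p u V G phi phi1 t1 c t).
  rewrite -(I_Z k1)// -mulrA mulrC -I_Z// -I_B; [|exact: CcZ|exact: CcZ].
  apply: I_le => //; first by apply: CcB; exact: CcZ.
  move=> x; apply: le_trans (dissip_lower t ht x).
  by rewrite lerD2r mulrC mulrA.
have E2 : I (fun x => zeta x * (N2' x t + pwF p (u x t) + u x t ^+ 2)) <= IN t + 2 * Q.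
  rewrite (I_ext _ (fun x => zeta x * N2' x t + zeta x * pwF p (u x t) + zeta x * u x t ^+ 2)); last first.
    by move=> x; ring.
  rewrite I_D; [|apply: CcD; exact: Cz|exact: Cz].
  rewrite I_D; [|exact: Cz|exact: Cz].
  by rewrite INE ZfE; have := IzF t ht2; have := Izu t ht2; lra.
have := ler_wpM2l k10 E2; have := ler_wpM2l k10 hd; rewrite /k2.
have := IN0 t; have := mulr_ge0 k10 (IN0 t); have := kQ0.
rewrite [k1 * (- _ + _)]mulrDr [k1 * (_ + 2 * Q)]mulrDr mulrN (mulrCA k1 2002) (mulrCA k1 2).
rewrite -(mulrA 4 k1 d).
by move: E; lra.
Qed.

Lemma A2_nonneg_En : - ((t1 - t) * A2' t) <= En' t <= (t1 - t) / 2 * A1' t + kp * A3' t.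
Proof.
rewrite /En; have h1 := A10 t; have h2 := A20' t; have h3 := A30 t.
have i1 : 0 <= (t1 - t) / 2 * A1' t.
  by apply: mulr_ge0 => //; apply: divr_ge0; [exact: ltW|lra].
have i2 : 0 <= kp * A3' t by apply: mulr_ge0 => //; exact: ltW.
have i3 : 0 <= (t1 - t) * A2' t by apply: mulr_ge0 => //; exact: ltW.
have i4 : 0 <= (t1 - t) / (p + 1) * A2' t <= (t1 - t) * A2' t.
  rewrite mulrAC; have := p1 => p1'; apply/andP; split; first by apply: divr_ge0; lra.
  by rewrite ler_pdivrMr; [rewrite ler_peMr//; lra|lra].
by apply/andP; split; lra.
Qed.

(** Splits the weight into the power of t1 - t that makes the energy scale invariant, at most 1
    here, and a heat kernel, whose mass is bounded by [CG]. *)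
Let e4 : R := expR (4 * kp * ln (t1 - t)).
Let gs (x : rV) : R := expR (- (n%:R / 2) * ln (t1 - t) - sq c x * (4 * (t1 - t))^-1).
Let omE x : om' x t = e4 * (phi x * gs x).
Proof.
rewrite /om /gam /e4 /gs mulrCA -expRD; congr (_ * expR _).
by rewrite /bex; ring.
Qed.
Let lnt : ln (t1 - t) <= 0.
Proof. by rewrite ln_le0. Qed.
Let e41 : e4 <= 1.
Proof.
rewrite -expR0 ler_expR; apply: mulr_ge0_le0 lnt.
by apply: mulr_ge0; [lra|exact: ltW].
Qed.
Let gs0 x : 0 <= gs x. Proof. exact: expR_ge0. Qed.
Let Cgs : Cc (fun x => phi x * gs x).
Proof.
apply: CcMl => //.
apply: (ccomp (fun x : rV => - (n%:R / 2) * ln (t1 - t) - sq c x * (4 * (t1 - t))^-1) expR); last exact: continuous_expR.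
by apply: cB; [exact: cC|apply: cM; [exact: cont_sq|exact: cC]].
Qed.

Variable CG : R.
Hypothesis CG0 : 0 < CG.
Hypothesis hCG : I (fun x => phi x * expR (- (n%:R / 2) * ln (t1 - t) - sq c x * (4 * (t1 - t))^-1)) <= CG.

Let om_gs x : om' x t <= phi x * gs x.
Proof.
rewrite omE ler_piMl//; apply: mulr_ge0; [exact: cut_ge0|exact: gs0].
Qed.

(** A qualitative bound: [Cu] depends on the solution and serves only to let t tend to t1. *)
Lemma A2_bound (Cu : R) : 0 <= Cu -> (forall x, `|x| <= A -> pwF p (u x t) <= Cu) -> A2' t <= Cu * CG.
Proof.
move=> Cu0 hCu; apply: le_trans (ler_wpM2l Cu0 hCG); rewrite -I_Z//.
apply: I_le; [exact: Co|exact: CcZ|move=> x].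
have [h|h] := leP `|x| A.
  rewrite mulrC; apply: ler_pM; [exact: pwF_ge0|exact: om0|exact: hCu|exact: om_gs].
have p0 : phi x = 0 by apply: (cut_supp 0 A A0); rewrite normr0 add0r.
by rewrite /om p0 !mul0r mulr0.
Qed.

Lemma A3_lambda (l : R) : 0 < l -> A3' t <= l ^+ 2 * CG + l `^ (1 - p) * A2' t.
Proof.
move=> l0; have lp := powR_ge0 l (1 - p).
apply: (@le_trans _ _ (I (fun x => l ^+ 2 * (phi x * gs x) + l `^ (1 - p) * (om' x t * pwF p (u x t))))).
  apply: I_le; [exact: Co|apply: CcD; apply: CcZ => //; exact: Co|move=> x].
  apply: (@le_trans _ _ (om' x t * (l ^+ 2 + l `^ (1 - p) * pwF p (u x t)))).
    by apply: ler_wpM2l; [exact: om0|exact: sq_le_lambda].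
  rewrite mulrDr mulrC lerD//; last by rewrite mulrCA.
  by apply: ler_wpM2l; [exact: sqr_ge0|exact: om_gs].
rewrite I_D; [|exact: CcZ|apply: CcZ; exact: Co].
rewrite !I_Z//; last exact: Co.
by rewrite lerD2r; apply: ler_wpM2l => //; exact: sqr_ge0.
Qed.

Lemma A3_bound : A3' t <= CG + (t1 - t) * A2' t.
Proof.
apply: (@le_trans _ _ (I (fun x => phi x * gs x + (t1 - t) * (om' x t * pwF p (u x t))))); last first.
  rewrite I_D//; last by apply: CcZ; exact: Co.
  by rewrite I_Z; [rewrite lerD2r|exact: Co].
apply: I_le; [exact: Co|apply: CcD => //; apply: CcZ; exact: Co|move=> x].
(* The similarity variable (t1 - t)^(1/(p-1)) |u|, to which the interpolation is applied at level
   1. *)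
pose v := expR (2 * kp * ln (t1 - t)) * `|u x t|.
have := sq_le_lambda p v 1 p1 ltr01; rewrite expr1n powR1 mul1r => hv.
have v0 : 0 <= v by rewrite mulr_ge0 ?expR_ge0.
have v2 : v ^+ 2 = e4 * u x t ^+ 2.
  rewrite exprMn real_normK ?num_real// expr2 -expRD; congr (expR _ * _); ring.
have vF : pwF p v = (t1 - t) * e4 * pwF p (u x t).
  rewrite /pwF (ger0_norm v0) powRM ?expR_ge0// -expRM; congr (_ * _).
  rewrite -[X in X * e4]lnK ?posrE// -expRD; congr expR.
  rewrite /kap; field; have := p1; lra.
have pg0 : 0 <= phi x * gs x by apply: mulr_ge0; [exact: cut_ge0|exact: gs0].
have := ler_wpM2l pg0 hv; rewrite v2 vF omE mulrDr mulr1.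
rewrite (_ : phi x * gs x * (e4 * u x t ^+ 2) = e4 * (phi x * gs x) * u x t ^+ 2); last by ring.
rewrite (_ : phi x * gs x * ((t1 - t) * e4 * pwF p (u x t)) =
  (t1 - t) * (e4 * (phi x * gs x) * pwF p (u x t))); last by ring.
by [].
Qed.

Lemma IuBG : `|I (fun x => u x t * BG' x t)| <= k1 * IN t + k1 * Q.
Proof.
have h : I (fun x => k1 * (zeta x * (N2' x t + u x t ^+ 2))) <= k1 * IN t + k1 * Q.
  rewrite I_Z; last by apply: Cz => //; exact: cD.
  rewrite -mulrDr; apply: ler_wpM2l => //.
  rewrite (I_ext _ (fun x => zeta x * N2' x t + zeta x * u x t ^+ 2)); last by move=> x; ring.
  rewrite I_D; [|exact: Cz|exact: Cz].
  by rewrite INE ZfE lerD2l; exact: Izu.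
have C1 : Cc (fun x => k1 * (zeta x * (N2' x t + u x t ^+ 2))).
  by apply: CcZ; apply: Cz => //; exact: cD.
rewrite ler_norml; apply/andP; split.
  rewrite lerNl -I_N//; apply: le_trans h; apply: I_le => //; first exact: CcN.
  by move=> x; have := uBG_bound t ht x; rewrite ler_norml; lra.
apply: le_trans h; apply: I_le => // x.
by have := uBG_bound t ht x; rewrite ler_norml; lra.
Qed.

Lemma IXBu : - (1 / (2 * (t1 - t)) * I (fun x => XB' x t * u x t ^+ 2)) <= k1 * Q.
Proof.
rewrite -mulrN -I_N// -I_Z; last exact: CcN.
apply: (@le_trans _ _ (I (fun x => k1 * (zeta x * u x t ^+ 2)))).
  apply: I_le; [by apply: CcZ; exact: CcN|by apply: CcZ; exact: Cz|move=> x].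
  apply: le_trans (XBu_bound t ht x); rewrite div1r mulrC.
  apply: ler_wpM2r; first by rewrite invr_ge0; apply: mulr_ge0; [lra|exact: ltW].
  by rewrite -normrN; exact: ler_norm.
by rewrite I_Z; [apply: ler_wpM2l => //; exact: Izu|exact: Cz].
Qed.

(** As for the energy, adding [4 * k1 * Zf] compensates the gradient integral in the cutoff
    errors. *)
Lemma A3_der : exists2 d, is_derive t 1 (fun s => A3' s + 4 * k1 * Zf s) d &
  d <= - (2 * A1' t + 4 * kp * A3' t) + 2 * A2' t + k2.
Proof.
have [d dz hd] := Zder t ht2.
have dE1 := deriv_A3 p u V G H p1 sol phi phi1 Cphi cphi1 dphi t1 c t10 t ht3.
eexists; first exact: (dD dE1 (dZ (4 * k1) dz)).
have h1 := IuBG; have h2 := IXBu.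
have h3 : 4 * kp * A3' t <= 4 * kp / (t1 - t) * A3' t.
  apply: ler_wpM2r => //; rewrite ler_pdivlMr// ler_piMr//.
  by apply: mulr_ge0; [lra|exact: ltW].
have := ler_wpM2l k10 hd; have := mulr_ge0 k10 (IN0 t); have := kQ0.
rewrite [k1 * (- _ + _)]mulrDr mulrN (mulrCA k1 2002) -(mulrA 4 k1 d) /k2.
move: h1; rewrite ler_norml => /andP[h1 _].
by move: h1 h2 h3; lra.
Qed.
End time2.

Lemma L_mono (s r : R) : t1 - 1 <= s -> s <= r -> r < t1 -> L r <= L s + k2.
Proof.
move=> s1 sr rt; have [sr'|rs] := ltP s r; last first.
  have -> : s = r by apply/eqP; rewrite eq_le sr.
  by have := k20; lra.
have [|z hz hd] := @MVT_ab _ L (fun t => - (Dn t / (t1 - t) / 2) - k1 * IN t + k2) s r sr'.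
  by move=> x hx; apply: energy_deriv_le; lra.
have D0 : 0 <= Dn z / (t1 - z) / 2.
  by apply: divr_ge0; [apply: divr_ge0; [exact: Dn0|lra]|lra].
have N0' := mulr_ge0 k10 (IN0 z).
have h : (- (Dn z / (t1 - z) / 2) - k1 * IN z + k2) * (r - s) <= k2 * (r - s).
  by apply: ler_wpM2r; lra.
have h2 : k2 * (r - s) <= k2 by apply: ler_piMr; [exact: k20|lra].
by lra.
Qed.

Variable CG : R.
Hypothesis CG0 : 0 < CG.
Hypothesis hCG : forall tau, 0 < tau ->
  I (fun x => phi x * expR (- (n%:R / 2) * ln tau - sq c x * (4 * tau)^-1)) <= CG.

(** The only negative part of the energy is a multiple of (t1 - t) [A2'], which tends to 0 as t
    tends to t1 because [u] is bounded there. Almost monotonicity carries the lower bound back to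
    [s]. *)
Lemma energy_ge (s : R) : t1 - 1 <= s < t1 -> - k2 <= L s.
Proof.
move=> hs.
have [Cu Cu0 hCu] := cont_bounded_cyl (fun z : rV * R => pwF p (u z.1 z.2)) A (t1 - 1) t1
  (ccomp _ _ (sol_cu _ _ _ _ _ sol) (pwF_cont p p1)).
apply/ler_addgt0Pr => e e0.
(* Close enough to t1 for (t1 - r) [Cu] [CG] to be at most [e]; the added 1 prevents division by
   zero. *)
pose r := Num.max s (t1 - e / (Cu * CG + 1)).
have CC : 0 <= Cu * CG by apply: mulr_ge0 => //; exact: ltW.
have e1 : 0 < e / (Cu * CG + 1) by apply: divr_gt0 => //; lra.
have rs : s <= r by rewrite le_max lexx.
have rt : r < t1 by rewrite gt_max; case/andP: hs => _ ->; rewrite /= ltrBlDr ltrDl.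
have rr : t1 - 1 <= r < t1 by rewrite rt andbT; lra.
have re : (t1 - r) * (Cu * CG) <= e.
  have h : t1 - r <= e / (Cu * CG + 1).
    have : t1 - e / (Cu * CG + 1) <= r by rewrite le_max lexx orbT.
    by lra.
  apply: (@le_trans _ _ (e / (Cu * CG + 1) * (Cu * CG + 1))).
    by apply: ler_pM => //; lra.
  by rewrite divfK// gt_eqF//; lra.
have hm := L_mono s r (proj1 (andP hs)) rs rt.
have a2 : A2' r <= Cu * CG.
  apply: (A2_bound r rr CG) => //; first by apply: hCG; lra.
  move=> x xA; have := hCu x r xA; rewrite ger0_norm; last exact: pwF_ge0.
  by apply; lra.
have a3 : (t1 - r) * A2' r <= (t1 - r) * (Cu * CG) by apply: ler_wpM2l => //; lra.
have [b1 _] := andP (A2_nonneg_En r rr).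
have zr : 0 <= 4 * k1 * Zf r by apply: mulr_ge0; [apply: mulr_ge0; [lra|exact: k10]|exact: Izu0].
have LE : L r = En' r + 4 * k1 * Zf r by [].
by rewrite LE in hm; lra.
Qed.

(** Since [L] is almost decreasing and almost nonnegative, its drop over (t1 - h, t1 - h/4) is at
    most [L s + 3 * k2]. The mean value theorem then gives a time at which the dissipation is of
    that size divided by h. *)
Lemma good_time (s h : R) : t1 - 1 <= s -> 0 < h <= 1 -> s <= t1 - h ->
  exists xi, [/\ t1 - h < xi < t1 - h / 4, Dn xi <= 3 * (L s + 3 * k2),
    (t1 - xi) * (k1 * IN xi) <= 3 * (L s + 3 * k2), En' xi <= L s + 3 * k2 & k2 <= L s + 3 * k2].
Proof.
move=> s1 hh sh.
have hab : t1 - h < t1 - h / 4 by lra.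
have [|xi hxi hd] := @MVT_ab _ L (fun t => - (Dn t / (t1 - t) / 2) - k1 * IN t + k2) _ _ hab.
  by move=> x hx; apply: energy_deriv_le; lra.
exists xi.
have hs : t1 - 1 <= s < t1 by lra.
have l1 := energy_ge s hs.
have l2 : L (t1 - h) <= L s + k2 by apply: L_mono; lra.
have l3 : - k2 <= L (t1 - h / 4) by apply: energy_ge; lra.
have l4 : L xi <= L s + k2 by apply: L_mono; lra.
have kk := k20.
set X := Dn xi / (t1 - xi) / 2 + k1 * IN xi.
have N0' := mulr_ge0 k10 (IN0 xi).
have D0 : 0 <= Dn xi / (t1 - xi) / 2.
  by apply: divr_ge0; [apply: divr_ge0; [exact: Dn0|lra]|lra].
have hXh : X * (3 / 4 * h) <= L s + 3 * k2.
  have e1 : (- (Dn xi / (t1 - xi) / 2) - k1 * IN xi + k2) * (t1 - h / 4 - (t1 - h)) =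
     k2 * (3 / 4 * h) - X * (3 / 4 * h).
    by rewrite /X; field; rewrite gt_eqF//; lra.
  rewrite e1 in hd.
  have e2 : k2 * (3 / 4 * h) <= k2 by apply: ler_piMr; [exact: k20|lra].
  by lra.
have X0 : 0 <= X by rewrite /X; lra.
have hX2 : X * (t1 - xi) * (3 / 4) <= L s + 3 * k2.
  by apply: le_trans hXh; rewrite -mulrA; apply: ler_wpM2l; [exact: X0|lra].
split.
- exact: hxi.
- have e3 : Dn xi = Dn xi / (t1 - xi) * (t1 - xi) by rewrite divfK// gt_eqF//; lra.
  have e4 : Dn xi / (t1 - xi) / 2 * (t1 - xi) <= X * (t1 - xi).
    by apply: ler_wpM2r; [lra|rewrite /X; lra].
  by rewrite e3; lra.
- have e4 : k1 * IN xi * (t1 - xi) <= X * (t1 - xi).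
    by apply: ler_wpM2r; [lra|rewrite /X; lra].
  by rewrite mulrC; lra.
- have zr : 0 <= 4 * k1 * Zf xi by apply: mulr_ge0; [apply: mulr_ge0; [lra|exact: k10]|exact: Izu0].
  have LE : L xi = En' xi + 4 * k1 * Zf xi by [].
  by rewrite LE in l4; lra.
- by lra.
Qed.

Definition cp : R := (p - 1) / (p + 1).
Let cp0 : 0 < cp <= 1.
Proof.
have p1' := p1; rewrite /cp divr_gt0 ?ler_pdivrMr//=; lra.
Qed.

(** In [A2_identity] the product of u and [Pf] is split by Young's inequality with parameter m. The
    part in u^2 costs m [CG] and m/2 times the left-hand quantity, absorbed because m <= [cp]; the
    part in [Pf]^2 costs [B] / m. *)
Lemma A2_small (s h B m : R) : t1 - 1 <= s -> 0 < h <= 1 -> s <= t1 - h -> L s + 3 * k2 <= B ->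
  0 < m <= cp -> exists2 xi, t1 - h < xi < t1 - h / 4 &
  (t1 - xi) * A2' xi <= 2 / cp * (6 * B + m * CG + 2 * B / m).
Proof.
move=> s1 hh sh hB hm; have [xi [hx h1 h2 h3 h4]] := good_time s h s1 hh sh.
exists xi => //.
have hxi : t1 - 1 <= xi < t1 by lra.
have tx : 0 < t1 - xi <= 1 by lra.
have k2' := k20; have m0 : 0 < m by lra.
have cpp := cp0.
set Y := (t1 - xi) * A2' xi.
have Y0 : 0 <= Y by apply: mulr_ge0; [lra|exact: A20'].
have CPo : Cc (fun x => om' x xi * P' x xi ^+ 2) by apply: Co; exact: cX.
have i1 : I (fun x => om' x xi * u x xi * P' x xi) <= m / 2 * A3' xi + 1 / (2 * m) * Dn xi.
  rewrite -I_Z; last exact: Co.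
  rewrite -I_Z// -I_D; [|apply: CcZ; exact: Co|exact: CcZ].
  apply: I_le.
  - by apply: CcMl => //; exact: Co.
  - by apply: CcD; [apply: CcZ; exact: Co|exact: CcZ].
  move=> x.
  rewrite -subr_ge0 (_ : _ - _ = om' x xi * ((m * u x xi - P' x xi) ^+ 2 / (2 * m))).
    apply: mulr_ge0; first exact: om0.
    by apply: divr_ge0; [exact: sqr_ge0|lra].
  by field; rewrite gt_eqF.
have i2 : (t1 - xi) * I (fun x => u x xi * BG' x xi) <= 4 * B.
  have := IuBG xi hxi; rewrite ler_norml => /andP[_ b].
  have : (t1 - xi) * I (fun x => u x xi * BG' x xi) <= (t1 - xi) * (k1 * IN xi + k1 * Q).
    by apply: ler_wpM2l => //; lra.
  have kQ : (t1 - xi) * (k1 * Q) <= k1 * Q by apply: ler_piMl; [exact: kQ0|lra].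
  have : k1 * Q <= k2 by rewrite /k2; have := kQ0; lra.
  by rewrite mulrDr; lra.
have i3 : m / 2 * A3' xi <= m / 2 * CG + cp / 2 * Y.
  have a3 : A3' xi <= CG + Y by apply: (A3_bound xi hxi); apply: hCG; lra.
  have : m / 2 * A3' xi <= m / 2 * (CG + Y) by apply: ler_wpM2l => //; lra.
  have : m / 2 * Y <= cp / 2 * Y by apply: ler_wpM2r => //; lra.
  by rewrite mulrDr; lra.
have i4 : 1 / (2 * m) * Dn xi <= 3 * B / (2 * m).
  have -> : 1 / (2 * m) * Dn xi = Dn xi / (2 * m) by ring.
  by apply: ler_wpM2r; [rewrite invr_ge0; lra|lra].
have := A2_identity p u V G H p1 sol phi phi1 Cphi cphi1 dphi t1 c xi.
have ht' : -2 < xi < t1 by have := ht1; lra.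
move=> /(_ ht'); rewrite -/Y -/cp => Yid.
have cY : cp * Y <= 2 * (6 * B + m * CG + 2 * B / m) / 2 + cp / 2 * Y.
  rewrite Yid (_ : 2 * (6 * B + m * CG + 2 * B / m) / 2 = 6 * B + m * CG + 2 * B / m); last by field; rewrite gt_eqF.
  have -> : 2 * B / m = 2 * (3 * B / (2 * m)) - B / m by field; rewrite gt_eqF.
  have B0 : 0 <= B by lra.
  have mC : 0 <= m * CG by apply: mulr_ge0; [lra|exact: ltW].
  have Bm : B / m = 2 / 3 * (3 * B / (2 * m)) by field; rewrite gt_eqF.
  have Bm0 : 0 <= 3 * B / (2 * m) by apply: divr_ge0; lra.
  by lra.
rewrite mulrAC ler_pdivlMr; last by case/andP: cpp.
by lra.
Qed.

(** The smallness in space-time is given through an antiderivative [S] with values in [0, e], so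
    that one-variable mean value arguments suffice. They yield a time at which [A3'] is small, then
    a later one at which [A1'] is small as well. *)
Lemma initial_energy (S : R -> R) (e l : R) : 0 <= e -> 0 < l ->
  (forall t : R, -1 < t < - (1 / 2) -> is_derive t 1 S (I (fun x => phi x * pwF p (u x t)))) ->
  (forall t, -1 < t < - (1 / 2) -> 0 <= S t <= e) ->
  exists2 s, - (15 / 16) < s < - (9 / 16) &
  L s + 3 * k2 <= l ^+ 2 * CG + 8 * expR (`|@bex R n p| * ln 4) * (l `^ (1 - p) * e)
     + 2 * expR (`|@bex R n p| * ln 4) * e + 6 * k2.
Proof.
(* [Cg] is 4^|bex|. It bounds the weight at times in [-1, -1/2], where t1 - t lies between 1/4 and
   1. *)
move=> e0 l0 dS hS; set Cg := expR _.
have Cg0 : 0 <= Cg by exact: expR_ge0.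
pose Nt t := I (fun x => phi x * pwF p (u x t)).
have ln4 : 0 < ln (4 : R) by apply: ln_gt0; lra.
have hA2 t : - 1 <= t <= - (1 / 2) -> A2' t <= Cg * Nt t.
  move=> ht; have CF : Cc (fun x => phi x * pwF p (u x t)) by exact: CcMl.
  rewrite -I_Z//; apply: I_le; [exact: Co|exact: CcZ|move=> x].
  rewrite mulrA; apply: ler_wpM2r; first exact: pwF_ge0.
  rewrite /om (mulrC (phi x)); apply: ler_wpM2r; first exact: cut_ge0.
  rewrite ler_expR; have h1 := ht1.
  have hq : 0 <= sq c x * (4 * (t1 - t))^-1.
    by apply: mulr_ge0; [exact: sq_ge0|rewrite invr_ge0; lra].
  have hl : `|ln (t1 - t)| <= ln 4.
    rewrite ler_norml; apply/andP; split.
      rewrite -lnV ?posrE//.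
      by rewrite ler_ln ?posrE; lra.
    by rewrite ler_ln ?posrE; lra.
  have : @bex R n p * ln (t1 - t) <= `|@bex R n p| * ln 4.
    by apply: le_trans (ler_norm _) _; rewrite normrM; apply: ler_wpM2l.
  by lra.
(* The interval has length 1/8, whence the factor 8. *)
have [ta hta Ea] : exists2 ta, - (15 / 16) < ta < - (13 / 16) & Nt ta <= 8 * e.
  have [||ta h1 h2] := @MVT_oo _ S Nt (- (15 / 16)) (- (13 / 16)).
  - by lra.
  - by move=> x hx; apply: dS; lra.
  - exists ta => //.
    have := hS (- (13 / 16)); have := hS (- (15 / 16)) => a b.
    have {}a := a ltac:(lra); have {}b := b ltac:(lra).
    by lra.
have lp := powR_ge0 l (1 - p).
have kk := k20; have kk2 := kQ0; have h1' := ht1.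
have hM : A3' ta <= l ^+ 2 * CG + 8 * Cg * (l `^ (1 - p) * e).
  have hta' : t1 - 1 <= ta < t1 by lra.
  have hG : I (fun x => phi x * expR (- (n%:R / 2) * ln (t1 - ta) - sq c x * (4 * (t1 - ta))^-1)) <= CG.
    by apply: hCG; lra.
  apply: le_trans (A3_lambda ta hta' CG hG l l0) _; rewrite lerD2l.
  have h2 : A2' ta <= Cg * (8 * e).
    by apply: le_trans (hA2 ta _) _; [lra|apply: ler_wpM2l].
  have := ler_wpM2l lp h2; lra.
have tab : ta < - (9 / 16) by lra.
have Z1 : 4 * k1 * Zf ta <= k2.
  have := ler_wpM2l k10 (Izu ta _) => /(_ ltac:(lra)); rewrite -mulrA /k2; lra.
(* Subtracting [2 * Cg * S] offsets the growth term [2 * A2'] in the balance of [A3']. What is left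
   bounds [A1'] and [A3'] together at one time. *)
have [|xi hxi hd] := @MVT_ab _ (fun s => A3' s + 4 * k1 * Zf s - 2 * Cg * S s)
   (fun s => - (2 * A1' s + 4 * kp * A3' s) + k2) _ _ tab.
  move=> x hx; have hx' : t1 - 1 <= x < t1 by lra.
  have hxs : -1 < x < - (1 / 2) by lra.
  have [d d1 d2] := A3_der x hx'.
  eexists; first exact: (dB d1 (dZ (2 * Cg) (dS x hxs))).
  have := hA2 x; rewrite /Nt => /(_ ltac:(lra)); lra.
exists xi; first by lra.
have hxi' : t1 - 1 <= xi < t1 by lra.
set X := 2 * A1' xi + 4 * kp * A3' xi in hd.
have X0 : 0 <= X.
  have := A10 xi; have : 0 <= kp * A3' xi by apply: mulr_ge0; [exact: ltW|exact: A30].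
  by rewrite /X; lra.
have Sb := hS (- (9 / 16)) ltac:(lra); have Sa := hS ta ltac:(lra).
have SbC : Cg * S (- (9 / 16)) <= Cg * e by apply: ler_wpM2l => //; lra.
have SaC : 0 <= Cg * S ta by apply: mulr_ge0; lra.
have A3b := A30 (- (9 / 16)).
have Zb : 0 <= 4 * k1 * Zf (- (9 / 16)).
  by apply: mulr_ge0; [apply: mulr_ge0; [lra|exact: k10]|exact: Izu0].
have e1 : (- X + k2) * (- (9 / 16) - ta) = - (X * (- (9 / 16) - ta)) + k2 * (- (9 / 16) - ta) by ring.
have e2 : k2 * (- (9 / 16) - ta) <= k2 by apply: ler_piMr => //; lra.
have e3 : X / 4 <= X * (- (9 / 16) - ta) by apply: ler_wpM2l => //; lra.
rewrite e1 in hd.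
have [_ Eb] := andP (A2_nonneg_En xi hxi').
have Eb2 : En' xi <= X / 4.
  apply: le_trans Eb _; rewrite /X.
  have : (t1 - xi) / 2 * A1' xi <= 1 / 2 * A1' xi by apply: ler_wpM2r; [exact: A10|lra].
  by lra.
have Zx : 4 * k1 * Zf xi <= k2.
  have := ler_wpM2l k10 (Izu xi _) => /(_ ltac:(lra)); rewrite -mulrA /k2; lra.
have LE : L xi = En' xi + 4 * k1 * Zf xi by [].
rewrite LE; rewrite -!(mulrA 2 Cg) in hd *; rewrite -!(mulrA 8 Cg) in hM *.
by lra.
Qed.

Theorem energy_small (S : R -> R) (e l m h : R) : 0 <= e -> 0 < l -> 0 < m <= cp ->
  0 < h <= 1 / 4 ->
  (forall t : R, -1 < t < - (1 / 2) -> is_derive t 1 S (I (fun x => phi x * pwF p (u x t)))) ->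
  (forall t, -1 < t < - (1 / 2) -> 0 <= S t <= e) ->
  let B := l ^+ 2 * CG + 8 * expR (`|@bex R n p| * ln 4) * (l `^ (1 - p) * e)
     + 2 * expR (`|@bex R n p| * ln 4) * e + 6 * k2 in
  exists2 xi, t1 - h < xi < t1 - h / 4 &
  (t1 - xi) * A2' xi <= 2 / cp * (6 * B + m * CG + 2 * B / m).
Proof.
move=> e0 l0 hm hh dS hS B.
have [s hs hL] := initial_energy S e l e0 l0 dS hS.
by have h1' := ht1; apply: (A2_small s) => //; lra.
Qed.
End decay.

(** * Maximum principle and gradient bounds *)

Section max_principle.
Context {R : realType} {n : nat}.
Notation rV := 'rV[R]_n.

(** One-sided, because the maximum may be attained at the final time. *)
Lemma deriv_nonneg_at_right_end (f : R -> R) (t d a : R) : a < t ->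
  (forall s, a < s < t -> f s <= f t) -> is_derive t 1 f d -> 0 <= d.
Proof.
move=> at_ h df; rewrite leNgt; apply/negP => d0.
have /cvgrPdist_lt := quot_cvg df.
have nd0 : 0 < - d by lra.
move=> /(_ _ nd0) H.
have H1 : \forall h \near (0 : R)^', `|h| < t - a by apply: (@dnbhs0_lt R R); lra.
have [e /= e0 He] := filterI H H1.
have e2 : `|0 - (- (e / 2))| < e by rewrite sub0r opprK gtr0_norm; lra.
have en : - (e / 2) != 0 by rewrite oppr_eq0 gt_eqF//; lra.
have [/= h1 h2] := He _ e2 en.
have h3 : a < - (e / 2) + t < t by move: h2; rewrite normrN gtr0_norm; lra.
have h4 := h _ h3.
have : 0 <= (- (e / 2))^-1 * (f (- (e / 2) + t) - f t).
  by apply: mulr_le0; [rewrite invr_le0; lra|lra].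
by move: h1; rewrite ltr_norml => /andP[h1 h1']; lra.
Qed.

(** The first derivative vanishes at 0. Were the second positive, the first would be positive just
    to the right and [f] would exceed [f 0]. *)
Lemma second_deriv_at_max (f f1 : R -> R) (d e : R) : 0 < e ->
  (forall s, - e < s < e -> is_derive s 1 f (f1 s)) ->
  (forall s, - e < s < e -> f s <= f 0) -> is_derive (0 : R) 1 f1 d -> d <= 0.
Proof.
move=> e0 df h df1; rewrite leNgt; apply/negP => d0.
have z : - e < 0 < e by lra.
have f10 : f1 0 = 0.
  apply/eqP; rewrite eq_le; apply/andP; split.
    have dN0 : is_derive (0 : R) 1 (fun s => f (- s)) (- f1 0).
      have d1 : is_derive (0 : R) 1 (fun r : R => - r) (-1) by apply: dN; exact: is_derive_id.
      refine (dE (dcomp (h := f) d1 _) _); first by rewrite oppr0; exact: df.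
      by rewrite mulrN1.
    rewrite -oppr_ge0; apply: (@deriv_nonneg_at_right_end (fun s => f (- s)) 0 _ (- e)) dN0; first lra.
    by move=> s hs; rewrite oppr0; apply: h; lra.
  by apply: (@deriv_nonneg_at_right_end f 0 _ (- e)) (df 0 z); [lra|move=> s hs; apply: h; lra].
have /cvgrPdist_lt := quot_cvg df1.
move=> /(_ _ d0) [e' /= e'0 He].
pose s := Num.min e e' / 2.
have me : 0 < Num.min e e' by rewrite lt_min e0 e'0.
have mle : Num.min e e' <= e by rewrite ge_min lexx.
have mle' : Num.min e e' <= e' by rewrite ge_min lexx orbT.
have s0 : 0 < s by rewrite /s; lra.
have [c hc E] : exists2 c, 0 < c < s & f s - f 0 = f1 c * (s - 0).
  by apply: MVT_oo => // x hx; apply: df; move: hx; rewrite /s; lra.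
have c1 : `|0 - c| < e' by rewrite sub0r normrN gtr0_norm; move: hc; rewrite /s; lra.
have c0 : c != 0 by rewrite gt_eqF//; lra.
have := He _ c1 c0; rewrite /= addr0 f10 subr0 ltr_norml => /andP[_ h2].
have c0' : 0 < c by lra.
have : 0 < c^-1 * f1 c by lra.
rewrite pmulr_rgt0 ?invr_gt0// => fc.
have : 0 < f1 c * (s - 0) by rewrite pmulr_rgt0//; lra.
have := h s; rewrite -E => /(_ ltac:(rewrite /s; lra)).
by lra.
Qed.

Lemma compact_box (lo hi : 'I_n -> R) :
  compact [set x : rV | forall i, lo i <= x ord0 i <= hi i].
Proof.
have := @rV_compact R n (fun i => `[lo i, hi i]%classic) (fun i => @segment_compact R _ _).
congr compact; apply/seteqP; split => x /= h i; have := h i; by rewrite in_itv.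
Qed.

Lemma max_principle (W Wt : rV -> R -> R) (W1 W2 : 'I_n -> rV -> R -> R)
    (lo hi : 'I_n -> R) (a b : R) :
  continuous (fun z : rV * R => W z.1 z.2) ->
  (forall i (x : rV) (t : R), a < t <= b -> is_derive x (ev i) (W^~ t) (W1 i x t)) ->
  (forall i (x : rV) (t : R), a < t <= b -> is_derive x (ev i) ((W1 i)^~ t) (W2 i x t)) ->
  (forall (x : rV) (t : R), a < t <= b -> is_derive t 1 (W x) (Wt x t)) ->
  (forall (x : rV) (t : R), a < t <= b -> (forall i, lo i <= x ord0 i <= hi i) ->
     Wt x t < \sum_i W2 i x t) ->
  (forall (x : rV) (t : R), a <= t <= b -> (forall i, lo i <= x ord0 i <= hi i) ->
     t = a \/ (exists i, x ord0 i = lo i \/ x ord0 i = hi i) -> W x t <= 0) ->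
  forall (x : rV) (t : R), a <= t <= b -> (forall i, lo i <= x ord0 i <= hi i) -> W x t <= 0.
Proof.
move=> cW dW1 dW2 dWt sub bd x0 t0 ht0 hx0.
pose Q : set (rV * R) := [set x : rV | forall i, lo i <= x ord0 i <= hi i] `*` `[a, b]%classic.
have cQ : compact Q by apply: compact_setX; [exact: compact_box|exact: segment_compact].
have Q0 : Q !=set0 by exists (x0, t0); split => //=; rewrite in_itv.
have [[x t] /set_mem[/= hx ht] hmax] := compact_EVT_max Q0 cQ (continuous_subspaceT cW).
rewrite in_itv/= in ht.
apply: (@le_trans _ _ (W x t)).
  by apply: (hmax (x0, t0)); apply/mem_set; split => //=; rewrite in_itv.
have [ta|/eqP ta] := eqVneq t a; first by apply: bd => //; left.
have [[i hi']|nex] := pselect (exists i, x ord0 i = lo i \/ x ord0 i = hi i).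
  by apply: bd => //; right; exists i.
have tab : a < t <= b by rewrite lt_neqAle eq_sym; move/eqP: ta => ->.
have hin i : lo i < x ord0 i < hi i.
  have := hx i; rewrite !le_eqVlt => /andP[/orP[/eqP h|->] /orP[/eqP h'|->]] //.
  - by exfalso; apply: nex; exists i; left.
  - by exfalso; apply: nex; exists i; left.
  - by exfalso; apply: nex; exists i; right.
exfalso; have := sub x t tab hx; apply/negP; rewrite -leNgt.
apply: (@le_trans _ _ 0).
  rewrite -oppr_ge0 -sumrN; apply: sumr_ge0 => i _; rewrite oppr_ge0.
  pose e := Num.min (x ord0 i - lo i) (hi i - x ord0 i).
  have e0 : 0 < e by rewrite lt_min; have := hin i; lra.
  apply: (@second_deriv_at_max (fun s => W (s *: ev i + x) t) (fun s => W1 i (s *: ev i + x) t) _ e e0).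
  - by move=> s _; apply: (@d_line R _ (W^~ t)); exact: dW1.
  - move=> s hs; rewrite scale0r add0r; apply: (hmax (s *: ev i + x, t)).
    apply/mem_set; split => /=; last by rewrite in_itv.
    move=> j; rewrite !mxE eqxx /=.
    have [->|ji] := eqVneq j i; last by rewrite mulr0 add0r.
    rewrite mulr1.
    have e1 : e <= x ord0 i - lo i by rewrite ge_min lexx.
    have e2 : e <= hi i - x ord0 i by rewrite ge_min lexx orbT.
    by lra.
  - apply: (@d_line R _ ((W1 i)^~ t)); rewrite scale0r add0r; exact: dW2.
apply: (@deriv_nonneg_at_right_end (W x) t _ a); [lra| |exact: dWt].
move=> s hs; apply: (hmax (x, s)); apply/mem_set; split => //=.
by rewrite in_itv/=; lra.
Qed.
End max_principle.

(* The estimates below are linear: they only use bounds on [V - Laplacian u]. *)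
Section heat_bounds.
Context {R : realType} {n : nat}.
Notation rV := 'rV[R]_n.

Record LinearSol (u V : rV -> R -> R) (G H : 'I_n -> rV -> R -> R) : Prop := MkLinearSol {
  hd_cu : continuous (fun z : rV * R => u z.1 z.2);
  hd_dG : forall i (x : rV) (t : R), is_derive x (ev i) (u^~ t) (G i x t);
  hd_dH : forall i (x : rV) (t : R), is_derive x (ev i) ((G i)^~ t) (H i x t);
  hd_dt : forall (x : rV) (t : R), -2 < t < 0 -> is_derive t 1 (u x) (V x t) }.

Lemma Sol_LinearSol p u V G H : Sol p u V G H -> LinearSol u V G H.
Proof. by case=> h1 h2 h3 h4 h5 h6 h7 h8; split. Qed.

Lemma LinearSolN u V G H : LinearSol u V G H ->
  LinearSol (fun x t => - u x t) (fun x t => - V x t) (fun i x t => - G i x t) (fun i x t => - H i x t).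
Proof.
case=> h1 h2 h3 h4; split.
- exact: cN.
- by move=> i x t; exact: (dN (h2 i x t)).
- by move=> i x t; exact: (dN (h3 i x t)).
- by move=> x t ht; exact: (dN (h4 x t ht)).
Qed.

Lemma d_sqC (c x : rV) j : is_derive x (ev j) (fun y : rV => 2 * (y ord0 j - c ord0 j)) 2.
Proof. by refine (dE (dZ 2 (d_coordB j j c x)) _); rewrite eqxx mulr1. Qed.

(** The barrier is k + L |x - x0|^2 + S (t - xi). The slope L = K / rho^2 makes it at least K on the
    lateral boundary, and [S] exceeds 2nL + N by L, which gives strictness. *)
Lemma forward_upper u V G H (x0 : rV) (xi t0 rho k K N : R) : LinearSol u V G H ->
  -2 < xi -> xi < t0 -> t0 < 0 -> 0 < rho -> 0 < K -> 0 <= k ->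
  (forall x, `|x - x0| <= rho -> u x xi <= k) ->
  (forall (x : rV) (t : R), `|x - x0| <= rho -> xi <= t <= t0 -> u x t <= K) ->
  (forall (x : rV) (t : R), `|x - x0| <= rho -> xi < t <= t0 -> V x t - \sum_i H i x t <= N) ->
  0 <= N ->
  u x0 t0 <= k + ((2 * n%:R + 1) * (K / rho ^+ 2) + N) * (t0 - xi).
Proof.
move=> [cu dG dH dt] xi2 xit t00 rho0 K0 k0 hk hK hN N0.
set L := K / rho ^+ 2; set S := (2 * n%:R + 1) * L + N.
have L0 : 0 < L by rewrite divr_gt0// exprn_gt0.
have S0 : 0 <= S by rewrite /S addr_ge0// mulr_ge0 ?(ltW L0)// addr_ge0// mulr_ge0// ler0n.
pose W x t := u x t - (k + L * sq x0 x + S * (t - xi)).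
pose W1 i x t := G i x t - L * (2 * (x ord0 i - x0 ord0 i)).
pose W2 i x t := H i x t - L * 2.
have inbox (x : rV) : (forall i, x0 ord0 i - rho <= x ord0 i <= x0 ord0 i + rho) -> `|x - x0| <= rho.
  move=> h; apply: norm_leP => [|i]; first exact: ltW.
  by rewrite !mxE ler_norml; have := h i; lra.
have nW : W x0 t0 <= 0.
  apply: (@max_principle R n W (fun x t => V x t - S) W1 W2
    (fun i => x0 ord0 i - rho) (fun i => x0 ord0 i + rho) xi t0).
  - apply: cB => //; apply: cD; first apply: cD; first exact: cC.
      apply: cM; first exact: cC.
      by apply: (@ccomp _ _ _ (fun z : rV * R => z.1) (sq x0)); [move=> z; exact: cvg_fst|exact: cont_sq].
    apply: cM; first exact: cC.
    by apply: cB; [move=> z; exact: cvg_snd|exact: cC].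
  - move=> i x t _; refine (dE (dB (dG i x t) (dD (dD (dC k _ _) (dZ L (d_sq x0 x i))) (dC _ _ _))) _).
    by rewrite add0r addr0.
  - by move=> i x t _; exact: (dB (dH i x t) (dZ L (d_sqC x0 x i))).
  - move=> x t ht; have ht' : -2 < t < 0 by lra.
    have d1 : is_derive t 1 (fun s : R => s - xi) 1.
      by refine (dE (dB (is_derive_id _ _) (dC xi t 1)) _); rewrite subr0.
    refine (dE (dB (dt x t ht') (dD (dC _ _ _) (dZ S d1))) _).
    by rewrite add0r mulr1.
  - move=> x t ht hx; rewrite /W2 sumrB sumr_const card_ord.
    have := hN x t (inbox x hx) ht; rewrite /S -[(L * 2) *+ n]mulr_natr; lra.
  - move=> x t ht hx [->|[i hi]].
      rewrite /W subrr mulr0 addr0; have := hk x (inbox x hx).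
      have : 0 <= L * sq x0 x by rewrite mulr_ge0 ?(ltW L0) ?sq_ge0.
      by lra.
    have s2 : rho ^+ 2 <= sq x0 x.
      apply: le_trans (coord_sq x0 x i).
      by case: hi => ->; rewrite le_eqVlt; apply/orP; left; apply/eqP; ring.
    have : L * rho ^+ 2 <= L * sq x0 x by rewrite ler_wpM2l// ltW.
    rewrite {1}/L divfK ?expf_neq0 ?gt_eqF// => h.
    have : 0 <= S * (t - xi) by rewrite mulr_ge0//; lra.
    by have := hK x t (inbox x hx) ht; rewrite /W; lra.
  - by lra.
  - by move=> i; lra.
move: nW; rewrite /W (_ : sq x0 x0 = 0); first by lra.
by rewrite /sq big1// => i _; rewrite subrr expr0n.
Qed.

Definition refl_rV (x0 : rV) i (x : rV) : rV := x - (2 * (x ord0 i - x0 ord0 i)) *: ev i.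

Lemma refl_line x0 i j (x : rV) (s : R) :
  refl_rV x0 i (s *: ev j + x) = (if j == i then - s else s) *: ev j + refl_rV x0 i x.
Proof.
apply/rowP => k; rewrite /refl_rV !mxE eqxx /=.
have [->|ji] := eqVneq j i.
  by case: eqP => _ /=; ring.
by case: (eqVneq k j) => _; case: (eqVneq k i) => _ /=; ring.
Qed.

Lemma d_refl (f : rV -> R) f' x0 i j (x : rV) :
  (forall y, is_derive y (ev j) f (f' y)) ->
  is_derive x (ev j) (fun y => f (refl_rV x0 i y)) ((-1) ^+ (j == i) * f' (refl_rV x0 i x)).
Proof.
move=> df; apply: d_at_line.
rewrite (_ : (fun _ => _) = fun s => f (((-1) ^+ (j == i) * s) *: ev j + refl_rV x0 i x)); last first.
  apply/funext => s; rewrite refl_line; congr (f (_ *: _ + _)).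
  by case: eqP => _; rewrite ?expr0 ?expr1 ?mul1r ?mulN1r.
have d1 : is_derive (0 : R) 1 (fun s : R => (-1) ^+ (j == i) * s) ((-1) ^+ (j == i)).
  by refine (dE (dZ _ (is_derive_id _ _)) _); rewrite mulr1.
have d2 : is_derive ((-1) ^+ (j == i) * (0 : R)) 1 (fun s : R => f (s *: ev j + refl_rV x0 i x)) (f' (refl_rV x0 i x)).
  by apply: d_line; rewrite mulr0 scale0r add0r.
by refine (dE (dcomp d1 d2) _); rewrite mulrC.
Qed.

Lemma cont_refl x0 i : continuous (refl_rV x0 i).
Proof.
move=> x; rewrite (_ : refl_rV x0 i = (fun y : rV => y) - (fun y : rV => (2 * (y ord0 i - x0 ord0 i)) *: ev i))//.
have h : {for x, continuous (fun y : rV => 2 * (y ord0 i - x0 ord0 i))}.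
  move: x; apply: cM; first exact: cC.
  by apply: cB; [exact: cont_coord|exact: cC].
have h1 : (fun y : rV => y) @ x --> x by move=> B.
exact: (cvgB h1 (cvgZ h (cvg_cst _))).
Qed.

(* Compare half the odd part of [u] in the i-th direction with a barrier vanishing
   at the centre (Gilbarg-Trudinger, Section 3.4). *)
Lemma grad_upper u V G H (x0 : rV) (t0 r K N : R) i : LinearSol u V G H ->
  -2 < t0 - r ^+ 2 -> t0 < 0 -> 0 < r -> 0 < K -> 0 <= N ->
  (forall (x : rV) (t : R), `|x - x0| <= r -> t0 - r ^+ 2 <= t <= t0 -> `|u x t| <= K) ->
  (forall (x : rV) (t : R), `|x - x0| <= r -> t0 - r ^+ 2 < t <= t0 -> `|V x t - \sum_i H i x t| <= N) ->
  G i x0 t0 <= (2 * n%:R + 2) * K / r + N * r.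
Proof.
move=> [cu dG dH dt] tr t00 r0 K0 N0 hK hN.
(* [B] is such that twice its value pays for the Laplacian of the quadratic term, for its time
   derivative and for N, with a margin L. *)
set L := K / r ^+ 2; set B := ((2 * n%:R + 2) * L + N) / 2.
have L0 : 0 < L by rewrite divr_gt0// exprn_gt0.
have n0 : 0 <= n%:R :> R by rewrite ler0n.
have B0 : 0 <= B by rewrite divr_ge0// addr_ge0// mulr_ge0 ?(ltW L0)//; lra.
have Lr : L * r ^+ 2 = K by rewrite /L divfK// expf_neq0// gt_eqF.
pose y (x : rV) : R := x ord0 i - x0 ord0 i.
pose s x := refl_rV x0 i x.
pose W x t := (u x t - u (s x) t) / 2 - (L * (sq x0 x + (t0 - t)) + B * (y x * (2 * r - y x))).
pose W1 j x t := (G j x t - (-1) ^+ (j == i) * G j (s x) t) / 2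
   - (L * (2 * (x ord0 j - x0 ord0 j)) + B * ((i == j)%:R * (2 * r - 2 * y x))).
pose W2 j x t := (H j x t - H j (s x) t) / 2 - (L * 2 - B * ((i == j)%:R * 2)).
(* The comparison takes place on the half cube x_i >= x0_i: on the face x_i = x0_i the odd part
   vanishes, and the barrier is nonnegative throughout since 0 <= y <= r. *)
pose lo (j : 'I_n) := if j == i then x0 ord0 j else x0 ord0 j - r.
pose hi j := x0 ord0 j + r.
have inbox (x : rV) : (forall j, lo j <= x ord0 j <= hi j) -> `|x - x0| <= r.
  move=> h; apply: norm_leP => [|j]; first exact: ltW.
  by rewrite !mxE ler_norml; have := h j; rewrite /lo /hi; case: ifP => _; lra.
have sc (x : rV) j : (s x) ord0 j - x0 ord0 j = (-1) ^+ (j == i) * (x ord0 j - x0 ord0 j).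
  rewrite /s /refl_rV !mxE eqxx /=; have [->|_] := eqVneq j i; first by rewrite expr1 /=; ring.
  by rewrite expr0 /=; ring.
have inbox' (x : rV) : (forall j, lo j <= x ord0 j <= hi j) -> `|s x - x0| <= r.
  move=> h; have h2 := inbox x h; apply: norm_leP => [|j]; first exact: ltW.
  rewrite mxE [X in _ + X]mxE sc normrM normrX normrN1 expr1n mul1r.
  by apply: le_trans h2; have := coord_le_norm (x - x0) j; rewrite !mxE.
have yin (x : rV) : (forall j, lo j <= x ord0 j <= hi j) -> 0 <= y x <= r.
  by move=> /(_ i); rewrite /lo /hi eqxx /y; lra.
have nW (x : rV) (t : R) : t0 - r ^+ 2 <= t <= t0 -> (forall j, lo j <= x ord0 j <= hi j) -> W x t <= 0.
  apply: (@max_principle R n W (fun x t => (V x t - V (s x) t) / 2 + L) W1 W2 lo hi (t0 - r ^+ 2) t0).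
  - have c1 : continuous (fun z : rV * R => z.1) by move=> z; exact: cvg_fst.
    have c2 : continuous (fun z : rV * R => z.2) by move=> z; exact: cvg_snd.
    have cy : continuous (fun z : rV * R => y z.1).
      apply: (@ccomp _ _ _ (fun z : rV * R => z.1) y) => //.
      by apply: cB; [exact: cont_coord|exact: cC].
    apply: cB.
      apply: cM; last exact: cC.
      apply: cB => //.
      apply: (@ccomp _ _ _ (fun z : rV * R => (s z.1, z.2)) (fun z => u z.1 z.2)) => //.
      apply: cpair => // z; apply: (@continuous_comp _ _ _ (fun z : rV * R => z.1) s); first exact: c1.
      exact: cont_refl.
    apply: cD; first apply: cM; first exact: cC.
      apply: cD; last by apply: cB => //; exact: cC.
      by apply: (@ccomp _ _ _ (fun z : rV * R => z.1) (sq x0)) => //; exact: cont_sq.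
    apply: cM; first exact: cC.
    by apply: cM => //; apply: cB => //; exact: cC.
  - move=> j x' t' _.
    have dy : is_derive x' (ev j) y ((i == j)%:R) by exact: d_coordB.
    refine (dE (dB (dM (dB (dG j x' t') (d_refl (u^~ t') (fun x => G j x t') x0 i j x' (fun y => dG j y t'))) (dC (2^-1) _ _))
      (dD (dZ L (dD (d_sq x0 x' j) (dC (t0 - t') _ _))) (dZ B (dM dy (dB (dC (2 * r) _ _) dy))))) _).
    by rewrite /W1 /s; ring.
  - move=> j x' t' _.
    have dy : is_derive x' (ev j) y ((i == j)%:R) by exact: d_coordB.
    refine (dE (dB (dM (dB (dH j x' t') (dZ ((-1) ^+ (j == i)) (d_refl ((G j)^~ t') (fun x => H j x t') x0 i j x' (fun y => dH j y t')))) (dC (2^-1) _ _))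
      (dD (dZ L (d_sqC x0 x' j)) (dZ B (dZ ((i == j)%:R) (dB (dC (2 * r) _ _) (dZ 2 dy)))))) _).
    rewrite /W2 /s; case: (eqVneq j i) => [->|ji]; first by rewrite expr1 /=; ring.
    by rewrite expr0 /=; ring.
  - move=> x' t' ht; have ht' : -2 < t' < 0 by lra.
    refine (dE (dB (dM (dB (dt x' t' ht') (dt (s x') t' ht')) (dC (2^-1) _ _))
      (dD (dZ L (dD (dC (sq x0 x') _ _) (dB (dC t0 _ _) (is_derive_id _ _)))) (dC _ _ _))) _).
    by ring.
  - move=> x' t' ht hx.
    have a1 := hN x' t' (inbox x' hx) ht; have a2 := hN (s x') t' (inbox' x' hx) ht.
    have E : \sum_j W2 j x' t' = (\sum_j H j x' t' - \sum_j H j (s x') t') / 2 - (2 * n%:R * L - 2 * B).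
      rewrite /W2 sumrB -mulr_suml sumrB; congr (_ - _).
      rewrite sumrB sumr_const card_ord -[(L * 2) *+ n]mulr_natr; congr (_ - _); first by ring.
      rewrite -mulr_sumr (bigD1 i)//= eqxx big1; first by rewrite addr0 mul1r mulrC.
      by move=> j ji; rewrite eq_sym (negbTE ji) mul0r.
    rewrite E /B; move: a1 a2; rewrite !ler_norml; lra.
  - move=> x' t' ht hx hb.
    have a1 := hK x' t' (inbox x' hx) ht; have a2 := hK (s x') t' (inbox' x' hx) ht.
    have yy := yin x' hx.
    have yb : 0 <= B * (y x' * (2 * r - y x')).
      by apply: mulr_ge0 => //; apply: mulr_ge0; lra.
    have uK : (u x' t' - u (s x') t') / 2 <= K by move: a1 a2; rewrite !ler_norml; lra.
    have sq0 := sq_ge0 x0 x'.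
    have Lsq : 0 <= L * sq x0 x' by rewrite mulr_ge0// ltW.
    have Lt : 0 <= L * (t0 - t') by rewrite mulr_ge0//; [exact: ltW|lra].
    case: hb => [tE|[j hj]].
      have : L * (t0 - t') = K by rewrite tE -Lr; congr (_ * _); ring.
      by rewrite /W mulrDr; lra.
    have [h0|h0] := eqVneq (x' ord0 j - x0 ord0 j) 0.
      have ji : j = i.
        apply/eqP; apply/negPn/negP => ji.
        by move: hj; rewrite /lo /hi (negbTE ji); case=> E; move: h0; rewrite E; lra.
      have sx : s x' = x'.
        by rewrite /s /refl_rV -ji h0 mulr0 scale0r subr0.
      by rewrite /W sx subrr mul0r mulrDr; lra.
    have sqr : r ^+ 2 <= sq x0 x'.
      apply: le_trans (coord_sq x0 x' j).
      case: hj; rewrite /lo /hi => E; last first.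
        by rewrite E le_eqVlt; apply/orP; left; apply/eqP; ring.
      move: E h0; have [_ ->|_ ->] := eqVneq j i; first by rewrite subrr eqxx.
      by move=> _; rewrite le_eqVlt; apply/orP; left; apply/eqP; ring.
    have : L * r ^+ 2 <= L * sq x0 x' by rewrite ler_wpM2l// ltW.
    by rewrite Lr /W mulrDr; lra.
(* Divide by the distance to the centre. *)
have key (h : R) : 0 < h <= r -> (u (h *: ev i + x0) t0 - u (- h *: ev i + x0) t0) / 2 <= h * (L * h + 2 * r * B).
  move=> hh; have := nW (h *: ev i + x0) t0.
  have r2 : 0 <= r ^+ 2 by rewrite exprn_ge0// ltW.
  have hb j : lo j <= (h *: ev i + x0) ord0 j <= hi j.
    rewrite /lo /hi !mxE eqxx /=; case: eqP => _ /=; lra.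
  move=> /(_ ltac:(lra) hb); rewrite /W.
  have -> : s (h *: ev i + x0) = - h *: ev i + x0.
    rewrite /s refl_line eqxx; congr (_ + _).
    by rewrite /refl_rV subrr mulr0 scale0r subr0.
  have -> : y (h *: ev i + x0) = h by rewrite /y !mxE !eqxx /= mulr1 addrK.
  have -> : sq x0 (h *: ev i + x0) = h ^+ 2.
    rewrite /sq (bigD1 i)//= !mxE !eqxx /= mulr1 addrK big1 ?addr0// => j ji.
    by rewrite !mxE eqxx /= (negbTE ji) mulr0 add0r subrr expr0n.
  have : 0 <= B * (h * h) by rewrite mulr_ge0// mulr_ge0//; lra.
  rewrite subrr addr0 => Bh.
  have -> : h * (L * h + 2 * r * B) = L * h ^+ 2 + B * (h * (2 * r - h)) + B * (h * h) by ring.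
  by lra.
have D : is_derive (0 : R) 1 (fun h : R => (u (h *: ev i + x0) t0 - u (- h *: ev i + x0) t0) / 2) (G i x0 t0).
  have d1 : is_derive (0 : R) 1 (fun h : R => u (h *: ev i + x0) t0) (G i x0 t0).
    by apply: (@d_line R _ (u^~ t0)); rewrite scale0r add0r; exact: dG.
  have d0 : is_derive (0 : R) 1 (fun h : R => - h) (-1) by apply: dN; exact: is_derive_id.
  have d2 : is_derive (- (0 : R)) 1 (fun h : R => u (h *: ev i + x0) t0) (G i x0 t0) by rewrite oppr0.
  by refine (dE (dM (dB d1 (dcomp d0 d2)) (dC (2^-1) _ _)) _); field.
have BE : 2 * r * B = (2 * n%:R + 2) * K / r + N * r.
  by rewrite /B /L; field; rewrite gt_eqF.
rewrite -BE leNgt; apply/negP => hG.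
pose dl := G i x0 t0 - 2 * r * B.
have dl0 : 0 < dl by rewrite /dl; lra.
have /cvgrPdist_lt := quot_cvg D; move=> /(_ (dl / 2) ltac:(lra)) [e /= e0 He].
pose h := Num.min (Num.min (e / 2) r) (dl / (4 * L)).
have l4 : 0 < dl / (4 * L) by apply: divr_gt0 => //; lra.
have h0 : 0 < h by rewrite !lt_min r0 l4 !andbT; lra.
have h1 : h <= e / 2 by rewrite !ge_min lexx.
have h2 : h <= r by rewrite !ge_min lexx orbT.
have h3 : h <= dl / (4 * L) by rewrite ge_min lexx orbT.
have Lh : L * h <= dl / 4.
  have := ler_wpM2l (ltW L0) h3; rewrite (_ : L * (dl / (4 * L)) = dl / 4)//.
  by field; rewrite gt_eqF.
have := He h; rewrite /= sub0r normrN gtr0_norm// => /(_ ltac:(lra) (lt0r_neq0 h0)).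
rewrite addr0 !scale0r oppr0 scale0r !add0r subrr mul0r subr0 ltr_norml => /andP[_ hq].
have := key h ltac:(lra) => k.
have : h^-1 * ((u (h *: ev i + x0) t0 - u (- h *: ev i + x0) t0) / 2) <= L * h + 2 * r * B.
  by rewrite ler_pdivrMl//; exact: k.
by move: hq; rewrite /dl in Lh *; lra.
Qed.

Lemma grad_bound u V G H (x0 : rV) (t0 r K N : R) i : LinearSol u V G H ->
  -2 < t0 - r ^+ 2 -> t0 < 0 -> 0 < r -> 0 < K -> 0 <= N ->
  (forall (x : rV) (t : R), `|x - x0| <= r -> t0 - r ^+ 2 <= t <= t0 -> `|u x t| <= K) ->
  (forall (x : rV) (t : R), `|x - x0| <= r -> t0 - r ^+ 2 < t <= t0 -> `|V x t - \sum_i H i x t| <= N) ->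
  `|G i x0 t0| <= (2 * n%:R + 2) * K / r + N * r.
Proof.
move=> hd tr t00 r0 K0 N0 hK hN; rewrite ler_norml lerNl.
rewrite (grad_upper u V G H) ?andbT//.
apply: (grad_upper _ _ _ _ _ _ _ _ _ _ (LinearSolN _ _ _ _ hd)) => //.
  by move=> x t hx ht; rewrite normrN; exact: hK.
by move=> x t hx ht; rewrite sumrN -opprD normrN; exact: hN.
Qed.

(** One coordinate is changed at a time, which requires only partial derivatives; the intermediate
    points stay in the cube because the norm is the sup norm. *)
Lemma lipschitz_cube (f : rV -> R) (F1 : 'I_n -> rV -> R) (x0 : rV) (rho Lm : R) :
  0 <= Lm ->
  (forall i x, is_derive x (ev i) f (F1 i x)) ->
  (forall i x, `|x - x0| <= rho -> `|F1 i x| <= Lm) ->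
  forall x y, `|x - x0| <= rho -> `|y - x0| <= rho -> `|f x - f y| <= n%:R * (Lm * `|x - y|).
Proof.
move=> L0 df hF x y hx hy.
pose z (k : nat) : rV := \row_j if (j < k)%N then x ord0 j else y ord0 j.
have zin (w : rV) (k : 'I_n) : (forall j, j != k -> w ord0 j = x ord0 j \/ w ord0 j = y ord0 j) ->
   (`|w ord0 k - x0 ord0 k| <= rho) -> `|w - x0| <= rho.
  move=> h1 h2; apply: norm_leP; first exact: le_trans hx.
  move=> j; rewrite !mxE; have [->//|jk] := eqVneq j k.
  case: (h1 j jk) => ->.
    by apply: le_trans hx; have := coord_le_norm (x - x0) j; rewrite !mxE.
  by apply: le_trans hy; have := coord_le_norm (y - x0) j; rewrite !mxE.
have step (k : 'I_n) : `|f (z k.+1) - f (z k)| <= Lm * `|x - y|.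
  pose w (s : R) : rV := s *: ev k + (z k - (z k ord0 k) *: ev k).
  have wk s : w s ord0 k = s by rewrite !mxE ltnn !eqxx /=; ring.
  have wj s (j : 'I_n) : j != k -> w s ord0 j = z k ord0 j.
    by move=> jk; rewrite !mxE eqxx (negbTE jk) /=; ring.
  have wx : w (x ord0 k) = z k.+1.
    apply/rowP => j; have [->|jk] := eqVneq j k; first by rewrite wk !mxE ltnSn.
    rewrite wj// !mxE ltnS (leq_eqVlt j k); have /negbTE -> : (j : nat) != k by [].
    by [].
  have wy : w (y ord0 k) = z k.
    apply/rowP => j; have [->|jk] := eqVneq j k; first by rewrite wk !mxE ltnn.
    by rewrite wj.
  rewrite -wx -wy.
  have dw (s : R) : is_derive s 1 (fun s => f (w s)) (F1 k (w s)) by apply: d_line; exact: df.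
  have bw (s : R) : `|s - x0 ord0 k| <= rho -> `|F1 k (w s)| <= Lm.
    move=> hs; apply: hF; apply: (zin _ k); last by rewrite wk.
    by move=> j jk; rewrite wj// !mxE; case: ifP; [left|right].
  have xk : `|x ord0 k - x0 ord0 k| <= rho.
    by apply: le_trans hx; have := coord_le_norm (x - x0) k; rewrite !mxE.
  have yk : `|y ord0 k - x0 ord0 k| <= rho.
    by apply: le_trans hy; have := coord_le_norm (y - x0) k; rewrite !mxE.
  apply: (@le_trans _ _ (Lm * `|x ord0 k - y ord0 k|)); last first.
    by apply: ler_wpM2l => //; have := coord_le_norm (x - y) k; rewrite !mxE.
  have [xy|yx|->] := ltgtP (x ord0 k) (y ord0 k); last by rewrite !subrr normr0 mulr0.
    have [c hc E] := MVT_oo (fun s => f (w s)) _ _ _ xy (fun s _ => dw s).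
    rewrite distrC E normrM (distrC (x ord0 k)) ler_wpM2r// bw//.
    by move: xk yk; rewrite !ler_norml; lra.
  have [c hc E] := MVT_oo (fun s => f (w s)) _ _ _ yx (fun s _ => dw s).
  rewrite E normrM ler_wpM2r// bw//.
  by move: xk yk; rewrite !ler_norml; lra.
have z0 : z 0%N = y by apply/rowP => j; rewrite mxE.
have zn : z n = x by apply/rowP => j; rewrite mxE ltn_ord.
have H (k : nat) : (k <= n)%N -> `|f (z k) - f y| <= k%:R * (Lm * `|x - y|).
  elim: k => [_|k IH kn]; first by rewrite z0 subrr normr0 mul0r.
  rewrite -(subrK (f (z k)) (f (z k.+1))) -addrA (le_trans (ler_normD _ _))//.
  rewrite -natr1 mulrDl mul1r [leRHS]addrC; apply: lerD; first exact: (step (Ordinal kn)).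
  by apply: IH; exact: ltnW.
by rewrite -{1}zn; exact: H.
Qed.
End heat_bounds.

(** * Pointwise bounds from small energy *)

Section schoen.
Context {R : realType} {n : nat}.
Notation rV := 'rV[R]_n.
Variables (p : R) (u V : rV -> R -> R) (G H : 'I_n -> rV -> R -> R).
Hypothesis p1 : 1 < p.
Hypothesis sol : Sol p u V G H.

Definition mexp : R := 4 * kap p.
(** Within half the distance from the maximum point to the boundary the distance at most halves, so
    maximality of dist^[mexp] |u| bounds |u| there by [beta] times its value at that point. *)
Definition beta : R := 2 `^ mexp.
(** Going back a time [c02] r^2, the maximum principle allows a change of less than |u(x1, t1)| / 2;
    within [c1s] r the gradient bound allows a change of at most |u(x1, t1)| / 4. *)
Definition c02 : R := (2 * beta * (8 * n%:R + 5))^-1.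
Definition c1s : R := (4 * (n%:R + 1) * (8 * n%:R + 9) * beta)^-1.
(** The product of the lower bounds, with powers of r removed, for t1 - t, the kernel, (|u| /
    4)^(p+1) and the integral of a cutoff of radius [c1s]. *)
Definition lower_cst : R := c02 / 4 * expR (mexp * ln (c02 / 4) - n%:R / 2 * ln c02 - n%:R / c02)
  * ((1 / 4) `^ (p + 1) * (c1s ^+ n * I (cut (0 : rV) 1))).

Let n0 : 0 <= n%:R :> R. Proof. exact: ler0n. Qed.
Let kp0 : 0 < kap p. Proof. by rewrite invr_gt0; have := p1; lra. Qed.
Lemma mexp_gt0 : 0 < mexp. Proof. by rewrite /mexp; have := kp0; lra. Qed.
Lemma mexpE : mexp * (p - 1) = 2.
Proof. by rewrite /mexp /kap; field; rewrite gt_eqF//; have := p1; lra. Qed.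
Let b1 : 1 <= beta.
Proof. by rewrite /beta -[leLHS](powRr0 2) ler_powR ?(ltW mexp_gt0)//; lra. Qed.
Let bn : 5 <= beta * (8 * n%:R + 5).
Proof.
apply: le_trans (_ : 1 * (8 * n%:R + 5) <= _); first by have := n0; lra.
by rewrite ler_wpM2r//; have := n0; lra.
Qed.
Let c020 : 0 < c02.
Proof. by rewrite invr_gt0; have := bn; lra. Qed.
Let c02_le : c02 <= 1 / 10.
Proof.
rewrite /c02 div1r lef_pV2 ?posrE; have := bn; lra.
Qed.
Lemma c02_bounds : 0 < c02 <= 1 / 10.
Proof. by rewrite c020. Qed.
Let c1den : 4 <= 4 * (n%:R + 1) * (8 * n%:R + 9) * beta.
Proof.
have h1 : 4 <= 4 * (n%:R + 1) * (8 * n%:R + 9) :> R.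
  have -> : 4 * (n%:R + 1) * (8 * n%:R + 9) = 32 * (n%:R * n%:R) + 68 * n%:R + 36 :> R by ring.
  have : 0 <= n%:R * n%:R :> R by rewrite mulr_ge0.
  by have := n0; lra.
apply: le_trans h1 _; rewrite ler_peMr//; lra.
Qed.
Let c1s0 : 0 < c1s. Proof. by rewrite invr_gt0; have := c1den; lra. Qed.
Let c1s_le : c1s <= 1 / 4.
Proof. by rewrite /c1s div1r lef_pV2 ?posrE; have := c1den; lra. Qed.

Lemma lower_cst_gt0 : 0 < lower_cst.
Proof.
have h0 := c020; rewrite /lower_cst; apply: mulr_gt0.
  by apply: mulr_gt0; [lra|exact: expR_gt0].
apply: mulr_gt0; first by apply: powR_gt0; lra.
by apply: mulr_gt0; [exact: exprn_gt0|exact: I_cut_gt0].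
Qed.

Section local.
Variables (x1 : rV) (t1 r : R).
Hypothesis t10 : t1 < 0.
Hypothesis t14 : - (1 / 4) < t1.
Hypothesis r0 : 0 < r.
Hypothesis r12 : r <= 1 / 2.
Hypothesis x12 : `|x1| <= 1 / 2.
Notation K := (beta * `|u x1 t1|).
Hypothesis hK : forall (x : rV) (t : R), `|x - x1| <= r -> t1 - r ^+ 2 <= t <= t1 -> `|u x t| <= K.
Hypothesis hN : K `^ (p - 1) * r ^+ 2 <= 1.
Hypothesis u0 : 0 < `|u x1 t1|.

Let K0 : 0 < K. Proof. by rewrite mulr_gt0//; have := b1; lra. Qed.
Let N := K / r ^+ 2.
Let rr0 : 0 < r ^+ 2. Proof. exact: exprn_gt0. Qed.
Let rr1 : r ^+ 2 <= 1 / 4.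
Proof.
have -> : 1 / 4 = (1 / 2) ^+ 2 :> R by field.
by apply: lerXn2r; rewrite ?nnegrE; have := r0; have := r12; lra.
Qed.
Let N0 : 0 <= N. Proof. by rewrite divr_ge0 ?ltW. Qed.

Let hNN (x : rV) (t : R) : `|x - x1| <= r -> t1 - r ^+ 2 <= t <= t1 -> `|V x t - \sum_i H i x t| <= N.
Proof.
move=> hx ht; rewrite (sol_eq _ _ _ _ _ sol) addrAC subrr add0r.
have h := hK x t hx ht.
rewrite /pwf normrM (ger0_norm (powR_ge0 _ _)).
apply: (@le_trans _ _ (K `^ (p - 1) * K)).
  apply: ler_pM; rewrite ?powR_ge0 ?normr_ge0//.
  by apply: ge0_ler_powR; rewrite ?nnegrE ?(ltW K0)//; have := p1; lra.
rewrite /N mulrC ler_wpM2l ?(ltW K0)//.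
by rewrite -[leRHS]mul1r ler_pdivlMr.
Qed.

Variables (xi : R).
Let h := c02 * r ^+ 2.
Hypothesis hxi : t1 - h < xi < t1 - h / 4.

Let h0 : 0 < h. Proof. exact: mulr_gt0. Qed.
Let h10 : h <= r ^+ 2 / 10.
Proof. by rewrite /h; have := ler_wpM2r (ltW rr0) c02_le; lra. Qed.

(** Otherwise |u| is at most half of |u(x1, t1)| on the slice at time [xi], and [forward_upper],
    applied to u or -u according to the sign at (x1, t1), leaves |u(x1, t1)| below itself. *)
Let exists_large : exists2 xs : rV, `|xs - x1| <= r / 2 & `|u x1 t1| / 2 <= `|u xs xi|.
Proof.
apply: contrapT => hne.
have hs (x : rV) : `|x - x1| <= r / 2 -> `|u x xi| <= `|u x1 t1| / 2.
  move=> hx; rewrite leNgt; apply/negP => hc; apply: hne; exists x => //; exact: ltW.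
have hxi' := hxi; have h10' := h10; have rr1' := rr1; have h0' := h0; have t10' := t10; have t14' := t14; have r0' := r0.
have nr : forall x : rV, `|x - x1| <= r / 2 -> `|x - x1| <= r by move=> x hx; lra.
have main (w W : rV -> R -> R) (G' H' : 'I_n -> rV -> R -> R) : LinearSol w W G' H' ->
   w x1 t1 = `|u x1 t1| -> (forall x t, `|w x t| = `|u x t|) ->
   (forall (x : rV) t, `|x - x1| <= r -> t1 - r ^+ 2 <= t <= t1 -> `|W x t - \sum_i H' i x t| <= N) -> False.
  move=> hd w1 wu wN.
  have := @forward_upper R n w W G' H' x1 xi t1 (r / 2) (`|u x1 t1| / 2) K N hd.
  move=> /(_ ltac:(lra) ltac:(lra) ltac:(lra) ltac:(lra) K0 ltac:(have := u0; lra)).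
  have q1 x : `|x - x1| <= r / 2 -> w x xi <= `|u x1 t1| / 2.
    by move=> hx; apply: le_trans (ler_norm _) _; rewrite wu; exact: hs.
  have q2 (x : rV) (t : R) : `|x - x1| <= r / 2 -> xi <= t <= t1 -> w x t <= K.
    by move=> hx ht; apply: le_trans (ler_norm _) _; rewrite wu; apply: hK; [exact: nr|lra].
  have q3 (x : rV) (t : R) : `|x - x1| <= r / 2 -> xi < t <= t1 -> W x t - \sum_i H' i x t <= N.
    by move=> hx ht; apply: le_trans (ler_norm _) _; apply: wN; [exact: nr|lra].
  move=> /(_ q1 q2 q3 N0); rewrite w1 => q4.
  have E : (2 * n%:R + 1) * (K / (r / 2) ^+ 2) + N = (8 * n%:R + 5) * (K / r ^+ 2).
    by rewrite /N; field; rewrite gt_eqF.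
  have : (8 * n%:R + 5) * (K / r ^+ 2) * (t1 - xi) < (8 * n%:R + 5) * (K / r ^+ 2) * h.
    rewrite ltr_pM2l; first lra.
    by rewrite mulr_gt0 ?divr_gt0//; have := n0; lra.
  have -> : (8 * n%:R + 5) * (K / r ^+ 2) * h = `|u x1 t1| / 2.
    rewrite /h /c02; have := n0; have := b1; move=> bb nn.
    by field; rewrite !gt_eqF//=; lra.
  by move: q4; rewrite E; lra.
have hd := Sol_LinearSol _ _ _ _ _ sol.
have [us|us] := leP 0 (u x1 t1).
  by apply: (main u V G H hd) => //; rewrite ger0_norm.
apply: (main _ _ _ _ (LinearSolN _ _ _ _ hd)).
- by rewrite ltr0_norm.
- by move=> x t; rewrite normrN.
- by move=> x t hx ht; rewrite sumrN -opprD normrN; exact: hNN.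
Qed.

(** On the ball of radius [c1s] r about the point of [exists_large], |u| stays above a quarter of
    |u(x1, t1)|. The distance to x1 is at most r there and t1 - xi is comparable to r^2, so the
    kernel is bounded below at its natural scale. The condition on [A] puts the unit cube where the
    cutoff is 1. *)
Lemma local_lower (A : R) : 0 < A -> 2 * n%:R <= A ^+ 2 ->
  lower_cst * (`|u x1 t1| * r `^ mexp) `^ (p + 1) <= (t1 - xi) * A2 p u (cut (0 : rV) A) t1 x1 xi.
Proof.
move=> A0 hA; have [xs hxs huxs] := exists_large.
set U := `|u x1 t1|.
have U4 : 0 <= U / 4 by apply: divr_ge0; rewrite ?normr_ge0.
have hxi' := hxi; have h10' := h10; have rr1' := rr1; have h0' := h0; have t10' := t10; have t14' := t14; have r0' := r0; have p1' := p1; have n0' := n0; have rr0' := rr0.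
have r4 : (r / 4) ^+ 2 = r ^+ 2 / 16 by field.
have hd := Sol_LinearSol _ _ _ _ _ sol.
set Lm := (8 * n%:R + 9) * K / r.
have Lm0 : 0 <= Lm by rewrite divr_ge0 ?(ltW r0)// mulr_ge0 ?(ltW K0)//; lra.
have tri (x y z : rV) : `|x - z| <= `|x - y| + `|y - z|.
  by rewrite (_ : x - z = (x - y) + (y - z)) ?ler_normD// addrA subrK.
have gb i (y : rV) : `|y - xs| <= r / 4 -> `|G i y xi| <= Lm.
  move=> hy; apply: (@le_trans _ _ ((2 * n%:R + 2) * K / (r / 4) + N * (r / 4))).
    apply: (@grad_bound R n u V G H y xi (r / 4) K N i hd) => //; rewrite ?r4; try lra.
    - move=> x t hx ht; apply: hK; last lra.
      by have := tri x y x1; have := tri y xs x1; lra.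
    - move=> x t hx ht; apply: hNN; last lra.
      by have := tri x y x1; have := tri y xs x1; lra.
  have -> : (2 * n%:R + 2) * K / (r / 4) + N * (r / 4) = (8 * n%:R + 8 + 1 / 4) * K / r.
    by rewrite /N; field; rewrite gt_eqF.
  rewrite /Lm ler_pM2r ?invr_gt0// ler_pM2r//; lra.
have low (y : rV) : `|y - xs| <= c1s * r -> U / 4 <= `|u y xi|.
  move=> hy.
  have c1r : c1s * r <= r / 4 by have := ler_wpM2r (ltW r0) c1s_le; lra.
  have := @lipschitz_cube R n (u^~ xi) (fun i x => G i x xi) xs (r / 4) Lm Lm0
    (fun i x => sol_dG _ _ _ _ _ sol i x xi) gb y xs.
  rewrite subrr normr0 => /(_ ltac:(lra) ltac:(lra)) hl.
  have : n%:R * (Lm * `|y - xs|) <= U / 4.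
    apply: (@le_trans _ _ ((n%:R + 1) * (Lm * (c1s * r)))).
      apply: ler_pM => //; first by rewrite mulr_ge0.
        by lra.
      by rewrite ler_wpM2l.
    rewrite /Lm /c1s /U le_eqVlt; apply/orP; left; apply/eqP.
    by have bb := b1; field; rewrite !gt_eqF//=; lra.
  have : `|u xs xi| <= `|u y xi - u xs xi| + `|u y xi|.
    by rewrite -{1}(subrK (u y xi) (u xs xi)) distrC ler_normD.
  by move: huxs; rewrite -/U; lra.
set E := mexp * ln (h / 4) - n%:R / 2 * ln h - n%:R / c02.
have cr0 : 0 < c1s * r by exact: mulr_gt0.
have pt (y : rV) : (expR E * (U / 4) `^ (p + 1)) * cut xs (c1s * r) y <=
    om p (cut (0 : rV) A) t1 x1 y xi * pwF p (u y xi).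
  have [hout|hin] := leP ((c1s * r) ^+ 2) (sq xs y).
    rewrite cut_out// mulr0 mulr_ge0 ?pwF_ge0// mulr_ge0 ?cut_ge0//; exact: expR_ge0.
  have hy := norm_sq xs y (c1s * r) (ltW cr0) (ltW hin).
  have c1r : c1s * r <= r / 4 by have := ler_wpM2r (ltW r0) c1s_le; lra.
  have y1 : `|y - x1| <= r by have := tri y xs x1; lra.
  rewrite /om (cut_in 0 A) ?mul1r//; last first.
    apply: le_trans (sq_norm 0 y) _; rewrite subr0.
    have : `|y| <= 1.
      by have := tri y x1 0; rewrite !subr0; have := x12; have := r12; lra.
    move=> ny; have : `|y| ^+ 2 <= 1 by rewrite exprn_ile1.
    by move=> /(ler_wpM2l n0'); lra.
  apply: (@le_trans _ _ ((expR E * (U / 4) `^ (p + 1)) * 1)).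
    by rewrite ler_wpM2l ?cut_le1// mulr_ge0 ?expR_ge0 ?powR_ge0.
  rewrite mulr1; apply: ler_pM; rewrite ?expR_ge0 ?powR_ge0//; last first.
    rewrite /pwF; apply: ge0_ler_powR; rewrite ?nnegrE//; try lra.
    exact: low.
  rewrite /gam ler_expR /E /bex mulrBl -/mexp.
  have tau0 : 0 < t1 - xi by lra.
  have l1 : ln (h / 4) <= ln (t1 - xi) by rewrite ler_ln ?posrE; lra.
  have l2 : ln (t1 - xi) <= ln h by rewrite ler_ln ?posrE; lra.
  have m1 : mexp * ln (h / 4) <= mexp * ln (t1 - xi) by rewrite ler_wpM2l ?(ltW mexp_gt0).
  have m2 : n%:R / 2 * ln (t1 - xi) <= n%:R / 2 * ln h by rewrite ler_wpM2l// divr_ge0.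
  have m3 : sq x1 y / (4 * (t1 - xi)) <= n%:R / c02.
    apply: (@le_trans _ _ (n%:R * r ^+ 2 / h)).
      apply: ler_pM; rewrite ?sq_ge0 ?invr_ge0//; try lra.
        apply: le_trans (sq_norm x1 y) _; rewrite ler_wpM2l//.
        by apply: lerXn2r; rewrite ?nnegrE//; lra.
      by rewrite lef_pV2 ?posrE; lra.
    by rewrite /h le_eqVlt; apply/orP; left; apply/eqP; field; rewrite !gt_eqF//=.
  by lra.
have Y1 : (c1s * r) ^+ n * I (cut (0 : rV) 1) * (expR E * (U / 4) `^ (p + 1)) <= A2 p u (cut (0 : rV) A) t1 x1 xi.
  rewrite -(@I_cut R n xs)// mulrC -I_Z; last exact: Cc_cut.
  apply: I_le => //.
  - by apply: CcZ; exact: Cc_cut.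
  - apply: CcMl; first exact: (Cc_om p _ (Cc_cut 0 A A0) t1 x1 xi).
    apply: (ccomp (fun x => u x xi) (pwF p)); last exact: pwF_cont.
    exact: cslice1 (sol_cu _ _ _ _ _ sol).
have U0 : 0 < U := u0.
apply: (@le_trans _ _ (h / 4 * ((c1s * r) ^+ n * I (cut (0 : rV) 1) * (expR E * (U / 4) `^ (p + 1))))); last first.
  apply: ler_pM => //; try lra.
  have i0 := @I_cut_gt0 R n.
  by rewrite !mulr_ge0 ?expR_ge0 ?powR_ge0 ?exprn_ge0 ?(ltW i0) ?(ltW cr0).
have -> : (U / 4) `^ (p + 1) = U `^ (p + 1) * (1 / 4) `^ (p + 1).
  by rewrite -(powRM (p + 1) (ltW U0)) ?div1r// invr_ge0; lra.
rewrite powRM ?powR_ge0 ?(ltW U0)// /lower_cst exprMn.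
have rX k : r ^+ k = expR (k%:R * ln r) by rewrite expRM_natl lnK.
have -> : (r `^ mexp) `^ (p + 1) = expR (mexp * (p + 1) * ln r).
  by rewrite -powRrM /powR gt_eqF.
have mE := mexpE.
(* Scale invariance: with this relation every power of r on the two sides matches. *)
have -> : mexp * (p + 1) = 2 + 2 * mexp by lra.
set a := mexp * ln (c02 / 4) - n%:R / 2 * ln c02 - n%:R / c02.
have -> : E = a + (2 * mexp * ln r - n%:R * ln r).
  have l1 : ln h = ln c02 + 2 * ln r.
    by rewrite /h lnM ?posrE// lnXn// mulr_natl.
  have l2 : ln (h / 4) = ln (c02 / 4) + 2 * ln r.
    rewrite (_ : h / 4 = (c02 / 4) * r ^+ 2); last by rewrite /h; field.
    by rewrite lnM ?posrE//; [rewrite lnXn// mulr_natl|have := c020; lra].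
  by rewrite /E /a l1 l2; field; rewrite gt_eqF.
rewrite (expRD a) -/a.
have -> : expR ((2 + 2 * mexp) * ln r) = r ^+ 2 * (expR (2 * mexp * ln r - n%:R * ln r) * r ^+ n).
  by rewrite !rX -!expRD; congr expR; ring.
rewrite le_eqVlt; apply/orP; left; apply/eqP; rewrite /h; ring.
Qed.
End local.
End schoen.

(** * Maximum of the solution weighted by the distance to the boundary *)

Section schoen_max.
Context {R : realType} {n : nat}.
Notation rV := 'rV[R]_n.
Variables (p : R) (u V : rV -> R -> R) (G H : 'I_n -> rV -> R -> R).
Hypothesis p1 : 1 < p.
Hypothesis sol : Sol p u V G H.
Variables (A Y : R).
Hypothesis A0 : 0 < A.
Hypothesis hA : 2 * n%:R <= A ^+ 2.
Hypothesis Y0 : 0 <= Y.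
Hypothesis hY : forall (x1 : rV) (t1 h : R), `|x1| <= 1 / 2 -> - (1 / 4) < t1 < 0 -> 0 < h <= 1 / 4 ->
  exists2 xi, t1 - h < xi < t1 - h / 4 & (t1 - xi) * A2 p u (cut (0 : rV) A) t1 x1 xi <= Y.
Notation m := (mexp p).
Notation bt := (beta p).
Notation Cs := (@lower_cst R n p).
Let l : R := bt * (Y / Cs) `^ (p + 1)^-1.
Hypothesis l1 : l < 1.

Let m0 : 0 < m := mexp_gt0 p p1.
Let bt0 : 0 < bt. Proof. by rewrite powR_gt0. Qed.
Let l0 : 0 <= l. Proof. by rewrite mulr_ge0 ?powR_ge0// ltW. Qed.
Let Cs0 : 0 < Cs. Proof. exact: lower_cst_gt0. Qed.

(** The spatial part uses the sup norm. The absolute value in [f] makes it continuous on the whole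
    space, also where [dist] is negative. *)
Let dist (z : rV * R) : R := Num.min (1 / 2 - `|z.1|) (Num.sqrt (z.2 + 1 / 4)).
Let f (z : rV * R) : R := `|dist z| `^ m * `|u z.1 z.2|.

Let cdist : continuous dist.
Proof.
apply: cMin.
  apply: cB; first exact: cC.
  by apply: (@ccomp _ _ _ (fun z : rV * R => z.1) (fun x : rV => `|x|)) => z; [exact: cvg_fst|exact: norm_continuous].
apply: (@ccomp _ _ _ (fun z : rV * R => z.2 + 1 / 4) Num.sqrt); last exact: sqrt_continuous.
by apply: cD; [move=> z; exact: cvg_snd|exact: cC].
Qed.

Let cf : continuous f.
Proof.
apply: cM; last by apply: cA; exact: (sol_cu _ _ _ _ _ sol).
apply: (@ccomp _ _ _ dist (fun r : R => `|r| `^ m)); [exact: cdist|].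
exact: cont_abs_powR.
Qed.

(** The cylinder ends at [tb < 0], since the time derivative is available only before 0; the bound
    does not depend on [tb]. *)
Lemma weighted_sup_le (tb : R) : - (1 / 4) <= tb < 0 ->
  forall z : rV * R, `|z.1| <= 1 / 2 -> - (1 / 4) <= z.2 <= tb -> f z <= l.
Proof.
move=> htb.
pose Q : set (rV * R) := [set x : rV | `|x| <= 1 / 2] `*` `[- (1 / 4), tb]%classic.
have cQ : compact Q by apply: compact_setX; [exact: compact_cube|exact: segment_compact].
have Q0 : Q !=set0.
  by exists (0, tb); split => /=; rewrite ?normr0 ?in_itv/=; lra.
have [[x1 t1] /set_mem[/= hx1 ht1] hmax] := compact_EVT_max Q0 cQ (continuous_subspaceT cf).
rewrite in_itv/= in ht1.
set L := f (x1, t1) in hmax.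
have LQ x t : `|x| <= 1 / 2 -> - (1 / 4) <= t <= tb -> f (x, t) <= L.
  by move=> hx ht; apply: hmax; apply/mem_set; split => //=; rewrite in_itv.
suff Ll : L <= l by move=> [x t] /= hx ht; apply: le_trans Ll; exact: LQ.
have L0 : 0 <= L by rewrite mulr_ge0 ?powR_ge0.
have [->//|Ln0] := eqVneq L 0.
have {L0 Ln0} L0 : 0 < L by rewrite lt_neqAle eq_sym Ln0.
pose d1 := dist (x1, t1).
have d10 : 0 <= d1 by rewrite le_min sqrtr_ge0 andbT /=; lra.
have U0 : 0 < `|u x1 t1|.
  rewrite normr_gt0; apply/eqP => E; move: L0.
  by rewrite /L /f /= E normr0 mulr0 ltxx.
have {d10} d10 : 0 < d1.
  rewrite lt_neqAle d10 andbT eq_sym; apply/eqP => E; move: L0.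
  by rewrite /L /f -/d1 E normr0 powR0 ?gt_eqF// mul0r ltxx.
have LE : d1 `^ m * `|u x1 t1| = L by rewrite /L /f -/d1 (gtr0_norm d10).
have d1a : d1 <= 1 / 2 - `|x1| by rewrite ge_min lexx.
have d1b : d1 ^+ 2 <= t1 + 1 / 4.
  have q0 : 0 <= t1 + 1 / 4 by lra.
  rewrite -(sqr_sqrtr q0); apply: lerXn2r; rewrite ?nnegrE ?sqrtr_ge0 ?(ltW d10)//.
  by rewrite ge_min lexx orbT.
have d12 : d1 <= 1 / 2 by have := normr_ge0 x1; lra.
have dd0 : 0 < d1 ^+ 2 by rewrite exprn_gt0.
(* The factor q shrinks the radius: once [L * q^m <= 1], the nonlinearity is at most K / r^2 on the
   smaller cylinder and [local_lower] applies. *)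
have claim (q : R) : 0 < q -> q <= 1 -> L * q `^ m <= 1 -> L * q `^ m <= l.
  move=> q0 q1 hq.
  pose r := d1 / 2 * q.
  have d20 : 0 < d1 / 2 by lra.
  have r0 : 0 < r by exact: mulr_gt0.
  have rd : r <= d1 / 2 by rewrite ger_pMr.
  have rr : r ^+ 2 <= d1 ^+ 2 / 4.
    have -> : d1 ^+ 2 / 4 = (d1 / 2) ^+ 2 by field.
    by apply: lerXn2r; rewrite ?nnegrE; lra.
  have KE : bt * `|u x1 t1| * (d1 / 2) `^ m = L.
    rewrite mulrAC /beta -powRM ?(ltW d20)// (_ : 2 * (d1 / 2) = d1); last by field.
    exact: LE.
  have KrE : bt * `|u x1 t1| * r `^ m = L * q `^ m.
    by rewrite /r powRM ?(ltW d20) ?(ltW q0)// mulrA KE.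
  have hK (x : rV) (t : R) : `|x - x1| <= r -> t1 - r ^+ 2 <= t <= t1 -> `|u x t| <= bt * `|u x1 t1|.
    move=> hx ht.
    have nx : `|x| <= `|x - x1| + `|x1| by rewrite -[X in `|X| <= _](subrK x1) ler_normD.
    have dx : d1 / 2 <= dist (x, t).
      rewrite le_min; apply/andP; split => /=; first by lra.
      rewrite -[leLHS]ger0_norm ?(ltW d20)// -sqrtr_sqr ler_wsqrtr//.
      have -> : (d1 / 2) ^+ 2 = d1 ^+ 2 / 4 by field.
      by lra.
    have fL : f (x, t) <= L by apply: LQ; lra.
    rewrite -(@ler_pM2r _ ((d1 / 2) `^ m)) ?powR_gt0// KE.
    apply: le_trans fL; rewrite /f mulrC ler_wpM2r//.
    apply: ge0_ler_powR; rewrite ?nnegrE ?(ltW m0) ?(ltW d20)//.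
    by apply: le_trans dx (ler_norm _).
  have mE := mexpE p p1.
  have K0 : 0 <= bt * `|u x1 t1| by rewrite mulr_ge0// ltW.
  have hN : (bt * `|u x1 t1|) `^ (p - 1) * r ^+ 2 <= 1.
    have -> : r ^+ 2 = (r `^ m) `^ (p - 1) by rewrite -powRrM mE powR_mulrn// ltW.
    rewrite -powRM ?powR_ge0// KrE.
    have e1 : 1 `^ (p - 1) = 1 :> R by rewrite powR1.
    have p1' := p1; rewrite -[leRHS]e1; apply: ge0_ler_powR; rewrite ?nnegrE//; try lra.
    by rewrite mulr_ge0 ?powR_ge0// ltW.
  have t14 : - (1 / 4) < t1 by lra.
  have t10 : t1 < 0 by lra.
  have r12 : r <= 1 / 2 by lra.
  have hh : 0 < @c02 R n p * r ^+ 2 <= 1 / 4.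
    have := c02_bounds p p1 => /(_ n) => /andP[h1 h2].
    have rr0 : 0 < r ^+ 2 by rewrite exprn_gt0.
    rewrite mulr_gt0//=; apply: le_trans (_ : 1 / 10 * r ^+ 2 <= _).
      by rewrite ler_wpM2r// ltW.
    have : d1 ^+ 2 <= t1 + 1 / 4 by []. lra.
  have [xi hxi hYx] := hY x1 t1 _ hx1 ltac:(lra) hh.
  have := @local_lower R n p u V G H p1 sol x1 t1 r t10 t14 r0 r12 hx1 hK hN U0 xi hxi A A0 hA.
  move=> /le_trans /(_ hYx) h1.
  have -> : L * q `^ m = bt * (`|u x1 t1| * r `^ m) by rewrite -KrE; ring.
  rewrite /l ler_pM2l//.
  have z0 : 0 <= `|u x1 t1| * r `^ m by rewrite mulr_ge0 ?powR_ge0.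
  have p10 : 0 < p + 1 by have := p1; lra.
  rewrite -[leLHS](@powRr1 _ (`|u x1 t1| * r `^ m))// -[X in _ `^ X <= _](@divff _ (p + 1)) ?gt_eqF// powRrM.
  apply: ge0_ler_powR; rewrite ?nnegrE ?invr_ge0 ?powR_ge0 ?(ltW p10)//.
    by rewrite divr_ge0// ltW.
  by rewrite ler_pdivlMr// mulrC.
have [L1|L1] := ltP L 1.
  by have := claim 1; rewrite powR1 mulr1; apply; lra.
(* If L >= 1, this q gives [L * q^m = 1], and the claim would yield 1 <= [l], against [l1]. *)
have q1 : (L `^ (- m^-1)) `^ m = L^-1.
  by rewrite -powRrM mulNr mulVf ?gt_eqF// powR_inv1// ltW.
have := claim (L `^ (- m^-1)); rewrite q1 divff ?gt_eqF// => /(_ (powR_gt0 _ L0)).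
have q2 : L `^ (- m^-1) <= 1.
  rewrite powRN -[leRHS]invr1 lef_pV2 ?posrE ?powR_gt0//.
  by rewrite -[leLHS](powRr0 L) ler_powR// invr_ge0 ltW//.
move=> /(_ q2 (lexx _)); have := l1; lra.
Qed.

(** The region is that of [gradient_bound] enlarged by a cylinder of radius 1/8: 3/8 = 1/4 + 1/8 and
    5/64 = 1/16 + 1/64. There [dist] is at least 1/8. *)
Lemma pointwise_bound (x : rV) (t : R) : `|x| <= 3 / 8 -> - (5 / 64) <= t < 0 ->
  `|u x t| <= 8 `^ m * l.
Proof.
move=> hx ht.
have := @weighted_sup_le t ltac:(lra) (x, t) ltac:(rewrite /=; lra) ltac:(rewrite /=; lra).
rewrite /f /= => h.
have d8 : 1 / 8 <= dist (x, t).
  rewrite le_min /=; apply/andP; split; first lra.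
  have -> : 1 / 8 = Num.sqrt (1 / 64) :> R.
    by rewrite (_ : 1 / 64 = (1 / 8) ^+ 2) ?sqrtr_sqr ?ger0_norm//; field.
  by rewrite ler_wsqrtr//; lra.
have -> : `|u x t| = 8 `^ m * ((1 / 8) `^ m * `|u x t|).
  have e8 : 8 * (1 / 8) = 1 :> R by field.
  have h8 : 0 <= 1 / 8 :> R by lra.
  by rewrite mulrA -powRM ?ler0n// e8 powR1 mul1r.
rewrite ler_pM2l ?powR_gt0//; apply: le_trans h.
rewrite ler_wpM2r//; apply: ge0_ler_powR; rewrite ?nnegrE ?(ltW m0)//.
by apply: le_trans d8 (ler_norm _).
Qed.

Lemma gradient_bound (x : rV) (t : R) i : 0 < l -> `|x| <= 1 / 4 -> - (1 / 16) <= t < 0 ->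
  `|G i x t| <= (16 * n%:R + 24) * (8 `^ m * l).
Proof.
move=> l0' hx ht.
set K := 8 `^ m * l.
have e8 : 0 < 8 `^ m :> R by rewrite powR_gt0.
have K0 : 0 < K by rewrite mulr_gt0.
(* Since [l] < 1 and (8^m)^(p-1) = 64, the nonlinearity is linearly bounded, which keeps the
   gradient bound proportional to [l]. *)
have K64 : K `^ p <= 64 * K.
  have -> : K `^ p = K `^ (p - 1) * K.
    by rewrite -[X in _ = _ * X]powRr1 ?(ltW K0)// -powRD ?subrK// (gt_eqF K0) implybT.
  rewrite ler_pM2r//.
  have -> : 64 = (8 `^ m) `^ (p - 1) :> R.
    by rewrite -powRrM (mexpE p p1) powR_mulrn ?ler0n//; ring.
  apply: ge0_ler_powR; rewrite ?nnegrE ?(ltW K0) ?(ltW e8)//; first by have := p1; lra.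
  by rewrite /K ger_pMr// ltW.
have hsm (y : rV) (s : R) : `|y - x| <= 1 / 8 -> t - (1 / 8) ^+ 2 <= s <= t -> `|u y s| <= K.
  have e64 : (1 / 8) ^+ 2 = 1 / 64 :> R by field.
  rewrite e64 => hy hs; apply: pointwise_bound; last by lra.
  have : `|y| <= `|y - x| + `|x| by rewrite -[X in `|X| <= _](subrK x) ler_normD.
  by lra.
apply: (@le_trans _ _ ((2 * n%:R + 2) * K / (1 / 8) + 64 * K * (1 / 8))); last first.
  by rewrite le_eqVlt; apply/orP; left; apply/eqP; field.
have e64 : (1 / 8) ^+ 2 = 1 / 64 :> R by field.
apply: (@grad_bound R n u V G H x t (1 / 8) K (64 * K) i (Sol_LinearSol _ _ _ _ _ sol)); [rewrite e64; lra|lra|lra|exact: K0|lra|exact: hsm|].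
move=> y s hy hs; rewrite (sol_eq _ _ _ _ _ sol) addrAC subrr add0r.
have h : `|u y s| <= K by apply: hsm => //; lra.
apply: le_trans K64.
rewrite /pwf normrM (ger0_norm (powR_ge0 _ _)).
have -> : K `^ p = K `^ (p - 1) * K.
  by rewrite -[X in _ = _ * X]powRr1 ?(ltW K0)// -powRD ?subrK// (gt_eqF K0) implybT.
apply: ler_pM; rewrite ?powR_ge0 ?normr_ge0//.
by apply: ge0_ler_powR; rewrite ?nnegrE ?(ltW K0)//; have := p1; lra.
Qed.
End schoen_max.

(** * Control of the error terms *)

Section estimates.
Context {R : realType} {n : nat}.
Notation rV := 'rV[R]_n.
Notation mu := (@lebesgue_rV R n).

(** The (k+1)-st power of z <= e^z, with z = y / (48 (k+1)). *)
Lemma poly_gauss (k : nat) (y : R) : 0 <= y ->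
  y ^+ k.+1 * expR (- (y / 48)) <= (48 * k.+1%:R) ^+ k.+1.
Proof.
move=> y0; have k0 : 0 < 48 * k.+1%:R :> R by rewrite mulr_gt0 ?ltr0n.
rewrite expRN ler_pdivrMr ?expR_gt0//.
have -> : y / 48 = k.+1%:R * (y / (48 * k.+1%:R)).
  by field; rewrite (_ : 1 + k%:R = k.+1%:R) ?pnatr_eq0// -natr1 addrC.
rewrite expRM_natl -exprMn; apply: lerXn2r; rewrite ?nnegrE//.
have E : y = 48 * k.+1%:R * (y / (48 * k.+1%:R)) by rewrite mulrC divfK// gt_eqF.
rewrite [leLHS]E ler_pM2l//; have := expR_ge1Dx (y / (48 * k.+1%:R)).
by apply: le_trans; rewrite lerDr.
Qed.

(** Since 8n <= A^2, the distance to [c] satisfies |x - c|^2 >= A^2 / 4, so the exponent is at least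
    y / 16 with y = A^2 / (t1 - t). It is split as 1/16 = 1/24 + 1/48: the first part gives
    e^(-A^2/24), because t1 - t <= 1, and the second absorbs the powers of 1 / (t1 - t). *)
Lemma gam_small (p t1 A : R) (c x : rV) (t : R) : 1 < p -> `|c| <= 1 / 2 -> 1 <= A -> 8 * n%:R <= A ^+ 2 ->
  t1 - 1 <= t < t1 -> 9 / 16 * A ^+ 2 <= sq 0 x ->
  gam (@bex R n p) t1 c x t * (E0 p * A / (t1 - t)) <=
  E0 p * (48 * n.+1%:R) ^+ n.+1 * (expR (- (A ^+ 2 / 24)) / A ^+ n).
Proof.
move=> p1 hc A1 hA ht hx.
have k0 : 0 < kap p by rewrite invr_gt0; lra.
have A0 : 0 < A by lra.
have tau0 : 0 < t1 - t by lra.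
have E00 : 0 < E0 p by rewrite /E0; lra.
move: (E0 p) E00 => e0 e00.
have sc : sq c x >= A ^+ 2 / 4.
  have h1 : sq 0 x <= 2 * sq c x + 2 * sq 0 c.
    rewrite /sq !mulr_sumr -big_split/=; apply: ler_sum => i _; rewrite !mxE.
    have : 0 <= (x ord0 i - 2 * c ord0 i) ^+ 2 by rewrite sqr_ge0.
    by rewrite -subr_ge0; congr (0 <= _); ring.
  have h2 : sq 0 c <= n%:R * (1 / 4).
    apply: le_trans (sq_norm 0 c) _; rewrite subr0 ler_wpM2l//.
    have -> : 1 / 4 = (1 / 2) ^+ 2 :> R by field.
    by apply: lerXn2r; rewrite ?nnegrE//; lra.
  by lra.
set tau := t1 - t; rewrite -/tau in tau0.
have tau1 : tau <= 1 by rewrite /tau; lra.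
have lt0 : ln tau <= 0 by rewrite ln_le0.
set y := A ^+ 2 / tau.
have y0 : 0 < y by rewrite divr_gt0// exprn_gt0.
have s1 : gam (@bex R n p) t1 c x t <= expR (- (n%:R / 2) * ln tau) * (expR (- (A ^+ 2 / 24)) * expR (- (y / 48))).
  rewrite /gam -/tau -!expRD ler_expR.
  have b1 : @bex R n p * ln tau <= - (n%:R / 2) * ln tau.
    rewrite /bex; have : 4 * kap p * ln tau <= 0.
      by rewrite mulr_ge0_le0//; lra.
    by lra.
  have b2 : y / 16 <= sq c x / (4 * tau).
    have -> : y / 16 = A ^+ 2 / 4 / (4 * tau) by rewrite /y; field; rewrite gt_eqF.
    by rewrite ler_wpM2r// invr_ge0; lra.
  have b3 : A ^+ 2 <= y.
    by rewrite /y ler_peMr ?exprn_ge0 ?(ltW A0)// -[leLHS]invr1 lef_pV2 ?posrE.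
  by lra.
have s2 : expR (- (n%:R / 2) * ln tau) <= tau ^- n.
  rewrite -[X in _ <= X](@lnK R) ?posrE ?invr_gt0 ?exprn_gt0// ler_expR lnV ?posrE ?exprn_gt0// lnXn//.
  rewrite -mulr_natl; have : 0 <= n%:R * - ln tau by rewrite mulr_ge0//; lra.
  by lra.
have A1' k : 1 <= A ^+ k by rewrite exprn_ege1.
have An0 k : 0 < A ^+ k by rewrite exprn_gt0.
apply: (@le_trans _ _ (tau ^- n * (expR (- (A ^+ 2 / 24)) * expR (- (y / 48))) * (e0 * A / tau))).
  apply: ler_wpM2r; first by apply: divr_ge0; [apply: mulr_ge0|]; exact: ltW.
  by apply: le_trans s1 _; rewrite ler_wpM2r// mulr_ge0 ?expR_ge0.
have -> : e0 * (48 * n.+1%:R) ^+ n.+1 * (expR (- (A ^+ 2 / 24)) / A ^+ n) =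
  (e0 * expR (- (A ^+ 2 / 24)) / A ^+ n) * (48 * n.+1%:R) ^+ n.+1 by ring.
have -> : tau ^- n * (expR (- (A ^+ 2 / 24)) * expR (- (y / 48))) * (e0 * A / tau) =
  (e0 * expR (- (A ^+ 2 / 24)) / A ^+ n) * (A ^+ n * A / tau ^+ n / tau * expR (- (y / 48))).
  by field; rewrite !gt_eqF// ?exprn_gt0.
apply: ler_wpM2l; first by apply: divr_ge0; [apply: mulr_ge0; [exact: ltW|exact: expR_ge0]|exact: ltW].
apply: le_trans _ (poly_gauss n y (ltW y0)).
apply: ler_wpM2r; first exact: expR_ge0.
rewrite /y expr_div_n -exprSr -mulrA -invfM -exprSr ler_wpM2r ?invr_ge0 ?exprn_ge0 ?(ltW tau0)//.
by rewrite -exprM ler_weXn2l// mul2n -addnn leq_addr.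
Qed.

Lemma measurable_super (f : rV -> R) (r : R) : continuous f -> measurable [set x | r < `|f x|].
Proof.
move=> cf; apply: open_measurable_rV.
apply: (@open_comp _ _ (fun x => `|f x|) [set s : R | r < s]); last exact: open_gt.
by have h := cA f cf => x _; exact: h.
Qed.

(** The sum over k of 2^a 2^((a-q)k), convergent for a < q. *)
Definition wC (q a : R) : R := 2 `^ a / (1 - 2 `^ (a - q)).

(* Decompose along the levels [M * 2 ^ k]. *)
Lemma weak_moment (q a M : R) (f phi : rV -> R) : continuous f -> Cc phi ->
  (forall x, 0 <= phi x <= 1) -> 0 < M -> 0 < a < q ->
  (forall r, 0 < r -> (mu [set x | (r < `|f x|)%R] <= ((M / r) `^ q)%:E)%E) ->
  I (fun x => phi x * `|f x| `^ a) <= M `^ a * (I phi + wC q a).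
Proof.
move=> cf cphi hphi M0 aq hw.
have [N0 sphi] := cphi.2.
have [C C0 hC] := cont_bounded_cube _ N0 cf.
(* Finitely many levels suffice because [f] is bounded on the support of [phi]; the final constant
   does not depend on their number. *)
have [N hN] : exists N, C <= M * 2 ^+ N.
  exists (Num.bound (C / M)); rewrite mulrC -ler_pdivrMr//.
  have h1 : 0 <= C / M by rewrite divr_ge0// ltW.
  apply: le_trans (ltW (archi_boundP h1)) _.
  by rewrite -natrX ler_nat ltnW// ltn_expl.
pose E k := [set x : rV | M * 2 ^+ k < `|f x|].
pose ck k : R := 2 `^ (a * k.+1%:R).
have ck0 k : 0 <= ck k by exact: powR_ge0.
have Ma0 : 0 < M `^ a by rewrite powR_gt0.
have lev K x : `|f x| <= M * 2 ^+ K -> `|f x| `^ a <= M `^ a * (1 + \sum_(k < K) ck k * \1_(E k) x).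
  elim: K => [|K IH] h.
    rewrite big_ord0 addr0 mulr1; apply: ge0_ler_powR; rewrite ?nnegrE ?(ltW M0)//; first lra.
    by rewrite expr0 mulr1 in h.
  rewrite big_ord_recr /=; have [h2|h2] := leP `|f x| (M * 2 ^+ K).
    apply: le_trans (IH h2) _; rewrite ler_pM2l// lerD2l lerDl mulr_ge0//.
  rewrite [\1_(E K) x]indicE mem_set// mulr1.
  apply: (@le_trans _ _ (M `^ a * ck K)).
    rewrite /ck mulrC (mulrC a) powRrM powR_mulrn ?ler0n// -powRM ?exprn_ge0 ?(ltW M0)//.
    by rewrite mulrC; apply: ge0_ler_powR; rewrite ?nnegrE ?mulr_ge0 ?exprn_ge0 ?(ltW M0)//; lra.
  rewrite ler_pM2l// addrA lerDr addr_ge0// sumr_ge0// => k _.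
  by rewrite mulr_ge0// indicE.
have mE k : measurable (E k) by exact: measurable_super.
have Cf : Cc (fun x => phi x * `|f x| `^ a).
  apply: CcMl => //; apply: (ccomp f (fun r : R => `|r| `^ a)) => //.
  by apply: cont_abs_powR; lra.
pose g (x : rV) : \bar R := ((M `^ a)%:E * ((phi x)%:E + \sum_(k < N) ((ck k)%:E * (\1_(E k) x)%:E)))%E.
have Ifin (h : rV -> R) : Cc h -> (I h)%:E = (\int[mu]_x (h x)%:E)%E.
  by move=> ch; rewrite /I /Rintegral fineK//; exact: integrable_fin_num (Cc_integrable _ ch).
have mI k : measurable_fun setT (fun x : rV => (\1_(E k) x)%:E : \bar R).
  by apply/measurable_EFinP; exact: measurable_indic.
have m1 : measurable_fun setT (fun x : rV => (phi x)%:E).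
  by apply/measurable_EFinP; apply: continuous_measurable_rV; exact: cphi.1.
have p0 x : 0 <= phi x by have /andP[] := hphi x.
have i0 k x : (0 <= (ck k)%:E * (\1_(E k) x)%:E :> \bar R)%E.
  by rewrite mule_ge0// lee_fin// indicE.
have m2 : measurable_fun setT (fun x : rV => (\sum_(k < N) ((ck k)%:E * (\1_(E k) x)%:E))%E).
  by apply: emeasurable_sum => k; apply: measurable_funeM.
have : ((I (fun x => phi x * `|f x| `^ a))%:E <= \int[mu]_x g x)%E.
  rewrite Ifin//; apply: ge0_le_integral => //.
  - by move=> x _; rewrite lee_fin mulr_ge0 ?powR_ge0.
  - by apply/measurable_EFinP; apply: continuous_measurable_rV; exact: Cf.1.
  - by apply: measurable_funeM; exact: emeasurable_funD.
  - move=> x _; rewrite /g.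
    under eq_bigr do rewrite -EFinM.
    rewrite sumEFin -EFinD -EFinM lee_fin.
    have s0 : 0 <= \sum_(k < N) ck k * \1_(E k) x.
      by rewrite sumr_ge0// => k _; rewrite mulr_ge0// indicE.
    have [px|px] := eqVneq (phi x) 0.
      by rewrite px mul0r add0r mulr_ge0// ltW.
    have hx : `|f x| <= M * 2 ^+ N.
      apply: le_trans hN; apply: hC; rewrite leNgt; apply/negP => /sphi h.
      by rewrite h eqxx in px.
    apply: le_trans (_ : phi x * (M `^ a * (1 + \sum_(k < N) ck k * \1_(E k) x)) <= _).
      by rewrite ler_wpM2l// lev.
    rewrite mulrCA ler_pM2l// mulrDr mulr1 lerD2l ler_piMl//.
    by have /andP[] := hphi x.
rewrite ge0_integralZl_EFin//; last 3 first.
- by move=> x _; rewrite adde_ge0// ?lee_fin// sume_ge0.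
- exact: emeasurable_funD.
- exact: ltW.
rewrite ge0_integralD//; last 2 first.
- by move=> x _; rewrite lee_fin.
- by move=> x _; rewrite sume_ge0.
rewrite -Ifin// ge0_integral_sum//; last by move=> k; apply: measurable_funeM.
have hk k : (\int[mu]_x ((ck k)%:E * (\1_(E k) x)%:E) <= (2 `^ a * (2 `^ (a - q)) ^+ k)%:E)%E.
  rewrite ge0_integralZl_EFin// ?integral_indic// ?setIT.
  have e0 : 0 < M * 2 ^+ k by rewrite mulr_gt0// exprn_gt0.
  apply: (@le_trans _ _ ((ck k)%:E * ((M / (M * 2 ^+ k)) `^ q)%:E)%E).
    by rewrite lee_pmul2l// ?fin_numE// ?hw// lte_fin powR_gt0.
  rewrite -EFinM lee_fin le_eqVlt; apply/orP; left; apply/eqP.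
  have -> : M / (M * 2 ^+ k) = (2 ^+ k)^-1 by field; rewrite !gt_eqF//= exprn_gt0.
  have e2 : 2 ^+ k = 2 `^ k%:R :> R by rewrite powR_mulrn// ler0n.
  rewrite e2 -powRN -powRrM -[(2 `^ (a - q)) ^+ k]powR_mulrn ?powR_ge0// -powRrM /ck.
  rewrite -!powRD ?pnatr_eq0 ?implybT//; congr powR; rewrite -natr1; ring.
move=> h; rewrite -lee_fin; apply: le_trans h _.
rewrite EFinM lee_pmul2l// ?lte_fin// EFinD leeD2l//.
apply: (@le_trans _ _ (\sum_(k < N) (2 `^ a * (2 `^ (a - q)) ^+ k)%:E)%E).
  by apply: lee_sum => k _; exact: hk.
rewrite sumEFin lee_fin -mulr_sumr /wC ler_wpM2l ?powR_ge0//.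
set rho := 2 `^ (a - q).
have r1 : rho < 1.
  have rE : rho = expR ((a - q) * ln 2) by rewrite /rho /powR gt_eqF.
  rewrite rE expR_lt1 nmulr_rlt0 ?ln_gt0//; lra.
have := subrX1 rho N; have r0 : 0 <= rho ^+ N by rewrite exprn_ge0// powR_ge0.
move=> hs; rewrite -[leRHS]mul1r ler_pdivlMr ?subr_gt0//.
by set S := \sum_(i < N) _ in hs *; lra.
Qed.
End estimates.

(** * Choice of the parameters *)

Section scaled.
Context {R : realType} {n : nat}.
Notation rV := 'rV[R]_n.
Notation mu := (@lebesgue_rV R n).

Lemma wC_ge0 (q a : R) : a < q -> 0 <= wC q a.
Proof.
move=> aq; rewrite divr_ge0 ?powR_ge0// subr_ge0 -[leRHS](powRr0 2).
by apply: ler_powR; lra.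
Qed.

(** The bound on u^2 follows from that on |u|^(p+1) through s^2 <= 1 + |s|^(p+1). The factor A^n is
    the volume of the ball. *)
Lemma moments_bound (p q M A : R) (f : rV -> R) : 1 < p -> p + 1 < q -> 1 < M -> 1 <= A -> continuous f ->
  (forall r, 0 < r -> (mu [set x | (r < `|f x|)%R] <= ((M / r) `^ q)%:E)%E) ->
  I (fun x => cut 0 (4 * A) x * pwF p (f x)) <=
    M `^ (p + 1) * A ^+ n * (2 * 4 ^+ n * I (cut (0 : rV) 1) + wC q (p + 1)) /\
  I (fun x => cut 0 (4 * A) x * f x ^+ 2) <=
    M `^ (p + 1) * A ^+ n * (2 * 4 ^+ n * I (cut (0 : rV) 1) + wC q (p + 1)).
Proof.
move=> p1 pq M1 A1 cf hw.
have A40 : 0 < 4 * A by lra.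
have Cz := Cc_cut 0 (4 * A) A40 : Cc (cut (0 : rV) (4 * A)).
have h1 : I (fun x => cut 0 (4 * A) x * pwF p (f x)) <= M `^ (p + 1) * (I (cut (0 : rV) (4 * A)) + wC q (p + 1)).
  apply: weak_moment => //; try lra.
  by move=> x; rewrite cut_ge0 cut_le1.
have h2 : I (fun x => cut 0 (4 * A) x * f x ^+ 2) <=
    I (cut (0 : rV) (4 * A)) + I (fun x => cut 0 (4 * A) x * pwF p (f x)).
  have C2 : Cc (fun x => cut (0 : rV) (4 * A) x * pwF p (f x)).
    by apply: CcMl => //; apply: (ccomp f (pwF p)) => //; exact: pwF_cont.
  rewrite -I_D//; apply: I_le => [| |x].
  - by apply: CcMl => //; exact: cX.
  - exact: CcD.
  - rewrite -[X in _ <= X + _]mulr1 -mulrDr; apply: ler_wpM2l; first exact: cut_ge0.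
    rewrite /pwF; have f0 := normr_ge0 (f x); rewrite -real_normK ?num_real//.
    have [fl|fl] := leP `|f x| 1.
      have : `|f x| ^+ 2 <= 1 by rewrite exprn_ile1.
      by have := powR_ge0 `|f x| (p + 1); lra.
    have : `|f x| ^+ 2 <= `|f x| `^ (p + 1).
      by rewrite -powR_mulrn//; apply: ler_powR; [exact: ltW|lra].
    by lra.
rewrite I_cut// exprMn in h1 h2.
have i0 := @I_cut_gt0 R n.
have w0 := wC_ge0 q (p + 1) pq.
have An1 : 1 <= A ^+ n by rewrite exprn_ege1.
have M1' : 1 <= M `^ (p + 1) by rewrite -[leLHS](powRr0 M); apply: ler_powR; lra.
have f40 : 0 < 4 ^+ n :> R by rewrite exprn_gt0.
set J := 4 ^+ n * A ^+ n * I (cut (0 : rV) 1) in h1 h2.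
have J0 : 0 <= J by rewrite !mulr_ge0 ?exprn_ge0 ?(ltW i0)//; lra.
have JM : J <= M `^ (p + 1) * J by rewrite ler_peMl.
have wA : wC q (p + 1) <= A ^+ n * wC q (p + 1) by rewrite ler_peMl.
have MwA : M `^ (p + 1) * wC q (p + 1) <= M `^ (p + 1) * (A ^+ n * wC q (p + 1)).
  by rewrite ler_wpM2l// powR_ge0.
have -> : M `^ (p + 1) * A ^+ n * (2 * 4 ^+ n * I (cut (0 : rV) 1) + wC q (p + 1)) =
   2 * (M `^ (p + 1) * J) + M `^ (p + 1) * (A ^+ n * wC q (p + 1)) by rewrite /J; ring.
by split; lra.
Qed.

Theorem scaled_bound (p q : R) : 1 < p -> p + 1 < q ->
  exists C e0 : R, [/\ 0 < C, 0 < e0, e0 <= 1 &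
  forall (u V : rV -> R -> R) (G H : 'I_n -> rV -> R -> R) (M e A : R) (S : R -> R),
    Sol p u V G H -> 1 < M -> 0 < e < e0 -> 0 < A -> 24 * ln (M `^ (p + 1) / e) < A ^+ 2 ->
    (forall t, -2 < t < 0 -> forall r, 0 < r ->
      (mu [set x | (r < `|u x t|)%R] <= ((M / r) `^ q)%:E)%E) ->
    (forall t : R, -1 < t < - (1 / 2) -> is_derive t 1 S (I (fun x => cut 0 A x * pwF p (u x t)))) ->
    (forall t, -1 < t < - (1 / 2) -> 0 <= S t <= e) ->
    forall (x : rV) (t : R), `|x| <= 1 / 4 -> - (1 / 16) <= t < 0 ->
      `|u x t| <= C * e `^ (1 / (p + 1) ^+ 2) /\
      forall i, `|G i x t| <= C * e `^ (1 / (p + 1) ^+ 2)].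
Proof.
move=> p1 pq.
have p10 : 0 < p + 1 by lra.
have n0 : 0 <= n%:R :> R by exact: ler0n.
have [CG CG0 hCG] := @gauss_bound R n.
have cp0 : 0 < cp p by rewrite /cp divr_gt0//; lra.
have kp0 : 0 < kap p by rewrite invr_gt0; lra.
have : 0 <= E0 p by rewrite /E0; lra.
set eE := E0 p => E00; pose CK : R := eE * (48 * n.+1%:R) ^+ n.+1.
have CK0 : 0 <= CK.
  by apply: mulr_ge0.
pose CQ : R := 2 * 4 ^+ n * I (cut (0 : rV) 1) + wC q (p + 1).
have CQ0 : 0 <= CQ.
  apply: addr_ge0; last exact: wC_ge0.
  apply: mulr_ge0; last exact: ltW I_cut_gt0.
  by apply: mulr_ge0; [lra|apply: exprn_ge0; lra].
pose X8 : R := expR (`|@bex R n p| * ln 4).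
have X80 : 0 < X8 by exact: expR_gt0.
have [K4 K40 k2E] : exists2 K4 : R, 0 <= K4 & forall k1 Q, k2 k1 Q = K4 * (k1 * Q).
  exists 10000; first exact: ler0n.
  by move=> a b; rewrite /k2.
pose CB : R := CG + 10 * X8 + 6 * (K4 * (CK * CQ)).
have KQ0 : 0 <= CK * CQ by exact: mulr_ge0.
have KKQ0 : 0 <= K4 * (CK * CQ) by exact: mulr_ge0.
have CB0 : 0 < CB by rewrite /CB; lra.
pose CY : R := 2 / cp p * (6 * CB + cp p * CG + 2 * (CB / cp p)).
have CY0 : 0 < CY.
  apply: mulr_gt0; first by apply: divr_gt0 => //; lra.
  have : 0 < cp p * CG by exact: mulr_gt0.
  have : 0 < CB / cp p by exact: divr_gt0.
  by lra.
have Cs0 := @lower_cst_gt0 R n p p1.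
have b0 : 0 < beta p by rewrite powR_gt0.
pose CL : R := beta p * (CY / @lower_cst R n p) `^ (p + 1)^-1.
have CL0 : 0 < CL by apply: mulr_gt0 => //; apply: powR_gt0; exact: divr_gt0.
pose C : R := (16 * n%:R + 24) * (8 `^ (mexp p) * CL).
have e8 : 1 <= 8 `^ (mexp p).
  by rewrite -[leLHS](powRr0 8); apply: ler_powR; [lra|exact: ltW (mexp_gt0 p p1)].
(* Three demands on e: to be less than 1, to force A^2 >= 8n + 1 through the logarithm, and to make
   the final bound [l] less than 1. *)
pose e0 : R := Num.min 1 (Num.min (expR (- ((8 * n%:R + 1) / 24))) (CL `^ (- (p + 1) ^+ 2))).
have e00 : 0 < e0 by rewrite !lt_min ltr01 expR_gt0 powR_gt0.
have C80 : 0 < 8 `^ (mexp p) * CL by apply: mulr_gt0 => //; lra.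
exists C, e0; split => //.
- by apply: mulr_gt0 => //; lra.
- by rewrite ge_min lexx.
move=> u V G H M e A S sol M1 /andP[ep ee0] A0 hA hw hS hSe.
have {ee0} [e1 e2 e3] : [/\ e < 1, e < expR (- ((8 * n%:R + 1) / 24)) & e < CL `^ (- (p + 1) ^+ 2)].
  by move: ee0; rewrite !lt_min => /and3P[].
have Mp1 : 1 <= M `^ (p + 1) by rewrite -[leLHS](powRr0 M); apply: ler_powR; lra.
have Mp0 : 0 < M `^ (p + 1) by lra.
have hAn : 8 * n%:R + 1 <= A ^+ 2.
  have : - ln e <= ln (M `^ (p + 1) / e).
    rewrite -lnV ?posrE// ler_ln ?posrE ?invr_gt0 ?divr_gt0//.
    by rewrite -[leLHS]mul1r ler_wpM2r// invr_ge0 ltW.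
  have : ln e < - ((8 * n%:R + 1) / 24) by rewrite -[ltRHS]expRK ltr_ln ?posrE ?expR_gt0.
  by lra.
have A1 : 1 <= A by rewrite -(@expr_ge1 R 2)//; [lra|exact: ltW].
pose eps : R := e `^ (p + 1)^-1.
have eps0 : 0 < eps by exact: powR_gt0.
have eps1 : eps <= 1.
  rewrite -[leRHS](powRr0 e); apply: ger_powR; last by rewrite invr_ge0 ltW.
  by rewrite ep ltW.
have epsE : e = eps `^ (p + 1) by rewrite /eps -powRrM mulVf ?gt_eqF// powRr1// ltW.
have ee2 : e <= eps ^+ 2.
  rewrite epsE -powR_mulrn ?(ltW eps0)//; apply: ger_powR; last by clear -p1; lra.
  by rewrite eps0.
have epsm : eps `^ (1 - p) * e = eps ^+ 2.
  rewrite epsE -powRD; last by rewrite (gt_eqF eps0) implybT.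
  by rewrite (_ : 1 - p + (p + 1) = 2%:R) ?powR_mulrn ?(ltW eps0)//; ring.
have eps2 : eps ^+ 2 <= eps by rewrite expr2 ger_pMr.
have epp : 0 < eps ^+ 2 by exact: exprn_gt0.
pose k1 : R := CK * (expR (- (A ^+ 2 / 24)) / A ^+ n).
pose Q : R := M `^ (p + 1) * A ^+ n * CQ.
have An0 : 0 < A ^+ n by exact: exprn_gt0.
have k10 : 0 <= k1 by apply: mulr_ge0 => //; apply: divr_ge0; [exact: expR_ge0|exact: ltW].
have Q0 : 0 <= Q by apply: mulr_ge0 => //; apply: mulr_ge0; exact: ltW.
have k1Q : k1 * Q <= CK * CQ * e.
  have -> : k1 * Q = CK * CQ * (M `^ (p + 1) * expR (- (A ^+ 2 / 24))).
    by rewrite /k1 /Q; field; rewrite gt_eqF.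
  apply: ler_wpM2l => //.
  have lE1 : ln (M `^ (p + 1) / e) = ln (M `^ (p + 1)) - ln e.
    by rewrite lnM ?posrE ?invr_gt0// lnV ?posrE.
  have lE2 : ln ((M `^ (p + 1))^-1 * e) = - ln (M `^ (p + 1)) + ln e.
    by rewrite lnM ?posrE ?invr_gt0// lnV ?posrE.
  have me0 : 0 < (M `^ (p + 1))^-1 * e by rewrite mulr_gt0 ?invr_gt0.
  rewrite -ler_pdivlMl// -[leRHS](@lnK R) ?posrE// ler_expR lE2.
  by move: hA; rewrite lE1; clear; lra.
have hq t : -2 < t < 0 -> I (fun x => cut 0 (4 * A) x * pwF p (u x t)) <= Q /\
    I (fun x => cut 0 (4 * A) x * u x t ^+ 2) <= Q.
  move=> ht; apply: moments_bound => //; last exact: hw.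
  exact: cslice1 (sol_cu _ _ _ _ _ sol).
pose Y : R := CY * eps.
have Y0 : 0 < Y by exact: mulr_gt0.
have hY (x1 : rV) (t1 h : R) : `|x1| <= 1 / 2 -> - (1 / 4) < t1 < 0 -> 0 < h <= 1 / 4 ->
  exists2 xi, t1 - h < xi < t1 - h / 4 & (t1 - xi) * A2 p u (cut (0 : rV) A) t1 x1 xi <= Y.
  move=> hx1 ht1 hh.
  have hg (x : rV) (t : R) : t1 - 1 <= t < t1 -> 9 / 16 * A ^+ 2 <= sq 0 x <= A ^+ 2 ->
      gam (@bex R n p) t1 x1 x t * (E0 p * A / (t1 - t)) <= k1.
    move=> ht /andP[hx _]; apply: gam_small => //.
    by clear -hAn; lra.
  have hX (x : rV) : sq 0 x <= A ^+ 2 -> sq x1 x <= 4 * A ^+ 2.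
    move=> hx.
    have h1 : sq x1 x <= 2 * sq 0 x + 2 * sq 0 x1.
      rewrite /sq !mulr_sumr -big_split/=; apply: ler_sum => i _; rewrite !mxE.
      have : 0 <= (x ord0 i + x1 ord0 i) ^+ 2 by rewrite sqr_ge0.
      by rewrite -subr_ge0; congr (0 <= _); ring.
    have h2 : sq 0 x1 <= n%:R * (1 / 4).
      apply: le_trans (sq_norm 0 x1) _; rewrite subr0; apply: ler_wpM2l => //.
      have -> : 1 / 4 = (1 / 2) ^+ 2 :> R by field.
      by apply: lerXn2r; rewrite ?nnegrE//; lra.
    by clear -h1 h2 hx hAn n0; lra.
  have hCG' (tau : R) : 0 < tau ->
      I (fun x => cut (0 : rV) A x * expR (- (n%:R / 2) * ln tau - sq x1 x * (4 * tau)^-1)) <= CG.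
    move=> t0; apply: hCG => //; first exact: Cc_cut.
    by move=> x; rewrite cut_ge0 cut_le1.
  have hm : 0 < cp p * eps <= cp p by rewrite mulr_gt0//= ger_pMr.
  have [xi hxi hYx] := @energy_small R n p u V G H p1 sol t1 x1 A k1 Q ht1 A1 k10 Q0 hg hX
    (fun t ht => (hq t ht).1) (fun t ht => (hq t ht).2) CG CG0 hCG' S e eps (cp p * eps) h
    (ltW ep) eps0 hm hh hS hSe.
  exists xi => //; apply: le_trans hYx _.
  rewrite k2E epsm -/X8.
  set B := eps ^+ 2 * CG + 8 * X8 * eps ^+ 2 + 2 * X8 * e + 6 * (K4 * (k1 * Q)).
  have hB : B <= CB * eps ^+ 2.
    have i1 : X8 * e <= X8 * eps ^+ 2 by apply: ler_wpM2l; [exact: ltW|].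
    have i2 : K4 * (k1 * Q) <= K4 * (CK * CQ) * eps ^+ 2.
      rewrite -mulrA; apply: ler_wpM2l => //; apply: le_trans k1Q _.
      by apply: ler_wpM2l.
    have -> : CB * eps ^+ 2 = eps ^+ 2 * CG + 8 * (X8 * eps ^+ 2) + 2 * (X8 * eps ^+ 2) + 6 * (K4 * (CK * CQ) * eps ^+ 2).
      by rewrite /CB; ring.
    by clear -i1 i2; rewrite /B; lra.
  have -> : Y = 2 / cp p * (6 * (CB * eps) + cp p * eps * CG + 2 * (CB * eps ^+ 2 / (cp p * eps))).
    by rewrite /Y /CY; field; rewrite !gt_eqF.
  apply: ler_wpM2l; first by apply: divr_ge0; [exact: ler0n|exact: ltW].
  have i3 : CB * eps ^+ 2 <= CB * eps by apply: ler_wpM2l => //; exact: ltW.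
  have i4 : B / (cp p * eps) <= CB * eps ^+ 2 / (cp p * eps).
    by apply: ler_wpM2r => //; rewrite invr_ge0 ltW//; case/andP: hm.
  have -> : 2 * B / (cp p * eps) = 2 * (B / (cp p * eps)) by rewrite mulrA.
  by clear -i3 i4 hB; lra.
set z := e `^ (1 / (p + 1) ^+ 2).
have z0 : 0 < z by exact: powR_gt0.
have lE : beta p * (Y / @lower_cst R n p) `^ (p + 1)^-1 = CL * z.
  have E : Y / @lower_cst R n p = CY / @lower_cst R n p * eps by rewrite /Y; ring.
  rewrite E powRM ?(ltW eps0)//; last by apply: divr_ge0; exact: ltW.
  rewrite /CL -[RHS]mulrA; congr (_ * (_ * _)); rewrite /eps /z -powRrM; congr powR.
  by field; rewrite gt_eqF.
have l1 : beta p * (Y / @lower_cst R n p) `^ (p + 1)^-1 < 1.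
  rewrite lE.
  have zz : z < CL^-1.
    have -> : CL^-1 = (CL `^ (- (p + 1) ^+ 2)) `^ (1 / (p + 1) ^+ 2).
      rewrite -powRrM (_ : - (p + 1) ^+ 2 * (1 / (p + 1) ^+ 2) = -1) ?powR_inv1 ?(ltW CL0)//.
      by field; rewrite gt_eqF.
    apply: gt0_ltr_powR; rewrite ?nnegrE ?powR_ge0 ?(ltW ep)//.
    by apply: divr_gt0 => //; exact: exprn_gt0.
  have : CL * z < CL * CL^-1 by rewrite ltr_pM2l.
  by rewrite divff ?gt_eqF.
have hAA : 2 * n%:R <= A ^+ 2 by clear -hAn n0; lra.
move=> x t hx ht.
have CE : C * z = (16 * n%:R + 24) * (8 `^ mexp p * (CL * z)) by rewrite /C; ring.
rewrite CE -lE; split.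
  have hx8 : `|x| <= 3 / 8 by clear -hx; lra.
  have ht8 : - (5 / 64) <= t < 0 by clear -ht; lra.
  have := @pointwise_bound R n p u V G H p1 sol A Y A0 hAA (ltW Y0) hY l1 x t hx8 ht8.
  have w0 : 0 <= 8 `^ mexp p * (CL * z).
    by apply: mulr_ge0; [exact: powR_ge0|apply: mulr_ge0; exact: ltW].
  by move=> /le_trans; apply; rewrite lE; apply: ler_peMl => //; clear -n0; lra.
move=> i; apply: (@gradient_bound R n p u V G H p1 sol A Y A0 hAA (ltW Y0) hY l1 x t i) => //.
by rewrite lE; exact: mulr_gt0.
Qed.
End scaled.

(** * Rescaling *)

Section rescale.
Context {R : realType} {n : nat}.
Notation rV := 'rV[R]_n.

Lemma strip_comp {T : topologicalType} (F : rV * R -> R) (f : T -> rV * R) :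
  {within strip, continuous F} -> continuous f -> (forall w, strip (f w)) ->
  continuous (fun w => F (f w)).
Proof.
move=> /subspace_continuousP cF cf sf w.
apply: (cvg_comp f F _ (cF _ (sf w))).
move=> B hB; have := cf w _ hB; rewrite /nbhs/=; apply: filterS => z; apply; exact: sf.
Qed.

(** At an interior time the restriction on increments is void for small ones, so the derivative is
    two-sided. *)
Lemma is_derive_time (u : rV -> R -> R) (x : rV) (t : R) : -1 < t < 0 -> time_derivable u x t ->
  is_derive t 1 (u x) (time_derivative u x t).
Proof.
move=> ht h; apply: is_derive_quot => B hB.
have hw : \forall h \near (0 : R)^', (t + h \in `]-1, 0]) -> B (time_quotient u x t h) by exact: (h B hB).
change (\forall h \near (0 : R)^', B (h^-1 * (u x (h + t) - u x t))).
have hD : \forall h \near (0 : R)^', t + h \in `]-1, 0].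
  have : \forall h \near (0 : R)^', `|h| < Num.min (t + 1) (- t).
    by apply: (@dnbhs0_lt R R); rewrite lt_min; lra.
  apply: filterS => h'; rewrite lt_min !ltr_norml => hh.
  by rewrite in_itv/=; lra.
near=> h'.
have h1 : t + h' \in `]-1, 0] by near: h'.
have : (t + h' \in `]-1, 0]) -> B (time_quotient u x t h') by near: h'.
by move=> /(_ h1); rewrite /time_quotient (addrC t).
Unshelve. all: by end_near.
Qed.

Lemma d_affine (f : rV -> R) (c a : R) (b x : rV) i : is_derive (c *: x + b) (ev i) f a ->
  is_derive x (ev i) (fun y => f (c *: y + b)) (c * a).
Proof.
move=> df; apply: d_at_line.
rewrite (_ : (fun _ => _) = fun r : R => f ((c * r) *: ev i + (c *: x + b))); last first.
  by apply/funext => r; rewrite scalerDr scalerA addrA.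
have d1 : is_derive (0 : R) 1 (fun r : R => c * r) c.
  by refine (dE (dZ c (is_derive_id _ _)) _); rewrite mulr1.
have d2 : is_derive (c * (0 : R)) 1 (fun r : R => f (r *: ev i + (c *: x + b))) a.
  by apply: d_line; rewrite mulr0 scale0r add0r.
by refine (dE (dcomp d1 d2) _); rewrite mulrC.
Qed.

Variables (p : R) (u : rV -> R -> R).
Hypothesis p1 : 1 < p.
Hypothesis cs : classical_solution p u.
Variables (x0 : rV) (t0 d : R).
Hypothesis ht0 : - (1 / 16) < t0.
Hypothesis ht0' : t0 <= 0.
Hypothesis d0 : 0 < d.
Hypothesis d14 : d < 1 / 4.

Let d2 : d ^+ 2 < 1 / 16.
Proof.
have -> : 1 / 16 = (1 / 4) ^+ 2 :> R by field.
by apply: ltrXn2r => //; rewrite ?nnegrE; have := d0; lra.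
Qed.
Let d20 : 0 < d ^+ 2. Proof. exact: exprn_gt0. Qed.

(* Clamping keeps the rescaled time in the domain of [u] and makes the rescaled
   solution jointly continuous on the whole space. *)
Definition rtime (s : R) : R := t0 + d ^+ 2 * clamp (-2) 0 s.
Notation m := (mexp p).
Notation dm := (d `^ m).
Definition ru (y : rV) (s : R) : R := dm * u (d *: y + x0) (rtime s).
Definition rV' (y : rV) (s : R) : R := dm * d ^+ 2 * time_derivative u (d *: y + x0) (rtime s).
Definition rG i (y : rV) (s : R) : R := dm * d * partial i (u^~ (rtime s)) (d *: y + x0).
Definition rH i (y : rV) (s : R) : R :=
  dm * d ^+ 2 * partial i (partial i (u^~ (rtime s))) (d *: y + x0).

Lemma rtime_in s : rtime s \in `]-1, 0].
Proof.
have : -2 <= clamp (-2) 0 s <= 0 by apply: clamp_in; lra.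
rewrite in_itv/= /rtime => hc.
have h1 : d ^+ 2 * clamp (-2) 0 s <= 0 by rewrite mulr_ge0_le0 ?(ltW d20)//; lra.
have h2 : d ^+ 2 * (- clamp (-2) 0 s) <= d ^+ 2 * 2 by rewrite ler_wpM2l ?(ltW d20)//; lra.
by have := d2; have := ht0; have := ht0'; lra.
Qed.

Lemma rtimeE s : -2 <= s <= 0 -> rtime s = t0 + d ^+ 2 * s.
Proof. by move=> h; rewrite /rtime clampE. Qed.

Let cmap : continuous (fun z : rV * R => (d *: z.1 + x0, rtime z.2)).
Proof.
apply: cpair.
  move=> z; apply: (@continuous_comp _ _ _ (fun z : rV * R => z.1) (fun x : rV => d *: x + x0)).
    exact: cvg_fst.
  exact: cont_affine.
apply: cD; first exact: cC.
apply: cM; first exact: cC.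
apply: (@ccomp _ _ _ (fun z : rV * R => z.2) (clamp (-2) 0)); last exact: clamp_continuous.
by move=> z; exact: cvg_snd.
Qed.

Let cstrip (F : rV * R -> R) (c : R) : {within strip, continuous F} ->
  continuous (fun z : rV * R => c * F (d *: z.1 + x0, rtime z.2)).
Proof.
move=> cF; apply: cM; first exact: cC.
apply: (strip_comp F _ cF cmap) => w; split => //=; exact: rtime_in.
Qed.

Lemma ru_powE (x : R) : pwf p (dm * x) = dm * d ^+ 2 * pwf p x.
Proof.
have dm0 : 0 < dm by exact: powR_gt0.
rewrite /pwf normrM gtr0_norm// powRM ?(ltW dm0)//.
have -> : dm `^ (p - 1) = d ^+ 2.
  by rewrite -powRrM mexpE// powR_mulrn ?(ltW d0).
by ring.
Qed.

(** The time derivative is claimed where the clamp is inactive. The equation holds at every time, as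
    an identity between values of [u] and its derivatives at the clamped time. *)
Lemma Sol_ru : Sol p ru rV' rG rH.
Proof.
have [[cu hG hH [hT cT]] heq] := cs.
split.
- exact: (cstrip (fun z => u z.1 z.2)).
- exact: (cstrip (fun z => time_derivative u z.1 z.2)).
- by move=> i; exact: (cstrip (fun z => partial i (u^~ z.2) z.1) _ (hG i).2).
- by move=> i; exact: (cstrip (fun z => partial i (partial i (u^~ z.2)) z.1) _ (hH i i).2).
- move=> i x t; rewrite /rG -mulrA; apply: dZ; apply: (d_affine (u^~ (rtime t))).
  by apply/derivableP; apply: (hG i).1; exact: rtime_in.
- move=> i x t; rewrite /rH (_ : dm * d ^+ 2 * _ = dm * d * (d * partial i (partial i (u^~ (rtime t))) (d *: x + x0))); last by ring.
  apply: dZ; apply: (d_affine (partial i (u^~ (rtime t)))).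
  by apply/derivableP; apply: (hH i i).1; exact: rtime_in.
- move=> x t ht; rewrite /rV' -mulrA; apply: dZ.
  have ht' : -2 <= t <= 0 by lra.
  apply: (@near_eq_is_derive _ _ _ (fun s => u (d *: x + x0) (t0 + d ^+ 2 * s))).
    near=> s; rewrite rtimeE//.
    by apply/andP; split; apply: ltW; near: s; [apply: lt_nbhsr|apply: lt_nbhsl]; lra.
  have dt : is_derive (t0 + d ^+ 2 * t) 1 (u (d *: x + x0)) (time_derivative u (d *: x + x0) (rtime t)).
    rewrite rtimeE//; have := rtime_in t; rewrite rtimeE// => hin.
    apply: is_derive_time; last exact: hT.
    have : d ^+ 2 * t < 0 by rewrite pmulr_rlt0//; lra.
    by move: hin; rewrite in_itv/=; have := ht0'; lra.
  have d1 : is_derive t 1 (fun s : R => t0 + d ^+ 2 * s) (d ^+ 2).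
    refine (dE (dD (dC t0 _ _) (dZ (d ^+ 2) (is_derive_id _ _))) _).
    by rewrite add0r mulr1.
  by refine (dE (dcomp d1 dt) _); rewrite mulrC.
- move=> x t; rewrite /rV' heq; last exact: rtime_in.
  by rewrite ru_powE mulrDr /rH /laplacian mulr_sumr.
Unshelve. all: by end_near.
Qed.

Lemma ru_pwF (x : R) : pwF p (dm * x) = dm `^ (p + 1) * pwF p x.
Proof.
have dm0 : 0 < dm by exact: powR_gt0.
by rewrite /pwF normrM gtr0_norm// powRM ?(ltW dm0).
Qed.

(** The relation [m * q = n] expresses that the weak norm is invariant under the scaling. *)
Lemma weak_ru (q M : R) : m * q = n%:R -> 0 < q -> 0 < M ->
  (forall t : R, -1 < t < 0 -> (weak_Lnorm q (u^~ t) <= M%:E)%E) ->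
  forall t, -2 < t < 0 -> forall r, 0 < r ->
    (lebesgue_rV [set x | (r < `|ru x t|)%R] <= ((M / r) `^ q)%:E)%E.
Proof.
move=> mq q0 M0 hM t ht r r0.
have dm0 : 0 < dm by exact: powR_gt0.
have ht1 : -1 < rtime t < 0.
  have := rtime_in t; rewrite in_itv/= rtimeE; last lra.
  have : d ^+ 2 * t < 0 by rewrite pmulr_rlt0//; lra.
  by have := ht0'; lra.
pose E := [set x : rV | r / dm < `|u x (rtime t)|].
have cu : continuous (u^~ (rtime t)).
  have [[cu _ _ _] _] := cs.
  apply: (strip_comp (fun z => u z.1 z.2) (fun x : rV => (x, rtime t)) cu).
    by apply: cpair; [move=> x B|exact: cC].
  by move=> w; split => //=; exact: rtime_in.
have mE : measurable E by exact: measurable_super.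
have -> : [set x | r < `|ru x t|] = affine_rV n d x0 @^-1` E.
  apply/seteqP; split => x; rewrite /E /= /ru normrM gtr0_norm// ltr_pdivrMr// [X in _ < X]mulrC => h; exact: h.
have dn0 : 0 < d ^+ n by exact: exprn_gt0.
rewrite -(@lee_pmul2l _ (d ^+ n)%:E)//.
rewrite lebesgue_rV_affine//.
have rd0 : 0 < r / dm by exact: divr_gt0.
have -> : ((d ^+ n)%:E * ((M / r) `^ q)%:E = ((M / (r / dm)) `^ q)%:E)%E.
  rewrite -EFinM; congr EFin.
  have -> : M / (r / dm) = dm * (M / r) by field; rewrite !gt_eqF.
  have Mr0 : 0 <= M / r by apply: divr_ge0; exact: ltW.
  rewrite (powRM q (ltW dm0) Mr0).
  by rewrite -powRrM mq powR_mulrn ?(ltW d0).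
have : ((r / dm)%:E * lebesgue_rV E `^ (q^-1)%R <= M%:E)%E.
  apply: le_trans (hM _ ht1); apply: ereal_sup_ubound.
  by exists (r / dm) => //=; rewrite in_itv/= andbT.
have mu0 : (0 <= lebesgue_rV E)%E by exact: measure_ge0.
(* A superlevel set of infinite measure would make the weak norm infinite. *)
case: (lebesgue_rV E) mu0 => [a| |] //; last first.
  by move=> _; rewrite poweRyr ?gt_eqF ?invr_gt0// gt0_muley ?lte_fin.
rewrite lee_fin poweR_EFin -EFinM !lee_fin => a0 h.
have h2 : a `^ q^-1 <= M / (r / dm) by rewrite ler_pdivlMr// mulrC.
have -> : a = (a `^ q^-1) `^ q by rewrite -powRrM mulVf ?gt_eqF// powRr1.
apply: ge0_ler_powR; rewrite ?nnegrE ?powR_ge0 ?(ltW q0)//.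
by apply: divr_ge0; exact: ltW.
Qed.
End rescale.

(* Monotonicity of the integral of nonnegative functions does not need measurability. *)
Lemma le_integral_patch {d} {T : measurableType d} {R : realType} (mu : {measure set T -> \bar R})
    (D E : set T) (f g : T -> \bar R) :
  (forall x, 0 <= f x)%E -> (forall x, 0 <= g x)%E ->
  (forall x, (f \_ D) x <= (g \_ E) x)%E ->
  (\int[mu]_(x in D) f x <= \int[mu]_(x in E) g x)%E.
Proof.
move=> f0 g0 fg; rewrite !ge0_integralE//.
apply/ge_ereal_sup => /= _ [h hf <-]; apply: ereal_sup_ubound => /=.
by exists h => // x; apply: le_trans (hf x) (fg x).
Qed.

(** * The smallness hypothesis in rescaled variables *)

Section budget.
Context {R : realType} {n : nat}.
Notation rV := 'rV[R]_n.
Variables (p : R) (u : rV -> R -> R).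
Hypothesis p1 : 1 < p.
Hypothesis cs : classical_solution p u.
Variables (x0 : rV) (t0 d A e : R).
Hypothesis ht0 : - (1 / 16) < t0.
Hypothesis ht0' : t0 <= 0.
Hypothesis d0 : 0 < d.
Hypothesis d14 : d < 1 / 4.
Hypothesis A0 : 0 < A.
Hypothesis hE : ((d `^ (4 / (p - 1) - n%:R))%:E *
      \int[lebesgue_measure]_(t in `[(t0 - d ^+ 2)%R, (t0 - d ^+ 2 / 2)%R])
        \int[@lebesgue_rV R n]_(x in eball x0 (A * d)%R)
          ((`|u x t| `^ (p + 1))%R)%:E <= e%:E)%E.
Notation m := (mexp p).
Notation dm := (d `^ m).
Notation v := (ru p u x0 t0 d).
Let sol := Sol_ru p u p1 cs x0 t0 d ht0 ht0' d0 d14.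
Let d20 : 0 < d ^+ 2. Proof. exact: exprn_gt0. Qed.

Let g (s : R) : R := I (fun y => cut 0 A y * pwF p (v y s)).
Let k (t : R) : R := g ((t - t0) / d ^+ 2).
(** An antiderivative of [g], written with the time integral in the original variable to match the
    hypothesis without a change of variables under that integral. *)
Let S (s : R) : R := (d ^+ 2)^-1 * \int[lebesgue_measure]_(t in `[t0 - d ^+ 2, t0 + d ^+ 2 * s]) k t.

Let cg : continuous g.
Proof.
move=> s; apply: (@I_cab_cont R n (fun y s => cut 0 A y * pwF p (v y s)) (s - 1) (s + 1) (`|0 : rV| + A)); [lra| | |lra].
- apply: cabM; first by apply: cab_const; exact: cut_cont.
  apply: cab_cont; apply: (ccomp (fun z : rV * R => v z.1 z.2) (pwF p)); last exact: pwF_cont.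
  exact: (sol_cu _ _ _ _ _ sol).
- by move=> r _ y hy; rewrite (cut_supp 0 A A0 y hy) mul0r.
Qed.

Let ck : continuous k.
Proof.
apply: (ccomp (fun t : R => (t - t0) / d ^+ 2) g); last exact: cg.
by apply: cM; [apply: cB; [move=> x; exact: cvg_id|exact: cC]|exact: cC].
Qed.

Let Cgs (s : R) : Cc (fun y => cut 0 A y * pwF p (v y s)).
Proof.
apply: CcMl; first exact: Cc_cut.
apply: (ccomp (fun y => v y s) (pwF p)); last exact: pwF_cont.
exact: cslice1 (sol_cu _ _ _ _ _ sol).
Qed.

Let k0 t : 0 <= k t.
Proof.
by apply: I_ge0 => y; apply: mulr_ge0; [exact: cut_ge0|exact: pwF_ge0].
Qed.

Let kint (a b : R) : lebesgue_measure.-integrable `[a, b]%classic (EFin \o k).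
Proof.
apply: continuous_compact_integrable; first exact: segment_compact.
exact: continuous_subspaceT.
Qed.

Lemma budget_deriv (s : R) : -1 < s -> is_derive s 1 S (g s).
Proof.
move=> hs; rewrite -[g s](mulKf (lt0r_neq0 d20)); apply: dZ; rewrite mulrC.
pose F (y : R) : R := \int[lebesgue_measure]_(t in `[t0 - d ^+ 2, y]) k t.
have h : t0 - d ^+ 2 < t0 + d ^+ 2 * s.
  by rewrite ltrD2l -mulN1r mulrC ltr_pM2l.
have [F1 F2] := @continuous_FTC1_closed R k (t0 - d ^+ 2) (t0 + d ^+ 2 * s) (t0 + d ^+ 2 * s + 1)
  ltac:(lra) (kint _ _) h (ck _).
have dF : is_derive (t0 + d ^+ 2 * s) 1 F (g s).
  have -> : g s = k (t0 + d ^+ 2 * s).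
    by rewrite /k; congr g; rewrite addrAC subrr add0r mulrC mulKf// lt0r_neq0.
  by split; [exact: F1|rewrite -F2 derive1E].
have d1 : is_derive s 1 (fun s : R => t0 + d ^+ 2 * s) (d ^+ 2).
  refine (dE (dD (dC t0 _ _) (dZ (d ^+ 2) (is_derive_id _ _))) _).
  by rewrite add0r mulr1.
exact: (dcomp d1 dF).
Qed.

Let kap0 : R := dm `^ (- (p + 1)) * d ^+ n.

(** Only the space variable is rescaled. The cutoff of radius A d is at most the indicator of the
    Euclidean ball in the hypothesis. *)
Let klow (t : R) : t0 - d ^+ 2 <= t <= t0 - d ^+ 2 / 2 ->
  ((kap0 * k t)%:E <= \int[@lebesgue_rV R n]_(x in eball x0 (A * d)%R) ((`|u x t| `^ (p + 1))%R)%:E)%E.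
Proof.
move=> ht.
have ts : rtime t0 d ((t - t0) / d ^+ 2) = t.
  have q : -2 <= (t - t0) / d ^+ 2 <= 0.
    apply/andP; split; last by rewrite ler_pdivrMr// mul0r; have := d20; lra.
    by rewrite ler_pdivlMr//; have := d20; lra.
  by rewrite rtimeE//; field; rewrite lt0r_neq0.
have dm0 : 0 < dm by exact: powR_gt0.
have Ad0 : 0 < A * d by exact: mulr_gt0.
have cu : continuous (fun x => pwF p (u x t)).
  apply: (ccomp (fun x => u x t) (pwF p)); last exact: pwF_cont.
  have [[cu _ _ _] _] := cs.
  apply: (strip_comp (fun z => u z.1 z.2) (fun x : rV => (x, t)) cu).
    by apply: cpair; [move=> x B|exact: cC].
  by move=> w; split => //=; rewrite -ts; exact: rtime_in.
pose f x := cut x0 (A * d) x * pwF p (u x t).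
have Cf : Cc f by apply: CcMl => //; exact: Cc_cut.
have kE : kap0 * k t = I f.
  have Cf' := @Cc_translate R n f x0 d d0 Cf.
  have kt : k t = dm `^ (p + 1) * I (fun x => f (d *: x + x0)).
    rewrite -I_Z//; apply: I_ext => y; rewrite /ru ts ru_pwF// /f mulrCA; congr (_ * (_ * _)).
    rewrite /cut; congr chi; rewrite /sq !mulr_suml; apply: eq_bigr => i _; rewrite !mxE.
    by field; rewrite !gt_eqF.
  have P0 : dm `^ (p + 1) != 0 by rewrite gt_eqF// powR_gt0.
  by rewrite -[RHS](@I_affine R n f x0 d d0 Cf) kt /kap0 powRN; field.
rewrite kE.
have -> : (I f)%:E = (\int[@lebesgue_rV R n]_x (f x)%:E)%E.
  by rewrite /I /Rintegral fineK//; exact: integrable_fin_num (Cc_integrable _ Cf).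
apply: le_integral_patch => x.
- by rewrite lee_fin mulr_ge0 ?cut_ge0 ?pwF_ge0.
- by rewrite lee_fin powR_ge0.
- rewrite patch_setT patchE; case: ifPn => hx.
    by rewrite lee_fin /f ler_piMl ?cut_le1 ?pwF_ge0.
  rewrite /f cut_out ?mul0r//.
  move: hx; rewrite notin_setE /eball /= => /negP; rewrite -leNgt => hx.
  have -> : sq x0 x = enorm (x0 - x) ^+ 2.
    rewrite sqr_sqrtr; last by apply: sumr_ge0 => i _; exact: sqr_ge0.
    by apply: eq_bigr => i _; rewrite !mxE -sqrrN opprB.
  by apply: lerXn2r; rewrite ?nnegrE ?sqrtr_ge0// ltW.
Qed.

Lemma budget_bound (s : R) : -1 < s < - (1 / 2) -> 0 <= S s <= e.
Proof.
move=> hs.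
have dm0 : 0 < dm by exact: powR_gt0.
have kp0 : 0 <= kap0 by rewrite mulr_ge0 ?powR_ge0 ?exprn_ge0 ?ltW.
set J := `[(t0 - d ^+ 2)%R, (t0 + d ^+ 2 * s)%R]%classic.
have S0 : 0 <= S s.
  apply: mulr_ge0; first by rewrite invr_ge0 ltW.
  by apply: Rintegral_ge0.
rewrite S0 /=.
have SE : ((d ^+ 2 * S s)%:E = \int[lebesgue_measure]_(t in J) (k t)%:E)%E.
  rewrite /S mulVKf ?lt0r_neq0// /Rintegral fineK//.
  exact: integrable_fin_num (kint _ _).
have h1 : (kap0%:E * (d ^+ 2 * S s)%:E <=
     \int[lebesgue_measure]_(t in `[(t0 - d ^+ 2)%R, (t0 - d ^+ 2 / 2)%R])
        \int[@lebesgue_rV R n]_(x in eball x0 (A * d)%R) ((`|u x t| `^ (p + 1))%R)%:E)%E.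
  rewrite SE -ge0_integralZl_EFin//; last first.
  - by apply/measurable_EFinP; apply: measurable_funTS; exact: continuous_measurable_fun.
  - by move=> t _; rewrite lee_fin.
  - exact: measurable_itv.
  apply: le_integral_patch => t.
  - by rewrite -EFinM lee_fin mulr_ge0.
  - by apply: integral_ge0 => x _; rewrite lee_fin powR_ge0.
  - rewrite !patchE; case: ifPn => [/set_mem|_].
      rewrite /J /= in_itv/= => hJ.
      have : d ^+ 2 * s <= d ^+ 2 * (- (1 / 2)) by rewrite ler_wpM2l ?(ltW d20)//; lra.
      move=> hJ2; rewrite mem_set; last by rewrite /= in_itv/=; lra.
      by rewrite -EFinM; apply: klow; lra.
    case: ifPn => // _; apply: integral_ge0 => x _; by rewrite lee_fin powR_ge0.
rewrite -lee_fin; apply: le_trans hE.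
have d4 : (0 <= (d `^ (4 / (p - 1) - n%:R))%:E :> \bar R)%E by rewrite lee_fin powR_ge0.
apply: le_trans (lee_wpmul2l d4 h1); rewrite -!EFinM lee_fin.
rewrite le_eqVlt; apply/orP; left; apply/eqP.
rewrite /kap0 -!powR_mulrn ?(ltW d0)// -powRrM !mulrA -!powRD ?(gt_eqF d0) ?implybT//.
have mE := mexpE p p1.
rewrite (_ : _ + 2%:R = 0) ?powRr0 ?mul1r//.
(* The powers of d cancel because 2m - m(p+1) + 2 = 2 - m(p-1) = 0. *)
have -> : 4 / (p - 1) = 2 * m by rewrite /mexp /kap; field; rewrite gt_eqF//; have := p1; lra.
by move: mE; lra.
Qed.

Lemma budget_ex : exists S : R -> R,
  (forall t : R, -1 < t < - (1 / 2) -> is_derive t 1 S (I (fun x => cut 0 A x * pwF p (v x t)))) /\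
  (forall t, -1 < t < - (1 / 2) -> 0 <= S t <= e).
Proof.
by exists S; split => [t ht|]; [apply: budget_deriv; lra|exact: budget_bound].
Qed.
End budget.

Lemma Linfty_norm_on_le {R : realType} {n : nat} (Q : set ('rV[R]_n * R)) (g : 'rV[R]_n * R -> R) (B : R) :
  0 <= B -> (forall z, Q z -> `|g z| <= B) -> (Linfty_norm_on Q g <= B%:E)%E.
Proof.
(* The norm is defined by cases on whether the measure of the space is positive, with default 0. *)
move=> B0 h; rewrite /Linfty_norm_on unlock; case: ifP => _; last by rewrite lee_fin.
apply/ess_supP; apply: aeW => z /=.
rewrite lee_fin normrM indicE; case: (boolP (z \in Q)) => [/set_mem/h|_].
  by rewrite normr1 mulr1.
by rewrite normr0 mulr0.
Qed.

Lemma enorm_le {R : realType} {n : nat} (x : 'rV[R]_n) (B : R) : (0 < n)%N ->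
  (forall i, `|x ord0 i| <= B) -> enorm x <= n%:R * B.
Proof.
move=> n0 h; have B0 : 0 <= B by apply: le_trans (h (Ordinal n0)).
have n1 : 1 <= n%:R :> R by rewrite ler1n.
have nB0 : 0 <= n%:R * B by rewrite mulr_ge0// ler0n.
rewrite /enorm -[leRHS]ger0_norm// -sqrtr_sqr ler_wsqrtr//.
apply: (@le_trans _ _ (\sum_(i < n) B ^+ 2)).
  apply: ler_sum => i _; rewrite -real_normK ?num_real//.
  by apply: lerXn2r; rewrite ?nnegrE.
rewrite sumr_const card_ord -[leLHS]mulr_natl exprMn ler_wpM2r ?sqr_ge0//.
by rewrite expr2 ler_peMr// ler0n.
Qed.

Theorem proposition7 (R : realType) (n : nat) (p : R)
    (hn : (3 <= n)%N) (hp : (n%:R + 2) / (n%:R - 2) < p) :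
  exists C e1 : R, [/\ 0 < C, 0 < e1, e1 < 1 &
  forall (u : 'rV[R]_n -> R -> R) (M : R),
    classical_solution p u ->
    1 < M ->
    (ereal_sup [set weak_Lnorm (n%:R * (p - 1) / 2)%R (u^~ t)
                | t in `](-1)%R, 0%R[%classic] <= M%:E)%E ->
  forall e : R,
    0 < e -> e < M `^ (- 2 * (p + 1) ^+ 2) * e1 `^ (2 * (p + 1)) ->
  forall (x0 : 'rV[R]_n) (t0 delta A : R),
    - (1 / 16) < t0 -> t0 <= 0 ->
    0 < delta -> delta < 1 / 4 ->
    Num.sqrt (24 * ln (M `^ (p + 1) / e)) < A ->
    ((delta `^ (4 / (p - 1) - n%:R))%:E *
      \int[lebesgue_measure]_(t in `[(t0 - delta ^+ 2)%R, (t0 - delta ^+ 2 / 2)%R])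
        \int[@lebesgue_rV R n]_(x in eball x0 (A * delta)%R)
          ((`|u x t| `^ (p + 1))%R)%:E <= e%:E)%E ->
    (Linfty_norm_on (pcylinder (x0, t0) (delta / 4)) (fun z => u z.1 z.2)
       <= (C * M * e `^ (1 / (2 * (p + 1) ^+ 2))
             * delta `^ (- (2 / (p - 1))))%:E)%E /\
    (Linfty_norm_on (pcylinder (x0, t0) (delta / 4))
         (fun z => enorm (gradient (u^~ z.2) z.1))
       <= (C * M * e `^ (1 / (2 * (p + 1) ^+ 2))
             * delta `^ (- ((p + 1) / (p - 1))))%:E)%E].
Proof.
have n3 : 3 <= n%:R :> R by rewrite (ler_nat R 3).
(* Supercriticality enters here: p > p_S means q_c > p + 1, so that the weak norm controls local
   integrals of |u|^(p+1). *)
have [p1 pq] : 1 < p /\ p + 1 < n%:R * (p - 1) / 2.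
  have hp' : n%:R + 2 < p * (n%:R - 2) by rewrite -ltr_pdivrMr//; lra.
  have p1 : 1 < p.
    rewrite ltNge; apply/negP => hp1.
    have : p * (n%:R - 2) <= 1 * (n%:R - 2) by rewrite ler_wpM2r//; lra.
    by lra.
  by split => //; lra.
have [C [e0 [C0 e00 e01 main]]] := @scaled_bound R n p _ p1 pq.
(* The factor n passes from partial derivatives to the Euclidean norm of the gradient; halving [e0]
   makes the second constant less than 1. *)
exists (n%:R * C), (e0 / 2); split; [by apply: mulr_gt0 => //; lra|lra|lra|].
move=> u M cs M1 hM e ep he x0 t0 d A ht0 ht0' d0 d14 hA hE.
have M0 : 0 < M by lra.
have p10 : 0 < p + 1 by lra.
(* The power of M has negative exponent, so it is at most 1, and [e0 / 2] < 1 is raised to an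
   exponent larger than 1. *)
have ee0 : e < e0.
  apply: lt_le_trans he _.
  apply: (@le_trans _ _ (1 * (e0 / 2))); last lra.
  apply: ler_pM; rewrite ?powR_ge0//.
    rewrite -[leRHS](powRr0 M); apply: ler_powR; first lra.
    by rewrite mulNr oppr_le0 mulr_ge0// sqr_ge0.
  by apply: ge1r_powR; lra.
have A0 : 0 < A by apply: le_lt_trans hA; exact: sqrtr_ge0.
have hAA : 24 * ln (M `^ (p + 1) / e) < A ^+ 2.
  (* [Num.sqrt] is 0 on negative arguments, so squaring the hypothesis on [A] depends on the
     sign. *)
  have [neg|pos] := ltP (24 * ln (M `^ (p + 1) / e)) 0.
    by apply: lt_trans neg _; exact: exprn_gt0.
  by rewrite -(sqr_sqrtr pos); apply: ltrXn2r => //; rewrite ?nnegrE ?sqrtr_ge0 ?ltW.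
have q0 : 0 < n%:R * (p - 1) / 2 by lra.
have mq : mexp p * (n%:R * (p - 1) / 2) = n%:R.
  transitivity (n%:R * (mexp p * (p - 1)) / 2); first by ring.
  by rewrite mexpE//; field.
have hw (t : R) : -1 < t < 0 -> (weak_Lnorm (n%:R * (p - 1) / 2) (u^~ t) <= M%:E)%E.
  move=> ht; apply: le_trans hM; apply: ereal_sup_ubound.
  by exists t => //=; rewrite in_itv.
have sol := Sol_ru p u p1 cs x0 t0 d ht0 ht0' d0 d14.
have [S [hS1 hS2]] := budget_ex p u p1 cs x0 t0 d A e ht0 ht0' d0 d14 A0 hE.
have weak := weak_ru p u cs x0 t0 d ht0 ht0' d0 d14 _ M mq q0 M0 hw.
have bound := main _ _ _ _ M e A S sol M1 (andb_true_intro (conj ep ee0)) A0 hAA weak hS1 hS2.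
set z := e `^ (1 / (p + 1) ^+ 2) in bound.
set z2 := e `^ (1 / (2 * (p + 1) ^+ 2)).
(* The exponent obtained is twice the required one, and e < 1. *)
have zz : z <= z2.
  apply: ger_powR; first by rewrite ep /=; clear -ee0 e01; lra.
  by rewrite !div1r lef_pV2 ?posrE ?mulr_gt0 ?exprn_gt0// ler_peMl ?exprn_ge0 ?ler1n// ltW.
have z0 : 0 <= z by exact: powR_ge0.
set dm := d `^ (mexp p).
have dm0 : 0 < dm by exact: powR_gt0.
have mE : 2 / (p - 1) = mexp p by rewrite /mexp /kap; field; rewrite gt_eqF//; clear -p1; lra.
have d2E : d `^ (- (2 / (p - 1))) = dm^-1 by rewrite powRN mE.
have d3E : d `^ (- ((p + 1) / (p - 1))) = (dm * d)^-1.
  rewrite powRN (_ : (p + 1) / (p - 1) = mexp p + 1).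
    by rewrite powRD ?powRr1 ?(ltW d0)// (gt_eqF d0) implybT.
  by rewrite -mE; field; rewrite gt_eqF//; clear -p1; lra.
have Cz : C * z <= C * M * z2.
  rewrite -mulrA ler_pM2l//; apply: le_trans zz _.
  by rewrite ler_peMl ?powR_ge0// ltW.
have Cz0 : 0 <= C * M * z2 by rewrite !mulr_ge0 ?powR_ge0// ltW.
have dd0 : 0 < d ^+ 2 by exact: exprn_gt0.
have point (w : 'rV[R]_n * R) : pcylinder (x0, t0) (d / 4) w ->
    `|u w.1 w.2| <= C * M * z2 * dm^-1 /\
    forall i, `|partial i (u^~ w.2) w.1| <= C * M * z2 * (dm * d)^-1.
  case: w => x t [/= hx]; rewrite in_itv/= => ht.
  have hx' : `|x - x0| <= d / 4.
    apply: norm_sq; first by clear -d0; lra.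
    have -> : sq x0 x = enorm (x0 - x) ^+ 2.
      rewrite sqr_sqrtr; last by apply: sumr_ge0 => i _; exact: sqr_ge0.
      by apply: eq_bigr => i _; rewrite !mxE -sqrrN opprB.
    by apply: lerXn2r; rewrite ?nnegrE ?sqrtr_ge0 ?(ltW hx)//; clear -d0; lra.
  pose y := d^-1 *: (x - x0); pose s := (t - t0) / d ^+ 2.
  have yx : d *: y + x0 = x by rewrite scalerA divff ?gt_eqF// scale1r subrK.
  have hy : `|y| <= 1 / 4.
    rewrite normrZ gtr0_norm ?invr_gt0// ler_pdivrMl//; clear -hx'; lra.
  have hs : - (1 / 16) <= s < 0.
    apply/andP; split; last by rewrite ltr_pdivrMr// mul0r; clear -ht; lra.
    rewrite ler_pdivlMr//.
    have : (d / 4) ^+ 2 = d ^+ 2 / 16 by field.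
    by clear -ht; lra.
  have ts : rtime t0 d s = t.
    by rewrite rtimeE; [rewrite /s; field; rewrite gt_eqF|clear -hs; lra].
  have [b1 b2] := bound y s hy hs; split.
    rewrite ler_pdivlMr// mulrC; apply: le_trans Cz; apply: le_trans b1.
    by rewrite /ru yx ts normrM (gtr0_norm dm0).
  move=> i; have dmd : 0 < dm * d by exact: mulr_gt0.
  rewrite ler_pdivlMr// mulrC; apply: le_trans Cz; apply: le_trans (b2 i).
  by rewrite /rG yx ts normrM (gtr0_norm dmd).
have n1 : 1 <= n%:R :> R by clear -n3; lra.
have nCE (r : R) : n%:R * C * M * z2 * r = n%:R * (C * M * z2 * r) by ring.
have nonneg (r : R) : 0 < r -> 0 <= C * M * z2 * r^-1.
  by move=> r0; apply: divr_ge0 => //; exact: ltW.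
have dmd : 0 < dm * d by exact: mulr_gt0.
split; apply: Linfty_norm_on_le; rewrite ?d2E ?d3E nCE.
- by apply: mulr_ge0; [exact: ler0n|exact: nonneg].
- move=> w /point [h _]; apply: le_trans h _.
  by rewrite ler_peMl// nonneg.
- by apply: mulr_ge0; [exact: ler0n|exact: nonneg].
- move=> w /point [_ h]; rewrite ger0_norm ?sqrtr_ge0//.
  apply: enorm_le; first exact: leq_trans hn.
  by move=> i; rewrite mxE.
Qed.
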